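(* Let $n\in\mathbb{Z}$, $n\neq0$, and let $D(\tau)$ denote the divisor of the torsion function $\tau$ on the variety $X^{\rm irr}(W_{2n-1})$ of irreducible $\mathrm{SL}_2(\mathbb{C})$-characters of the odd-twisted Whitehead link $W_{2n-1}$. Then $D(\tau)$ has multiplicity two on the geometric component, whereas on any other component either $D(\tau)$ has multiplicity one or $\tau$ vanishes identically.
   Context: Link and characters. $\pi_1(S^3-W_{2n-1})=\langle m,\mu\mid m\omega=\omega m\rangle$ with $\omega=(\mu m\mu^{-1}m^{-1})^n\,m\,(m^{-1}\mu^{-1}m\mu)^n$, where $m,\mu$ are meridians of the two components. Put $x=\mathrm{Tr}\,m$, $y=\mathrm{Tr}\,\mu$, $z=\mathrm{Tr}\,m\mu$, $v=x^2+y^2+z^2-xyz-2$. Let $S_k(v)$ ($k\in\mathbb{Z}$) be defined by $S_0=1$, $S_1=v$, $S_{k+2}=vS_{k+1}-S_k$, and $f_n=xy\,S_{n-1}(v)-(xy-z)S_{n-2}(v)-z\,S_n(v)$. The character variety is $\{(v-2)f_nS_{n-1}(v)=0\}\subset\mathbb{C}^3$, and $X^{\rm irr}(W_{2n-1})=\{f_nS_{n-1}(v)=0\}\setminus\{v=2\}$. The geometric component (containing the class of the holonomy representations of the complete hyperbolic structure) is given by $f_n=0$; the other components are $v=2\cos\frac{j\pi}{n}$, $0<j<|n|$. Torsion. For $\rho:\pi_1(M)\to \mathrm{SL}_2(\mathbb{C})$ with $M$ the link exterior, $C_*(M,\rho)=\mathbb{C}^2\otimes_{\mathbb{Z}[\pi_1(M)]}C_*(\widetilde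 M)$ ($\mathbb{C}^2$ a right module via $g\mapsto\rho(g^{-1})$); $\rho$ is acyclic if its homology vanishes. The Reidemeister torsion of acyclic $\rho$ is, up to sign, $\prod_i[\mathfrak b_i\sqcup\widetilde{\mathfrak b}_{i-1}:\mathfrak c_i]^{(-1)^{i+1}}$, where $\mathfrak c_i$ is the basis of $C_i(M,\rho)$ given by a basis of $\mathbb{C}^2$ tensored with lifts of cells, $\mathfrak b_i$ is a basis of the image of $\partial_{i+1}$, and $\widetilde{\mathfrak b}_{i-1}$ is a lift of $\mathfrak b_{i-1}$ to $C_i(M,\rho)$. The torsion function $\tau$ takes these values at acyclic characters and is zero at non-acyclic irreducible characters. It is known (Nguyen–Tran) to be given by $\tau_n=(2-x-y+z)S_{n-1}(v)+(4-2x-2y+xy)P_{n-2}(v)$ with $P_k(v)=(S_{k+1}(v)-S_k(v)-1)/(v-2)\in\mathbb{Z}[v]$. Divisor. For a polynomial function $P$ on a smooth surface $X$ with $X\cap\{P=0\}=C_1\cup\dots\cup C_r$ the irreducible decomposition, $D(P)=\sum m_iC_i$ with $m_i$ the order of vanishing of $P$ along $C_i$; ''$D(P)$ has multiplicity $k$'' means all $m_i=k$. *)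

(* Defs.v *)
From HB Require Import structures.
From mathcomp Require Import all_boot all_order all_algebra.
From mathcomp Require Import reals complex mpoly.

Set Implicit Arguments.
Unset Strict Implicit.
Unset Printing Implicit Defensive.
Import GRing.Theory.
Local Open Scope ring_scope.

(** * Words in the free group on the two meridians *)

Definition mer_m : bool := false.
Definition mer_mu : bool := true.

(* The letter (g, false) is the generator g, the letter (g, true) is g^-1. *)
Definition word := seq (bool * bool).

Definition word_inv (w : word) : word :=
  rev [seq (l.1, ~~ l.2) | l <- w].

Definition word_pow (w : word) (k : int) : word :=
  match k with
  | Posz j => flatten (nseq j w)
  | Negz j => flatten (nseq j.+1 (word_inv w))
  end.

(* omega = (mu m mu^-1 m^-1)^n m (m^-1 mu^-1 m mu)^n *)
Definition omega (n : int) : word :=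
  word_pow [:: (mer_mu, false); (mer_m, false); (mer_mu, true); (mer_m, true)] n
  ++ [:: (mer_m, false)]
  ++ word_pow
       [:: (mer_m, true); (mer_mu, true); (mer_m, false); (mer_mu, false)] n.

(* m omega m^-1 omega^-1 *)
Definition relator (n : int) : word :=
  [:: (mer_m, false)] ++ omega n ++ [:: (mer_m, true)] ++ word_inv (omega n).

Section Evaluation.
Variables (F : fieldType) (rho : bool -> 'M[F]_2).

Fixpoint word_eval (w : word) : 'M[F]_2 :=
  match w with
  | [::] => 1%:M
  | (h, e) :: w' => (if e then invmx (rho h) else rho h) *m word_eval w'
  end.

(* The image under rho of the Fox derivative dw/dg, computed from
   d(h u)/dg = dh/dg + h du/dg and d(h^-1 u)/dg = - h^-1 dh/dg + h^-1 du/dg. *)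
Fixpoint fox (g : bool) (w : word) : 'M[F]_2 :=
  match w with
  | [::] => 0
  | (h, e) :: w' =>
      let dh : 'M[F]_2 := if h == g then 1%:M else 0 in
      if e then invmx (rho h) *m (fox g w' - dh) else dh + rho h *m fox g w'
  end.

End Evaluation.

(** * Representations and characters *)

Section Representations.
Variable F : fieldType.
Implicit Types (n : int) (rho : bool -> 'M[F]_2).

(* A representation of < m, mu | m omega = omega m > in SL_2(F) is given by the
   images of the two generators. *)
Definition is_rep n rho : Prop :=
  (forall g, \det (rho g) = 1) /\ word_eval rho (relator n) = 1%:M.

(* No line of F^2 is invariant. *)
Definition irreducible_rep rho : Prop :=
  forall u : 'cV[F]_2,
    (forall g, exists a : F, rho g *m u = a *: u) -> u = 0.

(* (x, y, z) = (Tr m, Tr mu, Tr (m mu)) *)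
Definition char_of rho : 3.-tuple F :=
  [tuple \tr (rho mer_m); \tr (rho mer_mu); \tr (rho mer_m *m rho mer_mu)].

Definition Xirr n (p : 3.-tuple F) : Prop :=
  exists rho, [/\ is_rep n rho, irreducible_rep rho & p = char_of rho].

End Representations.

(** * The geometric component *)

Section Chebyshev.
Variable A : comNzRingType.

Fixpoint cheb_nat (v : A) (k : nat) : A :=
  match k with
  | 0 => 1
  | k'.+1 => match k' with
             | 0 => v
             | k''.+1 => v * cheb_nat v k' - cheb_nat v k''
             end
  end.

(* S_(-1) = 0 and S_(-k-2) = - S_k. *)
Definition cheb (v : A) (k : int) : A :=
  match k with
  | Posz j => cheb_nat v j
  | Negz 0 => 0
  | Negz j.+1 => - cheb_nat v j
  end.

Lemma cheb0 v : cheb v 0 = 1. Proof. by []. Qed.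

Lemma cheb1 v : cheb v 1 = v. Proof. by []. Qed.

Lemma chebSS v (k : int) : cheb v (k + 2) = v * cheb v (k + 1) - cheb v k.
Proof.
case: k => [j|[|[|[|j]]]].
- by rewrite -!PoszD addn2 addn1.
- by change (v = v * 1 - 0); rewrite mulr1 subr0.
- by change (1 = v * 0 - (- 1) :> A); rewrite mulr0 sub0r opprK.
- by change (0 = v * (- 1) - (- v)); rewrite mulrN1 opprK addNr.
change (- cheb_nat v j
        = v * (- cheb_nat v j.+1) - (- (v * cheb_nat v j.+1 - cheb_nat v j))).
by rewrite mulrN opprK addKr.
Qed.

Definition trv (x y z : A) : A := x ^+ 2 + y ^+ 2 + z ^+ 2 - x * y * z - 2%:R.

Definition fW (n : int) (x y z : A) : A :=
  let v := trv x y z in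
  x * y * cheb v (n - 1) - (x * y - z) * cheb v (n - 2) - z * cheb v n.

End Chebyshev.

Definition coord (F : fieldType) (p : 3.-tuple F) (i : nat) : F := nth 0 p i.

(* The subvariety f_n = 0 of Xirr n, which contains the characters of the
   holonomy of the complete hyperbolic structure. *)
Definition geometric (F : fieldType) (n : int) (p : 3.-tuple F) : Prop :=
  Xirr n p /\ fW n (coord p 0) (coord p 1) (coord p 2) = 0.

(** * Reidemeister torsion *)

Section Torsion.
Variable F : fieldType.

(* Based complexes 0 -> F^2 -> F^4 -> F^2 -> 0; the matrices act on row vectors
   from the right. *)
Definition acyclic (d2 : 'M[F]_(2, 2 + 2)) (d1 : 'M[F]_(2 + 2, 2)) : Prop :=
  [/\ row_free d2, (d2 == kermx d1)%MS & row_full d1].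

(* The bases b_i of the images of d_(i+1) are the rows of matrices, bt_i is the
   lift of b_i, and t is the alternating product of the determinants
   [b_i, bt_(i-1) : c_i]; b_2 and bt_(-1) are empty. *)
Definition torsion_value (d2 : 'M[F]_(2, 2 + 2)) (d1 : 'M[F]_(2 + 2, 2))
    (t : F) : Prop :=
  exists (b0 : 'M[F]_2) (bt0 : 'M[F]_(2, 2 + 2))
         (b1 : 'M[F]_(2, 2 + 2)) (bt1 : 'M[F]_2),
    [/\ row_free b0 && (b0 == d1)%MS, bt0 *m d1 = b0,
        row_free b1 && (b1 == d2)%MS, bt1 *m d2 = b1
      & t = (\det b0)^-1 * \det (col_mx b1 bt0) * (\det bt1)^-1].

(* The right action g |-> rho(g^-1) on column vectors, written on row vectors. *)
Definition right_action (rho : bool -> 'M[F]_2) (g : bool) : 'M[F]_2 :=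
  (invmx (rho g))^T.

(* The link exterior collapses onto the 2-complex of the presentation, with one
   0-cell, 1-cells m and mu, and one 2-cell attached along the relator; the
   boundary operators of its universal cover are given by Fox calculus. *)
Definition bd2 (n : int) (rho : bool -> 'M[F]_2) : 'M[F]_(2, 2 + 2) :=
  row_mx (fox (right_action rho) mer_m (relator n))
         (fox (right_action rho) mer_mu (relator n)).

Definition bd1 (rho : bool -> 'M[F]_2) : 'M[F]_(2 + 2, 2) :=
  col_mx (right_action rho mer_m - 1%:M) (right_action rho mer_mu - 1%:M).

(* C^2 has even dimension and det rho = 1, so the orderings, orientations and
   lifts of the cells do not affect the sign of the torsion. *)
Definition is_torsion (n : int) (rho : bool -> 'M[F]_2) (t : F) : Prop :=
  (acyclic (bd2 n rho) (bd1 rho) -> torsion_value (bd2 n rho) (bd1 rho) t) /\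
  (~ acyclic (bd2 n rho) (bd1 rho) -> t = 0).

(* T is a polynomial in x, y, z whose restriction to Xirr n is the torsion
   function. *)
Definition is_torsion_function (n : int) (T : {mpoly F[3]}) : Prop :=
  forall rho, is_rep n rho -> irreducible_rep rho ->
    is_torsion n rho T.@[tnth (char_of rho)].

End Torsion.

(** * Zariski topology and divisors in affine 3-space *)

Section Divisors.
Variable F : fieldType.
Implicit Types (X Y Z C : 3.-tuple F -> Prop) (P : {mpoly F[3]}).
Implicit Types J : {mpoly F[3]} -> Prop.

Definition subset_of X Y : Prop := forall p, X p -> Y p.

Definition zclosed Z : Prop :=
  exists S : {mpoly F[3]} -> Prop,
    forall p, Z p <-> (forall P, S P -> P.@[tnth p] = 0).

Definition zirreducible Y : Prop :=
  (exists p, Y p) /\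
  forall Z1 Z2, zclosed Z1 -> zclosed Z2 ->
    (forall p, Y p -> Z1 p \/ Z2 p) -> subset_of Y Z1 \/ subset_of Y Z2.

Definition irr_component X Y : Prop :=
  [/\ subset_of Y X, zirreducible Y
    & forall Y', zirreducible Y' -> subset_of Y' X -> subset_of Y Y' ->
        subset_of Y' Y].

Definition vanishing_ideal X P : Prop := forall p, X p -> P.@[tnth p] = 0.

Fixpoint ideal_pow J (k : nat) (P : {mpoly F[3]}) : Prop :=
  match k with
  | 0 => True
  | k'.+1 => exists s : seq ({mpoly F[3]} * {mpoly F[3]}),
      (forall u, u \in s -> J u.1 /\ ideal_pow J k' u.2) /\
      P = \sum_(u <- s) u.1 * u.2
  end.

(* The germ of P lies in the k-th power of the maximal ideal of the local ring
   of X along C, which is the localization of F[x,y,z] / I(X) at I(C). *)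
Definition in_max_pow X C P (k : nat) : Prop :=
  exists s a b : {mpoly F[3]},
    [/\ ~ vanishing_ideal C s, ideal_pow (vanishing_ideal C) k a,
        vanishing_ideal X b & s * P = a + b].

(* When X is a smooth surface and C a curve in X, this local ring is a discrete
   valuation ring and k is the valuation of P. *)
Definition order_along X C P (k : nat) : Prop :=
  in_max_pow X C P k /\ ~ in_max_pow X C P k.+1.

Definition vanishes_on X P : Prop := vanishing_ideal X P.

Definition divisor_has_multiplicity X P (k : nat) : Prop :=
  ~ vanishes_on X P /\
  forall C, irr_component (fun p => X p /\ P.@[tnth p] = 0) C ->
    order_along X C P k.

End Divisors.

(* No irreducible component contains another one, so a component other than the
   geometric one is a component not contained in it. *)
Definition other_component (F : fieldType) (n : int)
    (Y : 3.-tuple F -> Prop) : Prop :=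
  irr_component (Xirr n) Y /\ ~ subset_of Y (geometric n).

(* Main.v *)
Require Import Defs.
From mathcomp Require Import all_boot all_order all_algebra.
From mathcomp Require Import reals complex mpoly.
From mathcomp Require Import boolp ring zify.
Import Defs.

(** Throughout, S = S_(n-1)(v), w = v - 2, P is the polynomial in v with w P =
    S_(n-1)(v) - S_(n-2)(v) - 1, d = 1 + w P, and T = w S + 2 d, which is the
    trace of the n-th power of the commutator of the meridians. The Cassini
    identity of the Chebyshev polynomials reads S^2 = S + 2 P + w P^2 + w S P,
    and the polynomial f_n is xy d - z T. The identities between functions on
    the character variety are proved modulo these two relations.

    Characters. Write a, b for the images of m, mu. The determinant of [a, b]
    is 2 - v, so a representation is irreducible exactly when v differs from
    2, and then 1, a, b, ab is a basis of the 2 x 2 matrices. In this basis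
    the image of omega has coefficient S f_n on b and 0 on ab ([omega_eval]);
    hence it commutes with a if and only if S f_n = 0, which is the equation
    of the character variety ([XirrP]).

    Torsion. For the right action used in the chain complex, a and b are
    replaced by the transposes of their inverses, which have the same traces.
    The chain (1 - b, a - 1) is mapped by the boundary to [a, b], which is
    invertible, so the torsion is a 4 x 4 determinant divided by det [a, b]
    ([torsion_valueP]). A row operation replaces the Fox derivatives of the
    relator by commutators of a with the Fox derivatives of omega, and the
    quotient becomes the determinant of one 2 x 2 matrix, which equals 2 tau
    on the character variety, tau being the formula of Nguyen and Tran
    ([torsion_norm_identity], [is_torsionE]).

    The components v = c. Such a component has S(c) = 0 ([other_componentP]),
    and on it tau = (2 - x) (2 - y) P(c). Either P(c) = 0 and tau vanishes, or
    the zeros of tau are lines x = 2, z = y + s or y = 2, z = x + s with s^2 =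
    c - 2, where 2 - x or 2 - y vanishes to first order.

    The geometric component. On f_n = 0 one has (T + 2) d tau = S^2 E with E
    linear in x + y and z over the polynomials in v ([tau_factor]). If Eb
    denotes E at (-x, -y), then E Eb = - w H^2, where H = (T + 2) z + (v + 2)
    d ([E_norm]). The double zeros come from these two squares. The zero set
    of tau consists of the curve Gamma, where E = H = 0 and S is not zero, and
    of the curves v = c, xy = 2 z with S(c) = P(c) = 0 ([zero_locus],
    [zero_locus_S0]). Along Gamma, Eb does not vanish identically, so tau has
    the order of H^2, which is 2; along the curves v = c, E does not vanish
    identically and c is a simple root of S, so tau has the order of S^2,
    which is 2 again.

    Irreducibility. The zero curves and the surfaces v = c are lines or double
    covers t^2 = Delta of a line or a plane. The norm of a + b t is a^2 - b^2
    Delta; when Delta is not a square, a product of two functions can only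
    vanish on the cover if one of the factors does ([prime_double_cover]).
    Delta is seen not to be a square from its odd degree or from a simple
    root.

    Orders. The identities above show that the order is at least the stated
    one. For the converse, take a generic point q of the curve C, and points
    of the surface at distance O(e) from q at which the function is at least c
    e^k: an element of the (k+1)-st power of the ideal of C is O(e^(k+1))
    there, so the order is at most k ([order_upper]). The test points are
    found by solving quadratic equations with nearby solutions
    ([surface_lift], [geom_lift]). *)

Set Implicit Arguments.
Unset Strict Implicit.
Unset Printing Implicit Defensive.
Import Order.TTheory GRing.Theory Num.Theory.
Local Open Scope ring_scope.

(** * Chebyshev identities *)

Section ChebyshevIdentities.
Variable A : comNzRingType.
Implicit Types (v : A) (n : int).

Lemma cheb_rec v (k : int) : cheb v k = v * cheb v (k - 1) - cheb v (k - 2).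
Proof. by rewrite -{1}[k](subrK 2) chebSS; congr (_ * cheb v _ - _); ring. Qed.

(** The left-hand side is invariant under k |-> k + 1, by the recurrence, and
    is 1 at k = 0. *)
Lemma cheb_cassini v (k : int) :
  cheb v k ^+ 2 + cheb v (k - 1) ^+ 2 - v * cheb v k * cheb v (k - 1) = 1.
Proof.
have step j : cheb v (j + 1) ^+ 2 + cheb v (j + 1 - 1) ^+ 2
      - v * cheb v (j + 1) * cheb v (j + 1 - 1)
    = cheb v j ^+ 2 + cheb v (j - 1) ^+ 2 - v * cheb v j * cheb v (j - 1).
  rewrite (cheb_rec v (j + 1)) addrK.
  have -> : j + 1 - 2 = j - 1 by ring.
  by ring.
elim/int_rect: k => [|j IH|j IH].
- by rewrite /=; ring.
- by rewrite -addn1 PoszD step.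
by rewrite -IH -[in RHS](subrK 1 (- j%:Z)) step -addn1 PoszD opprD.
Qed.

Lemma rmorph_cheb (B : comNzRingType) (phi : {rmorphism A -> B}) v k :
  phi (cheb v k) = cheb (phi v) k.
Proof.
have H j : phi (cheb_nat v j) = cheb_nat (phi v) j.
  suff: phi (cheb_nat v j) = cheb_nat (phi v) j
     /\ phi (cheb_nat v j.+1) = cheb_nat (phi v) j.+1 by case.
  elim: j => [|j [IH1 IH2]]; first by rewrite /= rmorph1.
  split=> //; change (phi (v * cheb_nat v j.+1 - cheb_nat v j)
     = phi v * cheb_nat (phi v) j.+1 - cheb_nat (phi v) j).
  by rewrite rmorphB rmorphM IH1 IH2.
by case: k => [j|[|j]]; rewrite /= ?rmorph0 ?rmorphN ?H.
Qed.

Definition cheb_sum v (j : nat) : A := \sum_(i < j) cheb_nat v i.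

Lemma cheb_sumE v (j : nat) :
  (v - 2%:R) * cheb_sum v j = cheb v j - cheb v (j%:Z - 1) - 1.
Proof.
rewrite /cheb_sum; elim: j => [|j IH]; first by rewrite big_ord0 /=; ring.
rewrite big_ord_recr mulrDr IH -[nat_of_ord _]/j -[cheb_nat v j]/(cheb v j).
have -> : j.+1%:Z - 1 = j by rewrite -addn1 PoszD; ring.
rewrite (cheb_rec v j.+1).
have -> : j.+1%:Z - 1 = j by rewrite -addn1 PoszD; ring.
have -> : j.+1%:Z - 2 = j%:Z - 1 by rewrite -addn1 PoszD; ring.
by ring.
Qed.

(** The quotient (S_(n-1) - S_(n-2) - 1) / (v - 2), given as a sum of
    Chebyshev polynomials so that it makes sense in every ring and at v = 2.
    *)
Definition chebP v (n : int) : A :=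
  match n with Posz j => cheb_sum v j.-1 | Negz j => cheb_sum v j.+1 end.

Lemma cheb_neg v (k : int) : cheb v (- k - 2) = - cheb v k.
Proof.
case: k => [j|[|j]].
- by have -> : - j%:Z - 2 = Negz j.+1 by rewrite NegzE -[j.+2]addn2 PoszD; ring.
- by rewrite /= oppr0.
have -> : - Negz j.+1 - 2 = j by rewrite NegzE -[j.+2]addn2 PoszD; ring.
by rewrite /= opprK.
Qed.

Lemma chebPE v n :
  (v - 2%:R) * chebP v n = cheb v (n - 1) - cheb v (n - 2) - 1.
Proof.
case: n => [[|j]|j].
- by rewrite /= /cheb_sum big_ord0; ring.
- have -> : j.+1%:Z - 2 = j%:Z - 1 by rewrite -addn1 PoszD; ring.
  have -> : j.+1%:Z - 1 = j%:Z by rewrite -addn1 PoszD; ring.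
  by rewrite cheb_sumE.
have -> : Negz j - 1 = - j%:Z - 2 by rewrite NegzE -addn1 PoszD; ring.
have -> : Negz j - 2 = - (j%:Z + 1) - 2 by rewrite NegzE -addn1 PoszD; ring.
rewrite !cheb_neg [chebP _ _]/(cheb_sum v j.+1) cheb_sumE -[j.+1]addn1 PoszD addrK.
by ring.
Qed.

Lemma cheb_prevE v n :
  cheb v (n - 2) = cheb v (n - 1) - (1 + (v - 2%:R) * chebP v n).
Proof. by rewrite chebPE; ring. Qed.

End ChebyshevIdentities.

(** The Cassini identity for S_(n-1) and S_(n-2), in terms of S = S_(n-1) and
    P; it then has a factor v - 2, which is cancelled. *)
Lemma cheb_quadratic (A : idomainType) (v : A) (n : int) : v != 2%:R ->
  cheb v (n - 1) ^+ 2 = cheb v (n - 1) + 2%:R * chebP v n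
    + (v - 2%:R) * chebP v n ^+ 2 + (v - 2%:R) * cheb v (n - 1) * chebP v n.
Proof.
rewrite -subr_eq0 => w0; apply: (mulfI w0).
have cas : cheb v (n - 1) ^+ 2 + cheb v (n - 2) ^+ 2
    - v * cheb v (n - 1) * cheb v (n - 2) - 1 = 0.
  have -> : n - 2 = n - 1 - 1 by ring.
  by rewrite cheb_cassini subrr.
by apply/eqP; rewrite -subr_eq0 -oppr_eq0 -cas cheb_prevE; apply/eqP; ring.
Qed.

(** * Two-by-two matrices in the basis 1, a, b, ab *)

Section TwoByTwo.
Variable F : fieldType.
Implicit Types A B C D : 'M[F]_2.

Lemma ord2_cases (j : 'I_2) : j = 0 \/ j = 1.
Proof. by case: j => -[|[|//]] ?; [left|right]; apply: val_inj. Qed.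

Lemma mx22P A B :
  A 0 0 = B 0 0 -> A 0 1 = B 0 1 -> A 1 0 = B 1 0 -> A 1 1 = B 1 1 -> A = B.
Proof.
move=> h00 h01 h10 h11; apply/matrixP=> i j.
by case: (ord2_cases i) (ord2_cases j) => -> [] ->.
Qed.

Lemma mul2E A B i j : (A *m B) i j = A i 0 * B 0 j + A i 1 * B 1 j.
Proof.
rewrite mxE !big_ord_recl big_ord0 addr0.
by congr (A i _ * B _ j + A i _ * B _ j); apply: val_inj.
Qed.

Lemma tr2E A : \tr A = A 0 0 + A 1 1.
Proof.
rewrite /mxtrace !big_ord_recl big_ord0 addr0.
by congr (A _ _ + A _ _); apply: val_inj.
Qed.

Lemma det2E A : \det A = A 0 0 * A 1 1 - A 0 1 * A 1 0.
Proof.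
rewrite (expand_det_row A ord0) !big_ord_recl big_ord0 addr0.
rewrite /cofactor !det_mx11 !mxE /= expr0 expr1.
have -> : lift ord0 0 = 1 :> 'I_2 by apply: val_inj.
have -> : lift 1 0 = 0 :> 'I_2 by apply: val_inj.
by rewrite -[ord0]/(0 : 'I_2); ring.
Qed.

Lemma invmx2E A : \det A = 1 -> invmx A = (\tr A)%:M - A.
Proof.
move=> dA; have uA : A \in unitmx by rewrite unitmxE dA unitr1.
apply: (can_inj (mulKmx uA)); rewrite mulmxV //.
move: dA; rewrite det2E => dA.
apply: mx22P; rewrite ?mul2E !mxE tr2E /= -?dA; ring.
Qed.

Section Quaternions.
Variables a b : 'M[F]_2.

(** When the commutator of a and b is invertible, 1, a, b, ab is a basis of
    the matrix algebra, and for determinants 1 computations in it depend on a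
    and b only through their traces and that of ab. This is how identities
    between words become polynomial identities in x, y, z. *)
Definition quaternion (e0 e1 e2 e3 : F) : 'M[F]_2 :=
  e0%:M + e1 *: a + e2 *: b + e3 *: (a *m b).

Local Notation quat := quaternion.

Local Notation x := (\tr a).
Local Notation y := (\tr b).
Local Notation z := (\tr (a *m b)).

Lemma quat_eq e0 e1 e2 e3 f0 f1 f2 f3 :
  e0 = f0 -> e1 = f1 -> e2 = f2 -> e3 = f3 -> quat e0 e1 e2 e3 = quat f0 f1 f2 f3.
Proof. by move=> -> -> -> ->. Qed.

Lemma quatE e0 e1 e2 e3 i j :
  quat e0 e1 e2 e3 i j = e0 *+ (i == j) + e1 * a i j + e2 * b i j
    + e3 * (a i 0 * b 0 j + a i 1 * b 1 j).
Proof. by rewrite -mul2E !mxE. Qed.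

Lemma quat_mul p0 p1 p2 p3 q0 q1 q2 q3 : \det a = 1 -> \det b = 1 ->
  quat p0 p1 p2 p3 *m quat q0 q1 q2 q3 =
  quat (p0 * q0 - p1 * q1 - p2 * q2 - p3 * q3 + (z - x * y) * p2 * q1
          - x * p2 * q3 - y * p3 * q1)
       (p0 * q1 + p1 * q0 + x * p1 * q1 + y * p2 * q1 + z * p3 * q1
          + p2 * q3 - p3 * q2)
       (p0 * q2 + p2 * q0 + x * p2 * q1 + y * p2 * q2 + z * p2 * q3
          - p1 * q3 + p3 * q1)
       (p0 * q3 + p3 * q0 + x * p1 * q3 + y * p3 * q2 + z * p3 * q3
          + p1 * q2 - p2 * q1).
Proof.
(* With the determinants kept as variables the formula is an identity between
   polynomials in the entries of a and b. *)
set al := \det a; set be := \det b => al1 be1.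
transitivity (quat
  (p0 * q0 - al * p1 * q1 - be * p2 * q2 - al * be * p3 * q3
     + (z - x * y) * p2 * q1 - be * x * p2 * q3 - al * y * p3 * q1)
  (p0 * q1 + p1 * q0 + x * p1 * q1 + y * p2 * q1 + z * p3 * q1
     + be * p2 * q3 - be * p3 * q2)
  (p0 * q2 + p2 * q0 + x * p2 * q1 + y * p2 * q2 + z * p2 * q3
     - al * p1 * q3 + al * p3 * q1)
  (p0 * q3 + p3 * q0 + x * p1 * q3 + y * p3 * q2 + z * p3 * q3
     + p1 * q2 - p2 * q1)); last by rewrite al1 be1; congr quat; ring.
rewrite /al /be {al1 be1 al be} !det2E !tr2E.
by apply: mx22P; rewrite !(mul2E, quatE) /=; ring.
Qed.
End Quaternions.

End TwoByTwo.

(** * Words and Fox derivatives *)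

Section Words.
Variables (F : fieldType) (rho : bool -> 'M[F]_2).
Hypothesis det_rho : forall g, \det (rho g) = 1.
Implicit Types (u w : word) (g : bool).

Local Notation ev := (word_eval rho).

Let unit_rho g : rho g \in unitmx.
Proof. by rewrite unitmxE det_rho unitr1. Qed.

Lemma word_eval_cat u w : ev (u ++ w) = ev u *m ev w.
Proof.
elim: u => [|[h e] u IH]; first by rewrite mul1mx.
by rewrite /= IH mulmxA.
Qed.

Lemma det_word_eval w : \det (ev w) = 1.
Proof.
elim: w => [|[h e] w IH]; first exact: det1.
by rewrite /= det_mulmx IH mulr1; case: e; rewrite ?det_inv det_rho ?invr1.
Qed.

Lemma word_inv_cons l w : word_inv (l :: w) = word_inv w ++ [:: (l.1, ~~ l.2)].
Proof. by rewrite /word_inv /= rev_cons cats1. Qed.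

Lemma word_eval_inv w : ev (word_inv w) = invmx (ev w).
Proof.
have uw : ev w \in unitmx by rewrite unitmxE det_word_eval unitr1.
suff E : ev (word_inv w) *m ev w = 1%:M by rewrite -[LHS](mulmxK uw) E mul1mx.
elim: w {uw} => [|[h e] w IH]; first by rewrite /= mul1mx.
rewrite word_inv_cons word_eval_cat /= mulmx1 -mulmxA.
by case: e; rewrite /= ?mulKmx ?mulKVmx.
Qed.

Lemma fox_cat g u w : fox rho g (u ++ w) = fox rho g u + ev u *m fox rho g w.
Proof.
elim: u => [|[h e] u IH]; first by rewrite /= add0r mul1mx.
rewrite /= IH; case: e.
  by rewrite -mulmxA -mulmxDr addrAC.
by rewrite mulmxDr mulmxA addrA.
Qed.

(** The derivative of the word w^-1 w vanishes, by cancelling the letters from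
    the middle outwards. *)
Lemma fox_inv g w :
  fox rho g (word_inv w) = - (invmx (ev w) *m fox rho g w).
Proof.
have uw : ev w \in unitmx by rewrite unitmxE det_word_eval unitr1.
suff : fox rho g (word_inv w ++ w) = 0.
  by rewrite fox_cat word_eval_inv => /eqP; rewrite addr_eq0 => /eqP.
elim: w {uw} => [//|[h e] w IH]; rewrite word_inv_cons -catA.
have cancel : fox rho g ([:: (h, ~~ e)] ++ (h, e) :: w) = fox rho g w.
  case: e => /=; first by rewrite mulKVmx // addrC subrK.
  by rewrite addrAC subrr add0r mulKmx.
by rewrite fox_cat cancel -IH fox_cat.
Qed.

(** The fundamental formula of Fox calculus. Applied to the relator, it says
    that the boundary operators compose to zero. *)
Lemma fox_fundamental w :
  ev w - 1%:M = fox rho mer_m w *m (rho mer_m - 1%:M)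
              + fox rho mer_mu w *m (rho mer_mu - 1%:M).
Proof.
elim: w => [|[h e] w IH]; first by rewrite /= !mul0mx addr0 subrr.
have -> : ev ((h, e) :: w) - 1%:M =
    (if e then invmx (rho h) else rho h) *m (ev w - 1%:M)
    + ((if e then invmx (rho h) else rho h) - 1%:M).
  by rewrite mulmxBr mulmx1 addrA subrK.
rewrite IH; case: e => /=.
  have -> : invmx (rho h) - 1%:M = - (invmx (rho h) *m (rho h - 1%:M)).
    by rewrite mulmxBr mulVmx // mulmx1 opprB.
  case: h; rewrite /= subr0 -!mulmxA -mulmxDr -mulmxN -mulmxDr;
    by rewrite mulmxBl mul1mx ?addrA // addrAC.
case: h; rewrite /= add0r mulmxDr !mulmxA mulmxDl mul1mx.
  by rewrite -addrA; congr (_ + _); rewrite addrC.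
by rewrite addrAC; congr (_ + _); rewrite addrC.
Qed.

(** The elements of F[W]. By the Cayley-Hamilton theorem, they include the
    powers of W and the sums 1 + W + ... + W^(k-1). *)
Definition lin_mx (W : 'M[F]_2) (c d : F) : 'M[F]_2 := c *: W + d%:M.

Lemma lin_mx_mul (W : 'M[F]_2) c d c' d' : \det W = 1 ->
  lin_mx W c d *m lin_mx W c' d' = lin_mx W (c * c' * \tr W + c * d' + d * c') (d * d' - c * c').
Proof.
move=> hW; transitivity
  (lin_mx W (c * c' * \tr W + c * d' + d * c') (d * d' - \det W * c * c')).
  rewrite det2E tr2E; apply: mx22P; rewrite mul2E !mxE /=; ring.
by rewrite hW mul1r.
Qed.

Lemma lin_mx_self (W : 'M[F]_2) : W = lin_mx W 1 0.
Proof. by rewrite /lin_mx scale1r raddf0 addr0. Qed.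

Lemma lin_mx_one (W : 'M[F]_2) : 1%:M = lin_mx W 0 1.
Proof. by rewrite /lin_mx scale0r add0r. Qed.

Lemma lin_mxD (W : 'M[F]_2) c d c' d' : lin_mx W c d + lin_mx W c' d' = lin_mx W (c + c') (d + d').
Proof. by apply: mx22P; rewrite !mxE /=; ring. Qed.

Lemma chebP_succ (v : F) (j : nat) : chebP v (j.+1) = chebP v j + cheb v (j%:Z - 1).
Proof.
case: j => [|j]; first by rewrite /= addr0.
have -> : j.+1%:Z - 1 = j%:Z by rewrite -addn1 PoszD addrK.
by rewrite [LHS]/(cheb_sum v j.+1) /cheb_sum big_ord_recr.
Qed.

Lemma flatten_nseq_fox g w (j : nat) (v := \tr (ev w)) :
  ev (flatten (nseq j w)) = lin_mx (ev w) (cheb v (j%:Z - 1)) (- cheb v (j%:Z - 2)) /\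
  fox rho g (flatten (nseq j w)) =
    lin_mx (ev w) (chebP v j) (cheb v (j%:Z - 2) + 1 - chebP v j) *m fox rho g w.
Proof.
have dw := det_word_eval w.
elim: j => [|j [IH1 IH2]].
  rewrite /= /lin_mx scale0r add0r opprK /cheb_sum big_ord0 scale0r addNr subr0.
  by rewrite raddf0 addr0 mul0mx.
have e1 : j.+1%:Z - 1 = j%:Z - 1 + 1 by rewrite -addn1 PoszD; ring.
have e2 : j.+1%:Z - 2 = j%:Z - 1 by rewrite -addn1 PoszD; ring.
have chS : cheb v (j.+1%:Z - 1) = v * cheb v (j%:Z - 1) - cheb v (j%:Z - 2).
  rewrite cheb_rec; congr (_ * cheb v _ - cheb v _); rewrite e1; ring.
have hS : cheb v (j%:Z - 1) = (v - 2%:R) * chebP v j + cheb v (j%:Z - 2) + 1.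
  by rewrite chebPE; ring.
split.
  rewrite [flatten _]/(w ++ flatten (nseq j w)) word_eval_cat IH1 {1}[ev w]lin_mx_self lin_mx_mul // chS e2.
  by congr lin_mx; rewrite -/v; ring.
rewrite [flatten _]/(w ++ flatten (nseq j w)) fox_cat IH2 mulmxA {1}[ev w]lin_mx_self lin_mx_mul //.
rewrite -{1}[fox rho g w]mul1mx {1}(lin_mx_one (ev w)) -mulmxDl lin_mxD; congr (lin_mx _ _ _ *m _).
  rewrite chebP_succ -/v hS; ring.
by rewrite chebP_succ e2 hS; ring.
Qed.

Lemma lin_mx_inv (W : 'M[F]_2) c d : \det W = 1 ->
  lin_mx (invmx W) c d = lin_mx W (- c) (c * \tr W + d).
Proof.
by move=> hW; rewrite invmx2E //; apply: mx22P; rewrite !mxE /=; ring.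
Qed.

(** Powers of a matrix of determinant 1 are W^k = S_(k-1) W - S_(k-2), and the
    Fox derivative of w^k is the geometric series 1 + W + ... + W^(k-1) times
    that of w. Negative exponents reduce to positive ones by passing to the
    inverse word. *)
Lemma word_pow_fox g w (k : int) (v := \tr (ev w)) :
  ev (word_pow w k) = lin_mx (ev w) (cheb v (k - 1)) (- cheb v (k - 2)) /\
  fox rho g (word_pow w k) =
    lin_mx (ev w) (chebP v k) (cheb v (k - 2) + 1 - chebP v k) *m fox rho g w.
Proof.
case: k => j; first exact: flatten_nseq_fox.
have dw := det_word_eval w; pose wi := word_inv w.
have tri : \tr (ev wi) = v.
  by rewrite word_eval_inv invmx2E // raddfB /= mxtrace_scalar -/v; ring.
have := flatten_nseq_fox g wi j.+1; rewrite -/(word_pow w (Negz j)) tri => -[-> ->].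
have eN1 : Negz j - 1 = - j%:Z - 2 by rewrite NegzE -addn1 PoszD; ring.
have eN2 : Negz j - 2 = - (j%:Z + 1) - 2 by rewrite NegzE -addn1 PoszD; ring.
have e1 : j.+1%:Z - 1 = j by rewrite -addn1 PoszD; ring.
have e2 : j.+1%:Z - 2 = j%:Z - 1 by rewrite -addn1 PoszD; ring.
have hj : cheb v (j%:Z + 1) = v * cheb v j - cheb v (j%:Z - 1).
  by rewrite cheb_rec; congr (_ * cheb v _ - cheb v _); ring.
have hS : cheb v j = (v - 2%:R) * chebP v j.+1 + cheb v (j%:Z - 1) + 1.
  by rewrite chebPE e1 e2; ring.
have hP : chebP v (Negz j) = chebP v j.+1 + cheb v j.
  by rewrite -e1 -chebP_succ.
rewrite word_eval_inv eN1 eN2 !cheb_neg e1 e2; split.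
  by rewrite lin_mx_inv //; congr lin_mx; rewrite hj -/v; ring.
rewrite fox_inv mulmxN -mulNmx mulmxA; congr (_ *m _).
rewrite lin_mx_inv // [invmx _](_ : _ = lin_mx (ev w) (-1) v); last first.
  by rewrite invmx2E // /lin_mx scaleN1r addrC.
rewrite -scaleN1r -[_%R *: lin_mx _ _ _ *m _]scalemxAl.
have scl c d e : c *: lin_mx (ev w) d e = lin_mx (ev w) (c * d) (c * e).
  by apply: mx22P; rewrite !mxE /=; ring.
rewrite lin_mx_mul // scl -/v hP hj hS.
by congr lin_mx; ring.
Qed.

End Words.

(** * Determinants and commutators in the basis 1, a, b, ab *)

Section QuatMore.
Variable F : fieldType.
Variables a b : 'M[F]_2.
Local Notation quat := (quaternion a b).
Local Notation x := (\tr a).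
Local Notation y := (\tr b).
Local Notation z := (\tr (a *m b)).

Lemma quatD p0 p1 p2 p3 q0 q1 q2 q3 :
  quat p0 p1 p2 p3 + quat q0 q1 q2 q3
  = quat (p0 + q0) (p1 + q1) (p2 + q2) (p3 + q3).
Proof. by apply: mx22P; rewrite [LHS]mxE !quatE; ring. Qed.

Lemma quatZ c p0 p1 p2 p3 :
  c *: quat p0 p1 p2 p3 = quat (c * p0) (c * p1) (c * p2) (c * p3).
Proof. by apply: mx22P; rewrite [LHS]mxE !quatE; ring. Qed.

Lemma quatN p0 p1 p2 p3 : - quat p0 p1 p2 p3 = quat (- p0) (- p1) (- p2) (- p3).
Proof. by apply: mx22P; rewrite [LHS]mxE !quatE; ring. Qed.

Lemma quat_c c : c%:M = quat c 0 0 0.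
Proof. by rewrite /quaternion !scale0r !addr0. Qed.

Lemma quat_a : a = quat 0 1 0 0.
Proof. by rewrite /quaternion !scale0r scale1r !addr0 raddf0 add0r. Qed.

Lemma quat_b : b = quat 0 0 1 0.
Proof. by rewrite /quaternion !scale0r scale1r !addr0 raddf0 !add0r. Qed.

Lemma quat0 : 0 = quat 0 0 0 0.
Proof. by rewrite -quat_c raddf0. Qed.

Lemma quat_tr p0 p1 p2 p3 :
  \tr (quat p0 p1 p2 p3) = 2%:R * p0 + p1 * x + p2 * y + p3 * z.
Proof. by rewrite /quaternion !raddfD /= !mxtraceZ mxtrace_scalar; ring. Qed.

Lemma quat_lin e0 e1 e2 e3 c d :
  lin_mx (quat e0 e1 e2 e3) c d = quat (c * e0 + d) (c * e1) (c * e2) (c * e3).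
Proof. by rewrite /lin_mx quatZ quat_c quatD !addr0. Qed.

Hypotheses (ha : \det a = 1) (hb : \det b = 1).

Lemma quat_ainv : invmx a = quat x (-1) 0 0.
Proof. by rewrite invmx2E // quat_c [X in _ - X]quat_a quatN quatD; apply: quat_eq; ring. Qed.

Lemma quat_binv : invmx b = quat y 0 (-1) 0.
Proof. by rewrite invmx2E // quat_c [X in _ - X]quat_b quatN quatD; apply: quat_eq; ring. Qed.

Lemma quat_det p0 p1 p2 p3 :
  \det (quat p0 p1 p2 p3) = p0 ^+ 2 + p1 ^+ 2 + p2 ^+ 2 + p3 ^+ 2
   + p0 * (x * p1 + y * p2 + z * p3) - (z - x * y) * p1 * p2
   + x * p2 * p3 + y * p1 * p3.
Proof.
(* As in [quat_mul], the identity is made polynomial in the entries. *)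
transitivity (p0 ^+ 2 + \det a * p1 ^+ 2 + \det b * p2 ^+ 2
   + \det a * \det b * p3 ^+ 2
   + p0 * (x * p1 + y * p2 + z * p3) - (z - x * y) * p1 * p2
   + \det b * x * p2 * p3 + \det a * y * p1 * p3); last by rewrite ha hb; ring.
by rewrite !det2E !tr2E !quatE !mul2E /=; ring.
Qed.

(** This is why v = 2 is the locus of reducible representations. *)
Lemma comm_det : \det (a *m b - b *m a) = 2%:R - trv x y z.
Proof.
have -> : a *m b - b *m a = quat 0 1 0 0 *m quat 0 0 1 0 - quat 0 0 1 0 *m quat 0 1 0 0.
  by rewrite -quat_a -quat_b.
rewrite !quat_mul // quatN quatD.
by rewrite quat_det /trv; ring.
Qed.

(** The part e0 + e1 a commutes with a, and what remains is (e2 + e3 a) b. *)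
Lemma comm_quat e0 e1 e2 e3 :
  a *m quat e0 e1 e2 e3 - quat e0 e1 e2 e3 *m a
  = lin_mx a e3 e2 *m (a *m b - b *m a).
Proof.
have mE (A B : 'M[F]_2) i j : (A - B) i j = A i j - B i j by rewrite !mxE.
have lE c d i j : lin_mx a c d i j = c * a i j + d *+ (i == j) by rewrite !mxE.
by apply: mx22P; rewrite mE !mul2E !(lE, quatE, mE, mul2E) /=; ring.
Qed.

End QuatMore.

(** * The word omega and the equation of the character variety *)

Definition commL : word := [:: (mer_mu, false); (mer_m, false); (mer_mu, true); (mer_m, true)].
Definition commR : word := [:: (mer_m, true); (mer_mu, true); (mer_m, false); (mer_mu, false)].

Section Omega.
Variables (F : fieldType) (rho : bool -> 'M[F]_2).
Hypothesis det_rho : forall g, \det (rho g) = 1.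
Variable n : int.

Local Notation ev := (word_eval rho).
Local Notation a := (rho mer_m).
Local Notation b := (rho mer_mu).
Local Notation quat := (quaternion a b).
Local Notation x := (\tr a).
Local Notation y := (\tr b).
Local Notation z := (\tr (a *m b)).
Local Notation v := (trv x y z).
Local Notation S := (cheb v (n - 1)).
Local Notation S' := (cheb v (n - 2)).
Local Notation P := (chebP v n).
Let ha : \det a = 1 := det_rho mer_m.
Let hb : \det b = 1 := det_rho mer_mu.

Local Notation qm := (quat_mul _ _ _ _ _ _ _ _ ha hb).

Lemma commL_eval :
  ev commL = quat (x ^+ 2 + z ^+ 2 - x * y * z - 1) (y * z - x) y (- z).
Proof.
transitivity (quat 0 0 1 0 *m (quat 0 1 0 0 *m (quat y 0 (-1) 0 *m quat x (-1) 0 0))).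
  by rewrite -quat_a -quat_b -(quat_ainv b ha) -(quat_binv a hb) /= mulmx1.
by rewrite !qm; apply: quat_eq; ring.
Qed.

Lemma commR_eval :
  ev commR = quat (x ^+ 2 - 1) (- x) (y - x * z) z.
Proof.
transitivity (quat x (-1) 0 0 *m (quat y 0 (-1) 0 *m (quat 0 1 0 0 *m quat 0 0 1 0))).
  by rewrite -quat_a -quat_b -(quat_ainv b ha) -(quat_binv a hb) /= mulmx1.
by rewrite !qm; apply: quat_eq; ring.
Qed.

Lemma commL_tr : \tr (ev commL) = v.
Proof. by rewrite commL_eval quat_tr /trv; ring. Qed.

Lemma commR_tr : \tr (ev commR) = v.
Proof. by rewrite commR_eval quat_tr /trv; ring. Qed.

(** The two powers of commutators around m are given by [word_pow_fox], and
    the product is expanded in the basis 1, a, b, ab. The coefficients of 1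
    and a commute with a and are left unspecified. *)
Lemma omega_eval : exists e0 e1, ev (omega n) = quat e0 e1 (S * fW n x y z) 0.
Proof.
rewrite /omega !word_eval_cat -/commL -/commR.
have [-> _] := word_pow_fox det_rho mer_m commL n.
have [-> _] := word_pow_fox det_rho mer_m commR n.
rewrite commL_tr commR_tr commL_eval commR_eval !quat_lin.
rewrite [ev _](_ : _ = quat 0 1 0 0); last by rewrite /= mulmx1 -quat_a.
rewrite !qm; eexists; eexists; apply: quat_eq; try reflexivity; last by ring.
have Sn : cheb v n = v * S - S' by exact: cheb_rec.
by rewrite /fW Sn; move: S S' => s s'; rewrite /trv; ring.
Qed.

Hypothesis irr : v != 2%:R.

(** By [comm_quat], the commutator of a with omega is S f_n times that of a
    with b, which is invertible. *)
Lemma omega_comm : (a *m ev (omega n) = ev (omega n) *m a) <-> (S * fW n x y z = 0).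
Proof.
have [e0 [e1 ->]] := omega_eval.
have := comm_quat a b e0 e1 (S * fW n x y z) 0; set c := S * fW n x y z.
rewrite /lin_mx scale0r add0r mul_scalar_mx => E; split=> [/eqP|c0]; last first.
  by apply/eqP; rewrite -subr_eq0 E c0 scale0r.
rewrite -subr_eq0 E => /eqP /(congr1 (fun M : 'M_2 => \det M)).
rewrite detZ det0 comm_det // => /eqP.
by rewrite mulf_eq0 subr_eq0 [2%:R == _]eq_sym (negPf irr) orbF expf_eq0 => /eqP.
Qed.

Lemma relator_eval : (ev (relator n) = 1%:M) <-> (S * fW n x y z = 0).
Proof.
rewrite -omega_comm /relator; move: (omega n) => u.
have uo : ev u \in unitmx by rewrite unitmxE (det_word_eval det_rho) unitr1.
have ua : a \in unitmx by rewrite unitmxE ha unitr1.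
rewrite !word_eval_cat (word_eval_inv det_rho).
have -> : ev [:: (mer_m, false)] = a by rewrite /= mulmx1.
have -> : ev [:: (mer_m, true)] = invmx a by rewrite /= mulmx1.
split=> E; last by rewrite mulmxA E -mulmxA mulKVmx // mulmxV.
by rewrite -[RHS]mul1mx -E -!mulmxA mulKmx // mulVmx // mulmx1.
Qed.

End Omega.

(** * Fox derivatives of omega *)

Section FoxCoefficients.
Variable A : comNzRingType.
Variables x y z s p : A.
Let w := trv x y z - 2%:R.
Let d := 1 + w * p.

(** Together with [foxm1], the coefficients of b and ab in the Fox derivative
    of omega with respect to m, where s and p stand for S and P; [foxmu0] and
    [foxmu1] are those of the derivative with respect to mu. The coefficients
    of 1 and a disappear in commutators with a. *)
Definition foxm0 : A :=
  s ^+ 2 * (y ^+ 2 - w - 4%:R) + (s + 2%:R * p) * (2%:R - y).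
Definition foxm1 : A :=
  x * (s ^+ 2 + p * d - p) - x * y * p * d + z * (s ^+ 2 + p * d + p)
  - y * z * s ^+ 2.
Definition foxmu0 : A :=
  s ^+ 2 * (x * y ^+ 2 - y ^+ 2 - y * z + w + 4%:R - x * (w + 2%:R))
  - x * y * (s + p) + x * (s + p - s * d) + y * p + z * (s + p) - (s + 2%:R * p).
Definition foxmu1 : A :=
  s ^+ 2 * (y * z - x - y ^+ 2 + w + 4%:R) - x * p * d + y * (s + p) - z * p
  - (s + 2%:R * p).

End FoxCoefficients.

Section OmegaFox.
Variables (F : fieldType) (rho : bool -> 'M[F]_2).
Hypothesis det_rho : forall g, \det (rho g) = 1.
Variable n : int.

Local Notation ev := (word_eval rho).
Local Notation a := (rho mer_m).
Local Notation b := (rho mer_mu).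
Local Notation quat := (quaternion a b).
Local Notation x := (\tr a).
Local Notation y := (\tr b).
Local Notation z := (\tr (a *m b)).
Local Notation v := (trv x y z).
Local Notation S := (cheb v (n - 1)).
Local Notation S' := (cheb v (n - 2)).
Local Notation P := (chebP v n).
Let ha : \det a = 1 := det_rho mer_m.
Let hb : \det b = 1 := det_rho mer_mu.
Local Notation qm := (quat_mul _ _ _ _ _ _ _ _ ha hb).

Let ma : quat 0 1 0 0 = a. Proof. by rewrite -quat_a. Qed.
Let mb : quat 0 0 1 0 = b. Proof. by rewrite -quat_b. Qed.
Let mai : quat x (-1) 0 0 = invmx a. Proof. by rewrite -quat_ainv. Qed.
Let mbi : quat y 0 (-1) 0 = invmx b. Proof. by rewrite -quat_binv. Qed.
Let mm1 : quat (-1) 0 0 0 = - 1%:M. Proof. by rewrite -quat_c raddfN. Qed.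
Let m1 : quat 1 0 0 0 = 1%:M. Proof. by rewrite -quat_c. Qed.
Let toM := (ma, mb, mai, mbi, mm1, m1).

Lemma fox_m_commL : fox rho mer_m commL =
  quat (1 + x * y * z - x ^+ 2 - z ^+ 2) (x - y * z) (1 - y) z.
Proof.
transitivity (quat 0 0 1 0 - ev commL).
  by rewrite !toM /= !(add0r, oppr0, addr0, mulmxDr, mulmxN, mulmx1, mulmx0).
by rewrite commL_eval // quatN quatD; apply: quat_eq; ring.
Qed.

Lemma fox_mu_commL : fox rho mer_mu commL =
  quat (x * y ^+ 2 - x - y * z + 1) (1 - y ^+ 2) (z - x * y) y.
Proof.
transitivity (quat 1 0 0 0 + quat 0 0 1 0 *m (quat 0 1 0 0 *m
  (quat y 0 (-1) 0 *m quat (-1) 0 0 0))).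
  by rewrite !toM /= !(add0r, oppr0, addr0, mulmx0, mulmx1).
by rewrite !(qm, quatD); apply: quat_eq; ring.
Qed.

Lemma fox_m_commR : fox rho mer_m commR = quat (x * y - x) (1 - y) (- x) 1.
Proof.
transitivity (quat x (-1) 0 0 *m (quat y 0 (-1) 0 + quat (-1) 0 0 0)).
  by rewrite !toM /= !(add0r, oppr0, addr0, mulmx0, mulmx1).
by rewrite !(qm, quatD); apply: quat_eq; ring.
Qed.

Lemma fox_mu_commR : fox rho mer_mu commR =
  quat (x ^+ 2 * y - x * y - x * z) (y + z - x * y) (1 + x - x ^+ 2) (x - 1).
Proof.
transitivity (quat x (-1) 0 0 *m (quat y 0 (-1) 0 *m
   (quat 0 1 0 0 + quat (-1) 0 0 0))).
  by rewrite !toM /= !(add0r, oppr0, addr0, mulmx0, mulmx1).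
by rewrite !(qm, quatD); apply: quat_eq; ring.
Qed.

Let quat_ex e0 e1 e2 e3 f2 f3 : e2 = f2 -> e3 = f3 ->
  exists g0 g1, quat e0 e1 e2 e3 = quat g0 g1 f2 f3.
Proof. by move=> -> ->; exists e0, e1. Qed.

Hypothesis irr : v != 2%:R.
Local Notation w := (v - 2%:R).
Local Notation d := (1 + w * P).
Local Notation R := (S + 2%:R * P).

Lemma fox_m_omega : exists e0 e1, fox rho mer_m (omega n) =
  quat e0 e1 (foxm0 x y z S P) (foxm1 x y z S P).
Proof.
rewrite /omega 2!fox_cat -/commL -/commR.
have [-> ->] := word_pow_fox det_rho mer_m commL n.
have [_ ->] := word_pow_fox det_rho mer_m commR n.
rewrite commL_tr // commR_tr // commL_eval // commR_eval // !quat_lin.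
rewrite fox_m_commL fox_m_commR.
rewrite [word_eval _ _](_ : _ = quat 0 1 0 0); last by rewrite /= mulmx1 -quat_a.
rewrite [fox rho mer_m [:: _]](_ : _ = quat 1 0 0 0); last by rewrite /= mulmx0 addr0 -quat_c.
rewrite !(qm, quatD).
have q : S ^+ 2 = R + w * P ^+ 2 + w * S * P := cheb_quadratic n irr.
move: q; rewrite cheb_prevE; move: S P => s p q.
apply: quat_ex.
  apply/eqP; rewrite -subr_eq0; apply/eqP.
  (* The two sides differ by a multiple of the Cassini relation. *)
  transitivity ((2%:R - y) * (s ^+ 2 - (s + 2%:R * p + w * p ^+ 2 + w * s * p))); last by rewrite q subrr mulr0.
  by rewrite /foxm0 /foxm1 /foxmu0 /foxmu1 /trv; ring.
by rewrite /foxm0 /foxm1 /foxmu0 /foxmu1 /trv; ring.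
Qed.

Lemma fox_mu_omega : exists e0 e1, fox rho mer_mu (omega n) =
  quat e0 e1 (foxmu0 x y z S P) (foxmu1 x y z S P).
Proof.
rewrite /omega 2!fox_cat -/commL -/commR.
have [-> ->] := word_pow_fox det_rho mer_mu commL n.
have [_ ->] := word_pow_fox det_rho mer_mu commR n.
rewrite commL_tr // commR_tr // commL_eval // commR_eval // !quat_lin.
rewrite fox_mu_commL fox_mu_commR.
rewrite [word_eval _ _](_ : _ = quat 0 1 0 0); last by rewrite /= mulmx1 -quat_a.
rewrite [fox rho mer_mu [:: _]](_ : _ = quat 0 0 0 0); last by rewrite /= mulmx0 addr0 -quat0.
rewrite !(qm, quatD).
have q : S ^+ 2 = R + w * P ^+ 2 + w * S * P := cheb_quadratic n irr.
move: q; rewrite cheb_prevE; move: S P => s p q.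
apply: quat_ex; apply/eqP; rewrite -subr_eq0; apply/eqP.
  transitivity ((x - 2%:R) * (s ^+ 2 - (s + 2%:R * p + w * p ^+ 2 + w * s * p))); last by rewrite q subrr mulr0.
  by rewrite /foxm0 /foxm1 /foxmu0 /foxmu1 /trv; ring.
transitivity ((- 2%:R) * (s ^+ 2 - (s + 2%:R * p + w * p ^+ 2 + w * s * p))); last by rewrite q subrr mulr0.
by rewrite /foxm0 /foxm1 /foxmu0 /foxmu1 /trv; ring.
Qed.

End OmegaFox.

(** * Determinants of block matrices *)

Section BlockDet.
Variable F : fieldType.
Implicit Types A B C D a b : 'M[F]_2.

(** The Laplace expansion along the first two rows, with the mixed terms
    collected into a trace of adjugates. *)
Lemma det_block22 A B C D :
  \det (block_mx A B C D) = \det A * \det D + \det B * \det C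
    - \tr (((\tr A)%:M - A) *m B *m ((\tr D)%:M - D) *m C).
Proof.
pose M := block_mx A B C D; rewrite -/M.
pose m k l := M (inord k) (inord l).
have ME i j : M i j = m (val i) (val j) by rewrite /m !inord_val.
have e0 : inord 0 = lshift 2 (0 : 'I_2) by apply: val_inj; rewrite /= inordK.
have e1 : inord 1 = lshift 2 (1 : 'I_2) by apply: val_inj; rewrite /= inordK.
have e2 : inord 2 = rshift 2 (0 : 'I_2) by apply: val_inj; rewrite /= inordK.
have e3 : inord 3 = rshift 2 (1 : 'I_2) by apply: val_inj; rewrite /= inordK.
have -> : \det M =
    (m 0%N 0%N * m 1%N 1%N - m 0%N 1%N * m 1%N 0%N)
      * (m 2%N 2%N * m 3%N 3%N - m 2%N 3%N * m 3%N 2%N)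
  - (m 0%N 0%N * m 1%N 2%N - m 0%N 2%N * m 1%N 0%N)
      * (m 2%N 1%N * m 3%N 3%N - m 2%N 3%N * m 3%N 1%N)
  + (m 0%N 0%N * m 1%N 3%N - m 0%N 3%N * m 1%N 0%N)
      * (m 2%N 1%N * m 3%N 2%N - m 2%N 2%N * m 3%N 1%N)
  + (m 0%N 1%N * m 1%N 2%N - m 0%N 2%N * m 1%N 1%N)
      * (m 2%N 0%N * m 3%N 3%N - m 2%N 3%N * m 3%N 0%N)
  - (m 0%N 1%N * m 1%N 3%N - m 0%N 3%N * m 1%N 1%N)
      * (m 2%N 0%N * m 3%N 2%N - m 2%N 2%N * m 3%N 0%N)
  + (m 0%N 2%N * m 1%N 3%N - m 0%N 3%N * m 1%N 2%N)
      * (m 2%N 0%N * m 3%N 1%N - m 2%N 1%N * m 3%N 0%N).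
  rewrite (expand_det_row _ ord0) !big_ord_recl big_ord0 addr0 /cofactor.
  do 4 rewrite (expand_det_row _ (ord0 : 'I_3)) !big_ord_recl big_ord0 addr0.
  rewrite /cofactor !det2E.
  have rcE (i j : 'I_4) (k l : 'I_3) : row' i (col' j M) k l = M (lift i k) (lift j l).
    by rewrite !mxE.
  have rcE2 (i j : 'I_4) (k l : 'I_3) (p q : 'I_2) :
      row' k (col' l (row' i (col' j M))) p q = M (lift i (lift k p)) (lift j (lift l q)).
    by rewrite !mxE.
  rewrite !(rcE2, rcE, ME) /=; move: m {ME} => m.
  by rewrite /bump /= !(expr0, expr1, add0n, add1n, addn1, addn0) /=; ring.
rewrite /m e0 e1 e2 e3 /M !(block_mxEul, block_mxEur, block_mxEdl, block_mxEdr).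
rewrite !det2E !tr2E !mul2E.
have sE (W : 'M[F]_2) c i j : (c%:M - W) i j = c *+ (i == j) - W i j by rewrite !mxE.
by rewrite !(mul2E, sE) /=; ring.
Qed.

Let adj A : 'M[F]_2 := (\tr A)%:M - A.
Let adjE A i j : adj A i j = (A 0 0 + A 1 1) *+ (i == j) - A i j.
Proof. by rewrite !mxE tr2E. Qed.
Let linE A c d i j : lin_mx A c d i j = c * A i j + d *+ (i == j).
Proof. by rewrite !mxE. Qed.
Let subE A B i j : (A - B) i j = A i j - B i j.
Proof. by rewrite !mxE. Qed.
Let entE := (mul2E, adjE, linE, subE).

Lemma det2D A B : \det (A + B) = \det A + \det B + \tr (adj A *m B).
Proof. by rewrite tr2E !mul2E !adjE !det2E !mxE /=; ring. Qed.

Lemma adjM A B : adj (A *m B) = adj B *m adj A.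
Proof. by apply: mx22P; rewrite !entE /=; ring. Qed.

Lemma adj_lin A c d : adj (lin_mx A c d) = lin_mx (adj A) c d.
Proof. by apply: mx22P; rewrite !entE /=; ring. Qed.

(** Both traces of a K and K vanish, so moving a across the commutator K turns
    it into its adjugate tr a - a. *)
Lemma comm_lin a b c d (K := a *m b - b *m a) :
  lin_mx a c d *m K = K *m lin_mx (adj a) c d.
Proof. by rewrite /K; apply: mx22P; rewrite !entE /=; ring. Qed.

Lemma adj_mul A : adj A *m A = (\det A)%:M.
Proof. by apply: mx22P; rewrite !entE det2E !mxE /=; ring. Qed.

(** The factors K are moved to one side by [comm_lin]; what is left is the
    expansion of the determinant of a sum, [det2D]. *)
Lemma det_block_comm a b p0 p1 r0 r1 (K := a *m b - b *m a) :
  \det (block_mx (lin_mx a p1 p0 *m K) (lin_mx a r1 r0 *m K) (1%:M - b) (a - 1%:M))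
  = \det K * \det (lin_mx (adj a) p1 p0 *m (a - 1%:M)
                   + lin_mx (adj a) r1 r0 *m (b - 1%:M)).
Proof.
rewrite det_block22 -/(adj _) -/(adj (_ - _)) [\det (lin_mx _ _ _ *m _ + _)]det2D !det_mulmx.
have -> : \det (1%:M - b) = \det (b - 1%:M).
  by rewrite -opprB -scaleN1r detZ sqrrN expr1n mul1r.
have detl c d : \det (lin_mx (adj a) c d) = \det (lin_mx a c d).
  by rewrite -adj_lin !det2E !entE /=; ring.
have -> : adj (lin_mx a p1 p0 *m K) *m (lin_mx a r1 r0 *m K)
    = \det K *: (lin_mx a p1 p0 *m lin_mx (adj a) r1 r0).
  rewrite [lin_mx a r1 r0 *m K]comm_lin -/K adjM adj_lin.
  have -> : adj K *m lin_mx (adj a) p1 p0 = lin_mx a p1 p0 *m adj K.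
    have -> : adj K = - K by rewrite /adj /K raddfB /= mxtrace_mulC subrr raddf0 sub0r.
    by rewrite mulmxN mulNmx comm_lin.
  by rewrite -mulmxA [adj K *m _]mulmxA adj_mul mul_scalar_mx scalemxAr.
rewrite -!scalemxAl mxtraceZ. rewrite !detl.
have -> : adj (lin_mx (adj a) p1 p0 *m (a - 1%:M)) *m (lin_mx (adj a) r1 r0 *m (b - 1%:M))
   = - (lin_mx a p1 p0 *m lin_mx (adj a) r1 r0 *m adj (a - 1%:M) *m (1%:M - b)).
  rewrite adjM adj_lin.
  have -> : adj (adj a) = a by apply: mx22P; rewrite !entE /=; ring.
  have -> : adj (a - 1%:M) *m lin_mx a p1 p0 *m (lin_mx (adj a) r1 r0 *m (b - 1%:M))
     = (adj (a - 1%:M) *m (lin_mx a p1 p0 *m lin_mx (adj a) r1 r0)) *m (b - 1%:M).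
    by rewrite !mulmxA.
  rewrite -mulmxN opprB; congr (_ *m _).
  have -> : adj (a - 1%:M) = lin_mx a (-1) (\tr a - 1).
    by apply: mx22P; rewrite !entE tr2E !mxE /=; ring.
  have -> : adj a = lin_mx a (-1) (\tr a).
    by apply: mx22P; rewrite !entE tr2E /=; ring.
  by apply: mx22P; rewrite !entE /=; ring.
by rewrite raddfN /=; ring.
Qed.
End BlockDet.

(** * The torsion *)

Section TauFun.
Variable A : comNzRingType.
(** The formula of Nguyen and Tran; the torsion is twice this function, see
    [is_torsionE]. *)
Definition tauW (n : int) (x y z : A) : A :=
  (2%:R - x - y + z) * cheb (trv x y z) (n - 1)
  + (2%:R - x) * (2%:R - y) * chebP (trv x y z) n.
End TauFun.

(** On the left is the determinant of the quaternion with coefficients q0, q1,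
    q2, q3, to which [torsion_det] reduces the torsion; the last term on the
    right vanishes on the character variety, where s f = 0. *)
Lemma torsion_norm_identity (A : comNzRingType) (x y z s p : A)
    (w := trv x y z - 2%:R) (d := 1 + w * p) (R := s + 2%:R * p)
    (p0 := foxm0 x y z s p) (p1 := foxm1 x y z s p)
    (r0 := foxmu0 x y z s p) (r1 := foxmu1 x y z s p)
    (f := x * y * d - z * (w * s + 2%:R * d))
    (q0 := p1 - (p0 + x * p1) - (r0 + x * r1)) (q1 := p0 + p1 + r1)
    (q2 := r0 + x * r1) (q3 := - r1) :
  s ^+ 2 = R + w * p ^+ 2 + w * s * p ->
  q0 ^+ 2 + q1 ^+ 2 + q2 ^+ 2 + q3 ^+ 2
   + q0 * (x * q1 + y * q2 + z * q3) - (z - x * y) * q1 * q2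
   + x * q2 * q3 + y * q1 * q3
  = 2%:R * ((2%:R - x - y + z) * s + (2%:R - x) * (2%:R - y) * p)
    + s * f * (1 + x * s + y * s - z * s + w * p - 2%:R * s).
Proof.
move=> rel; apply/eqP; rewrite -subr_eq0; apply/eqP.
(* The difference of the two sides is divisible by the Cassini relation; the
   second factor is the quotient. *)
transitivity ((s ^+ 2 - (R + w * p ^+ 2 + w * s * p)) * (
  - x ^+ 2 * y ^+ 2 * w * p ^+ 2 + x ^+ 2 * y ^+ 2 * s ^+ 2
  - 2%:R * x ^+ 2 * y ^+ 2 * p + x ^+ 2 * y * w * s * p
  + 2%:R * x ^+ 2 * y * w * p ^+ 2 - 2%:R * x ^+ 2 * y * s ^+ 2
  + 2%:R * x ^+ 2 * y * s + 4%:R * x ^+ 2 * y * p - x ^+ 2 * w * s ^+ 2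
  - 2%:R * x ^+ 2 * w * s * p - 4%:R * x ^+ 2 * s + x * y ^+ 2 * w * s * p
  + 2%:R * x * y ^+ 2 * s + x * y * z * w * p ^+ 2 - x * y * z * s ^+ 2
  + 2%:R * x * y * z * p - 4%:R * x * y * s + x * y + x * z * w * s ^+ 2
  - 2%:R * x * z * w * p ^+ 2 + 2%:R * x * z * s ^+ 2 - 4%:R * x * z * p
  - x * w ^+ 2 * s * p - 4%:R * x * w * s * p - 2%:R * x
  - 2%:R * y ^+ 2 * w * s * p + 2%:R * y ^+ 2 * w * p ^+ 2
  - 2%:R * y ^+ 2 * s ^+ 2 - 2%:R * y ^+ 2 * s + 4%:R * y ^+ 2 * p
  - 2%:R * y * z * s - 2%:R * y - z * w * s + 4%:R * z * s
  + 2%:R * w ^+ 2 * s * p - 2%:R * w ^+ 2 * p ^+ 2 + 2%:R * w * s ^+ 2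
  + 8%:R * w * s * p + 2%:R * w * s - 8%:R * w * p ^+ 2 - 4%:R * w * p
  + 8%:R * s ^+ 2 + 8%:R * s - 16%:R * p + 4%:R));
  last by rewrite rel subrr mul0r.
rewrite /q0 /q1 /q2 /q3 /p0 /p1 /r0 /r1 /foxm0 /foxm1 /foxmu0 /foxmu1 /f /R /d /w /trv.
ring.
Qed.

Lemma fWE (A : comNzRingType) n (x y z : A) (v := trv x y z) (s := cheb v (n - 1))
    (d := 1 + (v - 2%:R) * chebP v n) :
  fW n x y z = x * y * d - z * ((v - 2%:R) * s + 2%:R * d).
Proof.
have Sn : cheb v n = v * s - cheb v (n - 2) by exact: cheb_rec.
by rewrite /fW -/v Sn cheb_prevE -/s /d; ring.
Qed.

(** The matrix of [det_block_comm] in the basis 1, a, b, ab, so that its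
    determinant can be read off from [quat_det]. *)
Lemma quat_adj_comb (F : fieldType) (a b : 'M[F]_2) p0 p1 r0 r1 (x := \tr a) :
  \det a = 1 -> \det b = 1 ->
  lin_mx (x%:M - a) p1 p0 *m (a - 1%:M) + lin_mx (x%:M - a) r1 r0 *m (b - 1%:M)
  = quaternion a b (p1 - (p0 + x * p1) - (r0 + x * r1)) (p0 + p1 + r1) (r0 + x * r1) (- r1).
Proof.
move=> ha hb.
have -> : x%:M - a = quaternion a b x (-1) 0 0 by rewrite -quat_ainv // invmx2E.
have -> : a - 1%:M = quaternion a b (-1) 1 0 0.
  by rewrite [X in X - _](quat_a a b) (quat_c a b) quatN quatD; apply: quat_eq; ring.
have -> : b - 1%:M = quaternion a b (-1) 0 1 0.
  by rewrite [X in X - _](quat_b a b) (quat_c a b) quatN quatD; apply: quat_eq; ring.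
by rewrite !quat_lin !quat_mul // quatD; apply: quat_eq; rewrite -/x; ring.
Qed.

Section TorsionLinear.
Variable F : fieldType.
Variables (d2 : 'M[F]_(2, 2 + 2)) (d1 : 'M[F]_(2 + 2, 2)) (bt : 'M[F]_(2, 2 + 2)).
Hypotheses (dd : d2 *m d1 = 0) (bK : bt *m d1 \in unitmx).
Local Notation K := (bt *m d1).
Local Notation D := (\det (col_mx d2 bt)).

Let full_d1 : row_full d1.
Proof. by apply/row_fullP; exists (invmx K *m bt); rewrite -mulmxA mulVmx. Qed.

(** The rows of bt and their images split off an acyclic complex; what remains
    is acyclic exactly when the rows of d2 complete those of bt to a basis of
    the middle term. *)
Lemma acyclicP : acyclic d2 d1 <-> D != 0.
Proof.
split=> [[free2 _ _]|D0].
  apply/negP => /det0P [v vn0]; rewrite -[v]hsubmxK mul_row_col => E.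
  have w0 : rsubmx v = 0.
    have := congr1 (mulmx^~ d1) E; rewrite mulmxDl -mulmxA dd mulmx0 add0r mul0mx.
    by rewrite -mulmxA => /(congr1 (mulmx^~ (invmx K))); rewrite mulmxK // mul0mx.
  move: E; rewrite w0 mul0mx addr0 -[RHS](mul0mx _ d2) => /(row_free_inj free2) u0.
  by move: vn0; rewrite -[v]hsubmxK u0 w0 row_mx0 eqxx.
have uD : col_mx d2 bt \in unitmx by rewrite unitmxE unitfE.
have free2 : row_free d2.
  apply/row_freeP; exists (lsubmx (invmx (col_mx d2 bt))).
  have E : d2 *m invmx (col_mx d2 bt) = usubmx (1%:M : 'M_(2 + 2)).
    by rewrite -(mulmxV uD) mul_col_mx col_mxKu.
  rewrite mulmx_lsub E; apply/matrixP=> i j.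
  by rewrite !mxE eq_lshift.
split=> //; have le : (d2 <= kermx d1)%MS by apply/sub_kermxP.
rewrite -(mxrank_leqif_eq le) mxrank_ker (eqP full_d1) (eqP free2).
by [].
Qed.

(** The rows of d2 and bt give one admissible choice of bases. Any other
    choice changes them by a block triangular matrix whose determinant cancels
    in the alternating product. *)
Lemma torsion_valueP t : acyclic d2 d1 -> torsion_value d2 d1 t <-> t = D / \det K.
Proof.
move=> acy; have [free2 ker2 _] := acy.
have K0 : \det K != 0 by rewrite -unitfE -unitmxE.
split=> [[b0 [bt0 [b1 [bt1 [/andP[f0 e0] l0 /andP[f1 e1] l1 ->]]]]]|->].
  have /sub_kermxP : (bt0 - b0 *m invmx K *m bt) *m d1 = 0.
    by rewrite mulmxBl l0 -!mulmxA mulVmx // mulmx1 subrr.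
  rewrite -(eqmxP ker2) => /submxP[C hC].
  have -> : col_mx b1 bt0 = block_mx bt1 0 C (b0 *m invmx K) *m col_mx d2 bt.
    rewrite -[b1]l1 -[bt0](subrK (b0 *m invmx K *m bt)) hC.
    by rewrite mul_block_col mul0mx addr0.
  rewrite det_mulmx det_lblock det_mulmx det_inv.
  have b00 : \det b0 != 0 by rewrite -unitfE -unitmxE -row_free_unit.
  have bt10 : \det bt1 != 0.
    rewrite -unitfE -unitmxE -row_free_unit -row_leq_rank -{1}(eqP f1) -l1.
    exact: mxrankM_maxl.
  by field; rewrite bt10 b00 K0.
(* The simplest choice: b_0 = K lifted by bt, and b_1 = d2. *)
exists K, bt, d2, 1%:M; split; rewrite ?mul1mx ?det1 ?invr1 ?mulr1 //.
- rewrite row_free_unit bK /=; apply/andP; split; first exact: submxMl.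
  by apply: submx_full; rewrite row_full_unit.
- by rewrite free2 /= submx_refl.
by rewrite mulrC.
Qed.

End TorsionLinear.

Section Torsion.
Variable F : fieldType.
Variables (n : int) (rho : bool -> 'M[F]_2).
Hypothesis det_rho : forall g, \det (rho g) = 1.
Local Notation x := (\tr (rho mer_m)).
Local Notation y := (\tr (rho mer_mu)).
Local Notation z := (\tr (rho mer_m *m rho mer_mu)).
Hypothesis irr : trv x y z != 2%:R.
Hypothesis rel : cheb (trv x y z) (n - 1) * fW n x y z = 0.

Let A := right_action rho.
Let detA g : \det (A g) = 1.
Proof. by rewrite /A /right_action det_tr det_inv det_rho invr1. Qed.
Let trA g : \tr (A g) = \tr (rho g).
Proof.
by rewrite /A /right_action mxtrace_tr invmx2E // raddfB /= mxtrace_scalar; ring.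
Qed.
Let trAA : \tr (A mer_m *m A mer_mu) = z.
Proof.
rewrite /A /right_action -trmx_mul mxtrace_tr !invmx2E //.
have sE (W : 'M[F]_2) c i j : (c%:M - W) i j = c *+ (i == j) - W i j by rewrite !mxE.
by rewrite !tr2E !mul2E !sE /=; ring.
Qed.

Let a := A mer_m.
Let b := A mer_mu.
Let om := word_eval A (omega n).
Let om_m := fox A mer_m (omega n).
Let om_mu := fox A mer_mu (omega n).

Let irrA : trv (\tr a) (\tr b) (\tr (a *m b)) != 2%:R.
Proof. by rewrite !trA trAA. Qed.
Let relA : a *m om = om *m a.
Proof. by apply/(omega_comm detA n irrA); rewrite !trA trAA. Qed.

(** In the Fox derivative of m omega m^-1 omega^-1, the relation m omega =
    omega m cancels the images of m^-1 and omega^-1. *)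
Lemma fox_relator g : fox A g (relator n) =
  (1%:M - om) *m (if g == mer_m then 1%:M else 0) + (a - 1%:M) *m fox A g (omega n).
Proof.
have ua : a \in unitmx by rewrite unitmxE detA unitr1.
have uo : om \in unitmx by rewrite unitmxE (det_word_eval detA) unitr1.
rewrite /relator 3!fox_cat (fox_inv detA) -/om.
have -> : word_eval A [:: (mer_m, false)] = a by rewrite /= mulmx1.
have -> : word_eval A [:: (mer_m, true)] = invmx a by rewrite /= mulmx1.
rewrite -/om [fox A g [:: (mer_m, false)]]/= [fox A g [:: (mer_m, true)]]/= -/a.
rewrite [mer_m == g]eq_sym mulmx0 addr0; set dh := if _ then _ else _.
set G := fox A g (omega n).
rewrite sub0r !mulmxN !mulmxDr !mulmxN.
rewrite !mulmxA relA mulmxK // mulmxV // mul1mx mulmxBl !mul1mx mulmxBl mul1mx.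
by rewrite !addrA [dh + _ - _]addrAC.
Qed.

Let K := a *m b - b *m a.
Let bt : 'M[F]_(2, 2 + 2) := row_mx (1%:M - b) (a - 1%:M).

Let btK : bt *m bd1 rho = K.
Proof.
rewrite mul_row_col -/A -/a -/b mulmxBl mulmxBr !mulmxBl !mulmxBr !mul1mx !mulmx1.
by apply/matrixP=> i j; rewrite !mxE; ring.
Qed.

Let detK : \det K != 0.
Proof. by rewrite (comm_det (detA _) (detA _)) subr_eq0 eq_sym. Qed.

Let boundary : bd2 n rho *m bd1 rho = 0.
Proof.
rewrite mul_row_col -/A -(fox_fundamental detA).
have /(relator_eval detA n irrA) -> : cheb (trv (\tr a) (\tr b) (\tr (a *m b))) (n - 1)
   * fW n (\tr a) (\tr b) (\tr (a *m b)) = 0 by rewrite !trA trAA.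
by rewrite subrr.
Qed.

(** A multiple of the rows bt added to the rows of the relator replaces, by
    the fundamental formula for omega, each entry by the commutator of a with
    a Fox derivative of omega. Such commutators are multiples of [a, b]
    ([comm_quat]), so that [det_block_comm] applies. *)
Lemma torsion_det :
  \det (col_mx (bd2 n rho) bt) = \det K * (2%:R * tauW n x y z).
Proof.
have -> : \det (col_mx (bd2 n rho) bt)
    = \det (block_mx (a *m om_m - om_m *m a) (a *m om_mu - om_mu *m a)
                    (1%:M - b) (a - 1%:M)).
  (* U subtracts om_mu times the rows of bt from the rows of the relator. *)
  pose U : 'M[F]_(2 + 2) := block_mx 1%:M (- om_mu) 0 1%:M.
  have detU : \det U = 1 by rewrite det_ublock !det1 mulr1.
  rewrite -[LHS]mul1r -{1}detU -det_mulmx; congr (\det _).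
  rewrite -block_mxEv mulmx_block !mul1mx !mul0mx !add0r !mulNmx -/A !fox_relator.
  have := fox_fundamental detA (omega n); rewrite -/om -/om_m -/om_mu -/a -/b => fund.
  congr block_mx.
    have -> : 1%:M - om = - (om_m *m (a - 1%:M) + om_mu *m (b - 1%:M)).
      by rewrite -fund opprB.
    rewrite /= mulmx1 -/a -/om_m mulmxBl mul1mx !mulmxBr !mulmx1.
    by apply/matrixP=> i j; rewrite !mxE; ring.
  rewrite /= mulmx0 add0r mulmxBl mul1mx mulmxBr mulmx1.
  by apply/matrixP=> i j; rewrite !mxE; ring.
have [e0 [e1]] := fox_m_omega detA n irrA; rewrite -/om_m -/a -/b => ->.
have [g0 [g1]] := fox_mu_omega detA n irrA; rewrite -/om_mu -/a -/b => ->.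
rewrite !comm_quat det_block_comm -/K; congr (_ * _).
have -> : \tr (a *m b) = z by exact: trAA.
rewrite /a /b !trA -/a -/b; set s := cheb _ _; set p := chebP _ _.
set p1 := foxm1 _ _ _ _ _; set p0 := foxm0 _ _ _ _ _.
set r1 := foxmu1 _ _ _ _ _; set r0 := foxmu0 _ _ _ _ _.
have ta : \tr a = x by exact: trA.
have tb : \tr b = y by exact: trA.
have tab : \tr (a *m b) = z by exact: trAA.
rewrite -ta (quat_adj_comb _ _ _ _ (detA _) (detA _)) (quat_det (detA _) (detA _)).
rewrite ta tb tab torsion_norm_identity; last by exact: cheb_quadratic.
by rewrite -fWE -/s rel mul0r addr0.
Qed.

Theorem is_torsionE t : is_torsion n rho t <-> t = 2%:R * tauW n x y z.
Proof.
have uK : bt *m bd1 rho \in unitmx by rewrite unitmxE unitfE btK.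
have acy := acyclicP boundary uK; have val := torsion_valueP uK.
have D : \det (col_mx (bd2 n rho) bt) / \det (bt *m bd1 rho) = 2%:R * tauW n x y z.
  by rewrite btK torsion_det mulrC mulKf.
split=> [[h1 h2]|->].
  have [D0|D0] := eqVneq (\det (col_mx (bd2 n rho) bt)) 0.
    by rewrite -D D0 mul0r; apply: h2 => /acy; rewrite D0 eqxx.
  by have a1 := acy.2 D0; rewrite -D; apply: (proj1 (val _ t a1)); apply: h1.
split=> [a1|na]; first by apply: (proj2 (val _ _ a1)); rewrite D.
have [D0|D0] := eqVneq (\det (col_mx (bd2 n rho) bt)) 0.
  by rewrite -D D0 mul0r.
by case: na; apply/acy.
Qed.

End Torsion.

Section Morphisms.
Variables (A B : comNzRingType) (phi : {rmorphism A -> B}).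

Lemma rmorph_trv x y z : phi (trv x y z) = trv (phi x) (phi y) (phi z).
Proof. by rewrite /trv !(rmorph_nat, rmorphXn, rmorphB, rmorphM, rmorphD). Qed.

Lemma rmorph_chebP v n : phi (chebP v n) = chebP (phi v) n.
Proof.
by case: n => j; rewrite /= /cheb_sum rmorph_sum; apply: eq_bigr => i _;
  exact: (rmorph_cheb phi v i).
Qed.

Lemma rmorph_fW n x y z : phi (fW n x y z) = fW n (phi x) (phi y) (phi z).
Proof. by rewrite /fW !(rmorphB, rmorphM, rmorph_cheb, rmorph_trv). Qed.

Lemma rmorph_tauW n x y z : phi (tauW n x y z) = tauW n (phi x) (phi y) (phi z).
Proof.
by rewrite /tauW !(rmorph_nat, rmorphB, rmorphM, rmorphD, rmorph_cheb, rmorph_trv,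
  rmorph_chebP).
Qed.

End Morphisms.

(** * Irreducible representations and their characters *)

Section Irreducibility.
Variable F : closedFieldType.
Implicit Types (a b N : 'M[F]_2) (u w : 'cV[F]_2).

Lemma sqr_exists (c : F) : exists s, s ^+ 2 = c.
Proof.
have [s] := @solve_monicpoly F 2 (fun i => if i == 0%N then c else 0) isT.
by rewrite !big_ord_recl big_ord0 /= mulr1 mul0r !addr0; exists s.
Qed.

Lemma quadratic_root (p q : F) : exists t, t ^+ 2 - p * t + q = 0.
Proof.
have [t] := @solve_monicpoly F 2 (fun i => if i == 0%N then - q else p) isT.
rewrite !big_ord_recl big_ord0 /= expr1 mulr1 addr0 => E; exists t.
by rewrite E; ring.
Qed.

Lemma det0_ker N : \det N = 0 -> exists2 u : 'cV[F]_2, u != 0 & N *m u = 0.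
Proof.
move=> dN; have /eqP/det0P [v vn0 vN] : \det N^T = 0 by rewrite det_tr.
exists v^T; first by rewrite trmx_eq0.
by rewrite -[N]trmxK -trmx_mul vN trmx0.
Qed.

Lemma mulmx_colE N u i : (N *m u) i 0 = N i 0 * u 0 0 + N i 1 * u 1 0.
Proof.
rewrite mxE !big_ord_recl big_ord0 addr0.
by congr (N i _ * u _ _ + N i _ * u _ _); apply: val_inj.
Qed.

Lemma col2P u w : u 0 0 = w 0 0 -> u 1 0 = w 1 0 -> u = w.
Proof.
by move=> h0 h1; apply/matrixP=> i j; rewrite ord1; case: (ord2_cases i) => ->.
Qed.

(** The kernel of a nonzero matrix of size 2 has dimension at most 1. *)
Lemma ker_line N u w : N != 0 -> u != 0 -> N *m u = 0 -> N *m w = 0 ->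
  exists c, w = c *: u.
Proof.
move=> N0 u0 Nu Nw.
have dep : u 0 0 * w 1 0 = w 0 0 * u 1 0.
  apply/eqP; rewrite -subr_eq0; apply: contraNT N0 => D0.
  have z i j : N i j = 0.
    have eu := congr1 (fun M : 'cV_2 => M i 0) Nu; have ew := congr1 (fun M : 'cV_2 => M i 0) Nw.
    move: eu ew; rewrite !mulmx_colE !mxE => eu ew.
    case: (ord2_cases j) => ->; apply: (mulIf D0); rewrite mul0r.
      transitivity (w 1 0 * (N i 0 * u 0 0 + N i 1 * u 1 0)
                    - u 1 0 * (N i 0 * w 0 0 + N i 1 * w 1 0)); first by ring.
      by rewrite eu ew !mulr0 subr0.
    transitivity (u 0 0 * (N i 0 * w 0 0 + N i 1 * w 1 0)
                  - w 0 0 * (N i 0 * u 0 0 + N i 1 * u 1 0)); first by ring.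
    by rewrite eu ew !mulr0 subr0.
  by apply/eqP/matrixP=> i j; rewrite z mxE.
have [u00|u00] := eqVneq (u 0 0) 0; last first.
  exists (w 0 0 / u 0 0); apply: col2P; rewrite mxE ?divfK //.
  by rewrite mulrAC -dep mulrAC divff // mul1r.
have u10 : u 1 0 != 0.
  by apply: contraNneq u0 => u10; apply/eqP/col2P; rewrite mxE.
exists (w 1 0 / u 1 0); apply: col2P; rewrite mxE ?divfK //.
by apply: (mulIf u10); rewrite -dep u00 mulr0 !mul0r.
Qed.

Lemma eigenvector_exists a : exists2 u : 'cV[F]_2, u != 0 & exists c, a *m u = c *: u.
Proof.
have [t ht] := quadratic_root (\tr a) (\det a).
have d0 : \det (a - t%:M) = 0.
  by rewrite -ht det2E !mxE /= tr2E det2E; ring.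
have [u u0 hu] := det0_ker d0; exists u => //; exists t.
by move: hu; rewrite mulmxBl mul_scalar_mx => /eqP; rewrite subr_eq0 => /eqP.
Qed.

(** If K is singular and nonzero, its kernel is a line, which is invariant
    since K M = (tr M - M) K for M = a, b. If K = 0, the two matrices commute
    and have a common eigenvector. Conversely, K kills every common
    eigenvector. *)
Lemma irreducible_repP (rho : bool -> 'M[F]_2)
    (K := rho mer_m *m rho mer_mu - rho mer_mu *m rho mer_m) :
  irreducible_rep rho <-> \det K != 0.
Proof.
set a := rho mer_m in K *; set b := rho mer_mu in K *.
split=> [irr|dK u hu]; last first.
  have [[c hc] [d hd]] := (hu mer_m, hu mer_mu); rewrite -/a -/b in hc hd.
  have uK : K \in unitmx by rewrite unitmxE unitfE.
  rewrite -[u](mulKmx uK) [K *m u](_ : _ = 0) ?mulmx0 //.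
  rewrite /K mulmxBl -!mulmxA hc hd -!scalemxAr hc hd !scalerA mulrC subrr //.
apply/negP => /eqP dK.
suff [u u0 [[c hc] [d hd]]] : exists2 u : 'cV[F]_2, u != 0 &
    (exists c, a *m u = c *: u) /\ (exists c, b *m u = c *: u).
  by move/eqP: u0; apply; apply: irr => -[]; [exists d | exists c].
have [K0|K0] := eqVneq K 0.
  have comm : a *m b = b *m a by apply/eqP; rewrite -subr_eq0 -/K K0.
  have [u u0 [c hc]] := eigenvector_exists a.
  have [N0|N0] := eqVneq (a - c%:M) 0.
    have [w w0 hw] := eigenvector_exists b; exists w => //; split=> //.
    by exists c; rewrite -mul_scalar_mx; congr (_ *m _); apply/eqP; rewrite -subr_eq0 N0.
  exists u => //; split; first by exists c.
  apply: (ker_line N0 u0).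
    by rewrite mulmxBl mul_scalar_mx hc subrr.
  by rewrite mulmxBl mul_scalar_mx mulmxA comm -mulmxA hc -scalemxAr subrr.
have [u u0 hu] := det0_ker dK; exists u => //.
have swap (M : 'M[F]_2) : K *m M = lin_mx M (-1) (\tr M) *m K -> K *m (M *m u) = 0.
  by rewrite mulmxA => ->; rewrite -mulmxA hu mulmx0.
have bE (A B : 'M[F]_2) i j : (A - B) i j = A i j - B i j by rewrite !mxE.
have lE (W : 'M[F]_2) c d i j : lin_mx W c d i j = c * W i j + d *+ (i == j) by rewrite !mxE.
by split; apply: (ker_line K0 u0 hu); apply: swap; rewrite /K; apply: mx22P;
  rewrite !(mul2E, lE, bE) tr2E /=; ring.
Qed.

End Irreducibility.

Section CharacterVariety.
Variable F : closedFieldType.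
Implicit Types (p : 3.-tuple F) (n : int).

Local Notation X p := (coord p 0).
Local Notation Y p := (coord p 1).
Local Notation Z p := (coord p 2).

Definition point (x y z : F) : 3.-tuple F := [tuple x; y; z].

Lemma pointE p : p = point (X p) (Y p) (Z p).
Proof. by apply: val_inj; case: p => -[|x [|y [|z [|]]]]. Qed.

Definition vW p : F := trv (X p) (Y p) (Z p).

(** The equation is that of [relator_eval]. Conversely, every (x, y, z) is the
    character of the pair a = (x, -1; 1, 0), b = (0, t; -1/t, y), where t +
    1/t = z. *)
Lemma XirrP n p : Xirr n p <->
  cheb (vW p) (n - 1) * fW n (X p) (Y p) (Z p) = 0 /\ vW p != 2%:R.
Proof.
split=> [[rho [[drho rel] /irreducible_repP irr ->]]|].
  rewrite comm_det // subr_eq0 eq_sym in irr.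
  by rewrite /vW /=; split=> //; apply/(relator_eval drho n irr).
move=> [h irr].
have [t ht] := quadratic_root (Z p) 1.
have t0 : t != 0.
  by apply: contra_eq_neq ht => ->; rewrite expr0n mulr0 subrr add0r oner_eq0.
pose ma : 'M[F]_2 := \matrix_(i, j)
  if i == 0 then (if j == 0 then X p else -1) else (if j == 0 then 1 else 0).
pose mb : 'M[F]_2 := \matrix_(i, j)
  if i == 0 then (if j == 0 then 0 else t) else (if j == 0 then - t^-1 else Y p).
pose rho g := if g then mb else ma.
have drho g : \det (rho g) = 1.
  by case: g; rewrite det2E !mxE /=; [field | ring].
have tra : \tr ma = X p by rewrite tr2E !mxE /=; ring.
have trb : \tr mb = Y p by rewrite tr2E !mxE /=; ring.
have trab : \tr (ma *m mb) = Z p.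
  have zt : Z p * t = t ^+ 2 + 1.
    by rewrite -[RHS]addr0 -[V in _ = _ + V]oppr0 -[V in - V]ht; ring.
  by rewrite tr2E !mul2E !mxE /=; apply: (mulIf t0); rewrite zt; field.
have irr' : trv (\tr ma) (\tr mb) (\tr (ma *m mb)) != 2%:R.
  by rewrite tra trb trab.
exists rho; split.
- split=> //; apply/(relator_eval drho n irr').
  by rewrite /= tra trb trab.
- by apply/irreducible_repP; rewrite comm_det // subr_eq0 eq_sym.
by rewrite /char_of /= tra trb trab; exact: pointE.
Qed.

Definition X0 : {mpoly F[3]} := 'X_(inord 0).
Definition X1 : {mpoly F[3]} := 'X_(inord 1).
Definition X2 : {mpoly F[3]} := 'X_(inord 2).

Lemma meval_coords p :
  (X0.@[tnth p] = X p) * (X1.@[tnth p] = Y p) * (X2.@[tnth p] = Z p).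
Proof. by rewrite !mevalXU !(tnth_nth 0) /= !inordK. Qed.

Definition tauP n : {mpoly F[3]} := tauW n X0 X1 X2.

Lemma meval_tauP n p : (tauP n).@[tnth p] = tauW n (X p) (Y p) (Z p).
Proof. by rewrite /tauP (rmorph_tauW (meval (tnth p))) /= !meval_coords. Qed.

Lemma torsion_functionP n (T : {mpoly F[3]}) : is_torsion_function n T <->
  forall p, Xirr n p -> T.@[tnth p] = 2%:R * tauW n (X p) (Y p) (Z p).
Proof.
split=> [hT p [rho [rep irr ->]]|hT rho rep irr].
  have := hT rho rep irr; case: rep => drho rel.
  move/irreducible_repP: irr; rewrite comm_det // subr_eq0 eq_sym => irr.
  by move/(relator_eval drho n irr): rel => rel /(is_torsionE drho irr rel) ->.
have := hT (char_of rho) (ex_intro _ rho (And3 rep irr erefl)) => ->.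
case: rep => drho rel.
move/irreducible_repP: irr; rewrite comm_det // subr_eq0 eq_sym => irr.
by move/(relator_eval drho n irr): rel => rel; apply/(is_torsionE drho irr rel).
Qed.

End CharacterVariety.

(** * Irreducible sets in affine space *)

Lemma mpoly_ring_ind (R : comNzRingType) k (K : {mpoly R[k]} -> Prop) :
  (forall c, K c%:MP) -> (forall i, K 'X_i) ->
  (forall P Q, K P -> K Q -> K (P + Q)) ->
  (forall P Q, K P -> K Q -> K (P * Q)) -> forall P, K P.
Proof.
move=> KC KX KD KM; elim/mpolyind => [|c m P _ _ KP]; first by rewrite -mpolyC0.
apply: KD => //; rewrite -mul_mpolyC; apply: (KM) => //.
rewrite mpolyXE_id; elim/big_ind: _ => //; first by rewrite -mpolyC1.
by move=> i _; elim: (m i) => [|e IH]; rewrite ?expr0 -?mpolyC1 ?exprS // ; exact: KM.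
Qed.

Section Zariski.
Variable F : fieldType.
Implicit Types (X Y Z C : 3.-tuple F -> Prop) (P Q : {mpoly F[3]}).

Definition zeros P (p : 3.-tuple F) : Prop := P.@[tnth p] = 0.

Lemma zclosed_zeros P : zclosed (zeros P).
Proof. by exists (eq^~ P) => p; split=> [h _ ->|]; [|exact]. Qed.

(** Primality of the vanishing ideal depends only on the closure of Y, so that
    it can be tested on the image of a parametrization. *)
Definition prime_locus Y : Prop :=
  (exists p, Y p) /\ forall P Q, vanishing_ideal Y (P * Q) ->
    vanishing_ideal Y P \/ vanishing_ideal Y Q.

Lemma prime_zirreducible Y : prime_locus Y -> zirreducible Y.
Proof.
move=> [Y0 prm]; split=> // Z1 Z2 [S1 h1] [S2 h2] cov.
have [|n1] := pselect (subset_of Y Z1); first by left.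
right=> p Yp; apply/h2 => Q S2Q.
move: n1 => /existsNP [q] /not_implyP [Yq nZ1q].
have /existsNP [P] : ~ (forall P, S1 P -> P.@[tnth q] = 0) by move/h1.
move=> /not_implyP [S1P Pq].
have [hP|//] : vanishing_ideal Y P \/ vanishing_ideal Y Q; last by apply.
  apply: prm => r Yr; rewrite mevalM; case: (cov r Yr) => [/h1|/h2] h.
    by rewrite (h P) // mul0r.
  by rewrite (h Q) // mulr0.
by case: Pq; apply: hP.
Qed.

Lemma zirreducible_mul Y P Q : zirreducible Y -> vanishing_ideal Y (P * Q) ->
  vanishing_ideal Y P \/ vanishing_ideal Y Q.
Proof.
move=> [_ irr] h; have := irr _ _ (zclosed_zeros P) (zclosed_zeros Q); apply.
move=> p Yp; have := h p Yp; rewrite mevalM => /eqP; rewrite mulf_eq0.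
by case/orP => /eqP; [left | right].
Qed.

Definition zclosure Y (p : 3.-tuple F) : Prop :=
  forall P, vanishing_ideal Y P -> P.@[tnth p] = 0.

Lemma zclosed_closure Y : zclosed (zclosure Y).
Proof. by exists (vanishing_ideal Y). Qed.

(** Components are described by dense subsets: the intersection of X with the
    closure of Y is irreducible and contains C, so it is equal to C by
    maximality. Limit points of Y never have to be determined. *)
Lemma dense_component X Y C : irr_component X C -> prime_locus Y ->
  subset_of Y X -> subset_of C (zclosure Y) ->
  subset_of Y C /\ forall P, vanishing_ideal C P <-> vanishing_ideal Y P.
Proof.
move=> [CX _ maxC] [[y Yy] prm] YX CY.
pose W p := X p /\ zclosure Y p.
have YW : subset_of Y W by move=> p Yp; split; [exact: YX | move=> P; exact].
have idW P : vanishing_ideal W P <-> vanishing_ideal Y P.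
  by split=> h p hp; [apply/h/YW | apply: (proj2 hp)].
have YC : subset_of Y C.
  have WC : subset_of W C.
    apply: maxC; [|by move=> p []|by move=> p Cp; split; [exact: CX | exact: CY]].
    apply: prime_zirreducible; split; first by exists y; exact: YW.
    by move=> P Q /idW /prm [] h; [left | right]; apply/idW.
  by move=> p /YW /WC.
by split=> // P; split=> h p hp; [apply/h/YC | apply: (CY p hp)].
Qed.

End Zariski.

(** * Double covers *)

Section DoubleCover.
Variables (F : closedFieldType) (B : idomainType) (I : Type) (U : I -> Prop).
Variables (ev : I -> {rmorphism B -> F}) (Delta : B) (phi : I -> F -> 3.-tuple F).
Hypothesis const : forall c, exists b, forall i, ev i b = c.
Hypothesis dense : forall b, (forall i, U i -> ev i b = 0) -> b = 0.
Hypothesis nonsquare : forall a b, a ^+ 2 = b ^+ 2 * Delta -> b = 0.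

(** On the cover t^2 = Delta, a function is of the form (a + b t) / D with a,
    b, D functions on the base; U is the part of the base over which the cover
    is considered, and there the denominators do not vanish. *)
Definition cover_fun (P : {mpoly F[3]}) : Prop := exists D a b : B,
  (forall i, U i -> ev i D != 0) /\
  forall i t, U i -> t ^+ 2 = ev i Delta ->
    ev i D * P.@[tnth (phi i t)] = ev i a + ev i b * t.

Hypothesis coords : forall j : 'I_3, cover_fun 'X_j.
Hypothesis nonempty : exists i, U i.

Definition double_cover (p : 3.-tuple F) : Prop :=
  exists i t, [/\ U i, t ^+ 2 = ev i Delta & p = phi i t].

Lemma cover_funP P : cover_fun P.
Proof.
elim/mpoly_ring_ind: P => [c|//|P Q|P Q].
- have [b hb] := const c; exists 1, b, 0.
  split=> [i _|i t _ _]; first by rewrite rmorph1 oner_eq0.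
  by rewrite rmorph1 rmorph0 mevalC hb; ring.
- move=> [D [a [b [hD hP]]]] [D' [a' [b' [hD' hQ]]]].
  exists (D * D'), (a * D' + a' * D), (b * D' + b' * D).
  split=> [i Ui|i t Ui ht]; first by rewrite rmorphM mulf_neq0 ?hD ?hD'.
  rewrite mevalD !(rmorphM, rmorphD) /=.
  transitivity (ev i D' * (ev i D * P.@[tnth (phi i t)])
     + ev i D * (ev i D' * Q.@[tnth (phi i t)])); first by ring.
  by rewrite hP // hQ //; ring.
move=> [D [a [b [hD hP]]]] [D' [a' [b' [hD' hQ]]]].
exists (D * D'), (a * a' + b * b' * Delta), (a * b' + b * a').
split=> [i Ui|i t Ui ht]; first by rewrite rmorphM mulf_neq0 ?hD ?hD'.
rewrite mevalM !(rmorphM, rmorphD) /=.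
transitivity ((ev i D * P.@[tnth (phi i t)])
     * (ev i D' * Q.@[tnth (phi i t)])); first by ring.
by rewrite hP // hQ // -ht; ring.
Qed.

(** The product of the norms a^2 - b^2 Delta of two functions whose product
    vanishes on the cover is zero in the domain B. A norm is zero only if a =
    b = 0, because Delta is not a square. *)
Lemma prime_double_cover : prime_locus double_cover.
Proof.
split.
  have [i Ui] := nonempty; have [t ht] := sqr_exists (ev i Delta).
  by exists (phi i t), i, t.
move=> P Q hPQ.
have [D [a [b [hD hP]]]] := cover_funP P.
have [D' [a' [b' [hD' hQ]]]] := cover_funP Q.
have vanish E c d R (hE : forall i, U i -> ev i E != 0)
    (hR : forall i t, U i -> t ^+ 2 = ev i Delta ->
      ev i E * R.@[tnth (phi i t)] = ev i c + ev i d * t) :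
    c ^+ 2 - d ^+ 2 * Delta = 0 -> vanishing_ideal double_cover R.
  move=> /eqP; rewrite subr_eq0 => /eqP n0.
  have d0 := nonsquare n0; move: n0; rewrite d0 expr0n mul0r => /eqP.
  rewrite sqrf_eq0 => /eqP c0 p [i [t [Ui ht ->]]].
  apply: (mulfI (hE i Ui)); rewrite hR // c0 d0 rmorph0 !mul0r mulr0 addr0 //.
have : (a ^+ 2 - b ^+ 2 * Delta) * (a' ^+ 2 - b' ^+ 2 * Delta) = 0.
  apply: dense => i Ui; have [t ht] := sqr_exists (ev i Delta).
  rewrite !(rmorphM, rmorphB, rmorphXn) /= -ht.
  have pq s : s ^+ 2 = ev i Delta ->
      (ev i a + ev i b * s) * (ev i a' + ev i b' * s) = 0.
    move=> hs; rewrite -hP // -hQ // mulrACA -mevalM hPQ ?mulr0 //.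
    by exists i, s.
  transitivity ((ev i a + ev i b * t) * (ev i a' + ev i b' * t)
     * ((ev i a + ev i b * - t) * (ev i a' + ev i b' * - t))); first by ring.
  by rewrite pq // mul0r.
move/eqP; rewrite mulf_eq0 => /orP[] /eqP h; [left | right].
  exact: (vanish D a b P).
exact: (vanish D' a' b' Q).
Qed.

End DoubleCover.

(** * Polynomials in one variable *)

Section UnivariateNonsquares.
Variable F : fieldType.
Implicit Types a b g q : {poly F}.

Lemma odd_root_nonsquare r q a b :
  q.[r] != 0 -> a ^+ 2 = b ^+ 2 * (('X - r%:P) * q) -> b = 0.
Proof.
move=> qr E; apply/eqP; apply: contraT => b0.
have q0 : q != 0 by apply: contraNneq qr => ->; rewrite horner0.
have X0 : 'X - r%:P != 0 by rewrite polyXsubC_eq0.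
have a0 : a != 0.
  by rewrite -sqrf_eq0 E !mulf_neq0 ?sqrf_eq0 ?expf_neq0.
have := congr1 (mup r) E; rewrite !expr2 !mupM ?mulf_neq0 //.
have := mup_XsubCX 1 r r; rewrite expr1 eqxx => ->.
have -> : mup r q = 0%N by apply: mupNroot; rewrite rootE.
by move: (mup r a) (mup r b) => i j; lia.
Qed.

Lemma odd_degree_nonsquare g a b :
  ~~ odd (size g) -> g != 0 -> a ^+ 2 = b ^+ 2 * g -> b = 0.
Proof.
move=> odg g0 E; apply/eqP; apply: contraT => b0.
have a0 : a != 0 by rewrite -sqrf_eq0 E !mulf_neq0.
have := congr1 (fun p : {poly F} => size p) E.
rewrite !expr2 !size_mul ?mulf_neq0 //.
move: (size_poly_eq0 a) (size_poly_eq0 b) (size_poly_eq0 g).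
rewrite (negPf a0) (negPf b0) (negPf g0).
move: (size a) (size b) (size g) odg => i j k; lia.
Qed.

End UnivariateNonsquares.

Section InfiniteField.
Variable F : numFieldType.

Lemma poly_idfun_eq0 (B : idomainType) (iota : nat -> B) (p : {poly B}) :
  injective iota -> (forall i, p.[iota i] = 0) -> p = 0.
Proof.
move=> inj p0; apply/eqP; apply: contraT => pn0.
have := @max_poly_roots _ p [seq iota i | i <- seq.iota 0 (size p)] pn0.
rewrite size_map size_iota ltnn; apply.
  by apply/allP=> _ /mapP[i _ ->]; rewrite rootE p0.
by rewrite map_inj_uniq ?iota_uniq.
Qed.

Let natinj : injective (fun i : nat => i%:R : F).
Proof. by move=> i j /eqP; rewrite eqr_nat => /eqP. Qed.

Lemma poly_fun_eq0 (p : {poly F}) : (forall c, p.[c] = 0) -> p = 0.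
Proof. by move=> h; apply: (poly_idfun_eq0 natinj). Qed.

(** Polynomials in one variable that vanish outside finitely many points are
    zero; this is the density hypothesis of the double covers over a line. *)
Lemma poly_dense (g p : {poly F}) : g != 0 ->
  (forall c, g.[c] != 0 -> p.[c] = 0) -> p = 0.
Proof.
move=> g0 h; apply/eqP; have /eqP : p * g = 0.
  apply: poly_fun_eq0 => c; rewrite hornerM.
  by have [->|gc] := eqVneq g.[c] 0; rewrite ?mulr0 // h ?mul0r.
by rewrite mulf_eq0 (negPf g0) orbF.
Qed.

Lemma poly_nonroot (g : {poly F}) : g != 0 -> exists c, g.[c] != 0.
Proof.
move=> g0; apply: contrapT => /forallNP h; move/eqP: g0; apply.
by apply: poly_fun_eq0 => c; apply/eqP/negPn/negP/h.
Qed.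

Lemma poly2_fun_eq0 (p : {poly {poly F}}) :
  (forall x y, p.[y%:P].[x] = 0) -> p = 0.
Proof.
move=> h; apply: (@poly_idfun_eq0 _ (fun i => (i%:R)%:P)).
  by move=> i j /polyC_inj /natinj.
by move=> i; apply: poly_fun_eq0 => x.
Qed.

End InfiniteField.

Section ConstantValue.
Variable F : numClosedFieldType.
Implicit Types (Y : 3.-tuple F -> Prop).

(** If V satisfies a polynomial equation in one variable on Y, then a product
    of functions V - c vanishes on Y, so one of the factors does. *)
Lemma irr_const_value Y (V : {mpoly F[3]}) (g : {poly F}) : zirreducible Y ->
  g != 0 -> (forall p, Y p -> g.[V.@[tnth p]] = 0) ->
  exists2 c, g.[c] = 0 & forall p, Y p -> V.@[tnth p] = c.
Proof.
move=> irrY g0 hg; have [rs Eg] := closed_field_poly_normal g.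
have lg0 : lead_coef g != 0 by rewrite lead_coef_eq0.
have : vanishing_ideal Y (\prod_(c <- rs) (V - c%:MP)).
  move=> p Yp; have := hg p Yp; rewrite Eg hornerZ => /eqP.
  rewrite mulf_eq0 (negPf lg0) /= horner_prod rmorph_prod /= => /eqP <-.
  by apply: eq_bigr => c _; rewrite mevalB mevalC hornerXsubC.
have : {in rs, forall c, g.[c] = 0}.
  by move=> c crs; apply/eqP; rewrite Eg hornerZ mulf_eq0 (negPf lg0) -rootE root_prod_XsubC.
elim: rs {Eg hg} => [|c rs IH] hrs.
  have [[p Yp] _] := irrY; rewrite big_nil => /(_ p Yp) /eqP.
  by rewrite meval1 oner_eq0.
rewrite big_cons => /(zirreducible_mul irrY) [h|]; last first.
  by apply: IH => d drs; apply: hrs; rewrite inE drs orbT.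
exists c => [|p Yp]; first by apply: hrs; rewrite inE eqxx.
by have /eqP := h p Yp; rewrite mevalB mevalC subr_eq0 => /eqP.
Qed.

End ConstantValue.

(** * The surfaces v = c *)

Section Surfaces.
Variable F : numClosedFieldType.
Implicit Types (p : 3.-tuple F) (c : F).

Definition eval2 (q : F * F) : {rmorphism {poly {poly F}} -> F} :=
  horner_eval q.1 \o horner_eval q.2%:P.

Definition eval1 (q : F) : {rmorphism {poly F} -> F} := horner_eval q.

Lemma eval1E q (g : {poly F}) : eval1 q g = g.[q]. Proof. by []. Qed.
Lemma eval2E q g : eval2 q g = g.[q.2%:P].[q.1]. Proof. by []. Qed.

Lemma two_neq0 : (2%:R : F) != 0. Proof. by rewrite pnatr_eq0. Qed.

Lemma prime_locus_ext (Y Y' : 3.-tuple F -> Prop) :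
  (forall p, Y p <-> Y' p) -> prime_locus Y -> prime_locus Y'.
Proof.
move=> e [[p Yp] prm]; split; first by exists p; apply/e.
move=> P Q h; have [p' /e|hP|hQ] := prm P Q; first exact: h.
  by left=> p' /e; apply: hP.
by right=> p' /e; apply: hQ.
Qed.

Lemma pointX (x y z : F) : (coord (point x y z) 0 = x) * (coord (point x y z) 1 = y)
  * (coord (point x y z) 2 = z).
Proof. by []. Qed.

Lemma ord3_cases (j : 'I_3) : [\/ j = inord 0, j = inord 1 | j = inord 2].
Proof.
by case: j => -[|[|[|//]]] h;
  [apply: Or31 | apply: Or32 | apply: Or33]; apply: val_inj; rewrite /= inordK.
Qed.

Lemma meval_point (j : 'I_3) p : ('X_j : {mpoly F[3]}).@[tnth p] = coord p j.
Proof. by rewrite mevalXU (tnth_nth 0). Qed.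

(** As a quadratic equation in z, v = c is a double cover of the (x, y)-plane,
    with t = 2 z - x y. The leading coefficient in y of the discriminant is
    x^2 - 4; if the discriminant times a nonzero square were a square, so
    would be x^2 - 4 times a nonzero square, against its simple root x = 2. *)
Lemma surface_prime c : prime_locus (fun p : 3.-tuple F => vW p = c).
Proof.
pose x : {poly {poly F}} := 'X%:P; pose k (a : F) : {poly {poly F}} := a%:P%:P.
pose Delta := (x ^+ 2 - k 4%:R) * 'X ^+ 2 - k 4%:R * x ^+ 2 + k (4%:R * (c + 2%:R)).
pose phi (q : F * F) t := point q.1 q.2 ((q.1 * q.2 + t) / 2%:R).
have evD q : eval2 q Delta = (q.1 * q.2) ^+ 2 - 4%:R * (q.1 ^+ 2 + q.2 ^+ 2 - 2%:R - c).
  by rewrite eval2E /Delta /x /k !hornerE /=; ring.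
(* The base ring is F[x][y]; a pair q = (x, y) is evaluated by eval2. *)
apply: (@prime_locus_ext (double_cover (fun=> True) eval2 Delta phi)) => [p|].
  rewrite /vW /trv; split=> [[q [t [_ ht ->]]]|hv].
    rewrite /phi !pointX; move: ht; rewrite evD => ht.
    transitivity (c + (t ^+ 2 - ((q.1 * q.2) ^+ 2
        - 4%:R * (q.1 ^+ 2 + q.2 ^+ 2 - 2%:R - c))) / 4%:R); first by field.
    by rewrite ht subrr mul0r addr0.
  exists (coord p 0, coord p 1), (2%:R * coord p 2 - coord p 0 * coord p 1).
  split=> //; first by rewrite evD -hv /=; ring.
  by rewrite [LHS]pointE /phi /=; congr point; field.
apply: prime_double_cover.
- by move=> a; exists (k a) => q; rewrite eval2E /k !hornerE.
- move=> b hb; apply: poly2_fun_eq0 => u v; exact: (hb (u, v)).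
- move=> a b E; apply/eqP; rewrite -lead_coef_eq0; apply/eqP.
  apply: (@odd_root_nonsquare _ 2%:R ('X + 2%:R%:P) (lead_coef a)).
    rewrite (_ : _.[_] = 4%:R) ?pnatr_eq0 // hornerD hornerX hornerC; ring.
  have := congr1 lead_coef E; rewrite ![_ ^+ 2]expr2 !lead_coefM => ->; congr (_ * _).
  have szX : size ((x ^+ 2 - k 4%:R) * 'X ^+ 2) = 3%N.
    have -> : x ^+ 2 - k 4%:R = ('X ^+ 2 - 4%:R%:P)%:P by rewrite /x /k polyCB polyC_exp.
    rewrite mul_polyC size_scale ?size_polyXn //.
    by rewrite -size_poly_eq0 size_XnsubC.
  rewrite /Delta -addrA lead_coefDl.
    have -> : x ^+ 2 - k 4%:R = ('X ^+ 2 - 4%:R%:P)%:P by rewrite /x /k polyCB polyC_exp.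
    rewrite mul_polyC lead_coefZ lead_coefXn mulr1.
    have -> : 4%:R = 2%:R ^+ 2 :> F by ring.
    by rewrite polyC_exp; ring.
  rewrite szX.
  have -> : - (k 4%:R * x ^+ 2) + k (4%:R * (c + 2%:R))
     = (- (4%:R%:P * 'X ^+ 2) + (4%:R * (c + 2%:R))%:P)%:P.
    by rewrite /k /x [RHS]rmorphD [X in _ = X + _]rmorphN [X in _ = - X + _]rmorphM [X in _ = - (_ * X) + _]rmorphXn.
  by rewrite ltnS (leq_trans (size_polyC_leq1 _)).
- have cov (j : 'I_3) D a b : (forall q, eval2 q D != 0) ->
     (forall q t, eval2 q D * coord (phi q t) j = eval2 q a + eval2 q b * t) ->
     cover_fun (fun=> True) eval2 Delta phi 'X_j.
    by move=> h1 h2; exists D, a, b; split=> // i t _ _; rewrite meval_point.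
  move=> j; case: (ord3_cases j) => ->.
  + apply: (cov _ 1 x 0) => [q|q t]; first by rewrite rmorph1 oner_eq0.
    by rewrite rmorph1 rmorph0 inordK // eval2E /x !hornerE /=.
  + apply: (cov _ 1 'X 0) => [q|q t]; first by rewrite rmorph1 oner_eq0.
    by rewrite rmorph1 rmorph0 inordK // eval2E !hornerE /=.
  apply: (cov _ 2%:R (x * 'X) 1) => [q|q t]; first by rewrite rmorph_nat two_neq0.
  rewrite rmorph_nat rmorph1 inordK // eval2E /x !hornerE /=.
  by field.
by exists (0, 0).
Qed.

End Surfaces.

(** * Upper bounds for orders of vanishing *)

Section OrderEstimate.
Variable F : numFieldType.
Implicit Types (X C : 3.-tuple F -> Prop) (P : {mpoly F[3]}) (p q : 3.-tuple F).

Definition close (eta : F) p q : Prop := forall j, `|tnth p j - tnth q j| <= eta.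

Lemma mpoly_lipschitz q P : exists2 M, 0 < M & forall eta p,
  0 <= eta -> eta <= 1 -> close eta p q -> `|P.@[tnth p] - P.@[tnth q]| <= M * eta.
Proof.
elim/mpoly_ring_ind: P => [c|j|P Q [M M0 hP] [M' M0' hQ]|P Q [M M0 hP] [M' M0' hQ]].
- by exists 1 => // eta p e0 _ _; rewrite !mevalC subrr normr0 mul1r.
- by exists 1 => // eta p e0 _ h; rewrite !mevalXU mul1r.
- exists (M + M'); first exact: addr_gt0.
  move=> eta p e0 e1 h; rewrite !mevalD mulrDl opprD addrACA.
  by apply: le_trans (ler_normD _ _) _; apply: lerD; [exact: hP | exact: hQ].
exists (M * (`|Q.@[tnth q]| + M') + (`|P.@[tnth q]|) * M').
  by rewrite ltr_wpDr ?mulr_ge0 ?mulr_gt0 ?ltr_wpDl // ltW.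
move=> eta p e0 e1 h; rewrite !mevalM.
have -> : P.@[tnth p] * Q.@[tnth p] - P.@[tnth q] * Q.@[tnth q]
   = (P.@[tnth p] - P.@[tnth q]) * (Q.@[tnth q] + (Q.@[tnth p] - Q.@[tnth q]))
     + P.@[tnth q] * (Q.@[tnth p] - Q.@[tnth q]) by ring.
apply: le_trans (ler_normD _ _) _; rewrite !normrM mulrDl.
have hQ' := hQ eta p e0 e1 h.
apply: lerD; last by rewrite -mulrA ler_wpM2l.
rewrite mulrAC; apply: ler_pM => //; first exact: hP.
apply: le_trans (ler_normD _ _) _; rewrite lerD2l.
by apply: le_trans hQ' _; rewrite ler_piMr // ltW.
Qed.

(** Each of the k factors vanishes at q, hence is O(eta) at distance eta from
    q. *)
Lemma ideal_pow_bound C q k P : C q -> ideal_pow (vanishing_ideal C) k P ->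
  exists2 M, 0 < M & forall eta p,
  0 <= eta -> eta <= 1 -> close eta p q -> `|P.@[tnth p]| <= M * eta ^+ k.
Proof.
move=> Cq; elim: k P => [|k IH] P.
  move=> _; have [M M0 hM] := mpoly_lipschitz q P.
  exists (M + `|P.@[tnth q]|); first by rewrite ltr_wpDr.
  move=> eta p e0 e1 h; rewrite expr0 mulr1 -[P.@[tnth p]](subrK P.@[tnth q]).
  apply: le_trans (ler_normD _ _) _; rewrite lerD2r.
  by apply: le_trans (hM eta p e0 e1 h) _; rewrite ler_piMr // ltW.
move=> [s [hs ->]]; elim: s hs => [|u s IHs] hs.
  by exists 1 => // eta p e0 _ _; rewrite big_nil meval0 normr0 mul1r exprn_ge0.
have [|M M0 hM] := IHs; first by move=> w ws; apply: hs; rewrite inE ws orbT.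
have [|u1 u2] := hs u; first by rewrite inE eqxx.
have [M1 M10 h1] := mpoly_lipschitz q u.1.
have [M2 M20 h2] := IH u.2 u2.
exists (M1 * M2 + M); first by rewrite addr_gt0 ?mulr_gt0.
move=> eta p e0 e1 h; rewrite big_cons mevalD mulrDl.
apply: le_trans (ler_normD _ _) _; apply: lerD; last exact: hM.
rewrite mevalM normrM exprS mulrACA; apply: ler_pM => //; last exact: h2.
by have := h1 eta p e0 e1 h; rewrite (u1 q Cq) subr0.
Qed.

(** If s P = a + b with a in the (k+1)-st power of the ideal of C and b in
    that of X, then at the test points |s P| = |a| is O(e^(k+1)) by
    [ideal_pow_bound], while |s| tends to |s(q)| > 0 and |P| is at least c
    e^k. For small e this is a contradiction. *)
Lemma order_upper X C P k :
  (forall s, ~ vanishing_ideal C s -> exists q, [/\ C q, s.@[tnth q] != 0 &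
    exists L c K, [/\ 0 < L, 0 < c, 0 < K & forall e, 0 < e -> K * e <= 1 ->
      exists p, [/\ X p, close (L * e) p q & c * e ^+ k <= `|P.@[tnth p]|]]]) ->
  ~ in_max_pow X C P k.+1.
Proof.
move=> test [s [a [b [sC aC bX E]]]].
have [q [Cq s0 [L [c [K [L0 c0 K0 hp]]]]]] := test s sC.
have [Ms Ms0 hs] := mpoly_lipschitz q s.
have [M M0 ha] := ideal_pow_bound Cq aC.
set s1 := `|s.@[tnth q]|; have s10 : 0 < s1 by rewrite normr_gt0.
pose A1 := 2%:R * Ms * L / s1; pose A2 := 4%:R * M * L ^+ k.+1 / (s1 * c).
have A10 : 0 < A1 by rewrite divr_gt0 ?mulr_gt0.
have A20 : 0 < A2 by rewrite divr_gt0 ?mulr_gt0 ?exprn_gt0.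
(* The inverse of N is small enough for the four bounds K e <= 1, L e <= 1, A1
   e <= 1, A2 e <= 1, the last two giving |s| >= s1 / 2 and the contradiction.
   *)
pose N := K + L + A1 + A2; have N0 : 0 < N by rewrite !addr_gt0.
have Ne t : t <= N -> t * N^-1 <= 1 by move=> tN; rewrite ler_pdivrMr // mul1r.
pose e := N^-1; have e0 : 0 < e by rewrite invr_gt0.
have KN : K * e <= 1 by apply: Ne; rewrite /N -!addrA lerDl !addr_ge0 ?ltW.
have LN : L * e <= 1.
  by apply: Ne; rewrite /N [K + L]addrC -!addrA lerDl !addr_ge0 ?ltW.
have A1N : A1 * e <= 1.
  by apply: Ne; rewrite /N addrAC lerDr !addr_ge0 ?ltW.
have A2N : A2 * e <= 1 by apply: Ne; rewrite /N lerDr !addr_ge0 ?ltW.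
have [p [Xp hc hP]] := hp e e0 KN.
have Le0 : 0 <= L * e by rewrite ltW // mulr_gt0.
have sP : s.@[tnth p] * P.@[tnth p] = a.@[tnth p].
  by rewrite -mevalM E mevalD (bX p Xp) addr0.
have hsp : s1 / 2%:R <= `|s.@[tnth p]|.
  have h1 : `|s.@[tnth p] - s.@[tnth q]| <= s1 / 2%:R.
    apply: le_trans (hs _ p Le0 LN hc) _.
    have -> : Ms * (L * e) = (A1 * e) * (s1 / 2%:R).
      by rewrite /A1; field; rewrite gt_eqF.
    by rewrite ler_piMl // divr_ge0 // ltW.
  have h2 : s1 <= `|s.@[tnth p]| + s1 / 2%:R.
    rewrite {1}/s1 -[s.@[tnth q]](subrK s.@[tnth p]).
    by apply: le_trans (ler_normD _ _) _; rewrite addrC lerD2l distrC.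
  by rewrite -(lerD2r (s1 / 2%:R)); apply: le_trans h2; rewrite -mulrDl -mulr2n
     -[s1 *+ 2]mulr_natr mulfK ?pnatr_eq0.
have := ha _ p Le0 LN hc; rewrite -sP normrM => up.
have lo : (s1 / 2%:R) * (c * e ^+ k) <= `|s.@[tnth p]| * `|P.@[tnth p]|.
  by apply: ler_pM => //; rewrite ?divr_ge0 ?mulr_ge0 ?exprn_ge0 // ltW.
have := le_trans lo up.
have -> : M * (L * e) ^+ k.+1 = (A2 * e) * (s1 * c / 4%:R * e ^+ k).
  by rewrite /A2 exprMn [e ^+ k.+1]exprS; field; rewrite !gt_eqF.
move=> h; have {h} := le_trans h (ler_piMl _ A2N).
have pos : 0 < s1 * c / 4%:R * e ^+ k by rewrite mulr_gt0 ?divr_gt0 ?mulr_gt0 ?exprn_gt0 ?ltr0n.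
move=> /(_ (ltW pos)).
have -> : s1 / 2%:R * (c * e ^+ k) = (s1 * c / 4%:R * e ^+ k) *+ 2.
  by rewrite -mulr_natr; field.
by rewrite mulr2n gerDl lt_geF.
Qed.

End OrderEstimate.

(** * Chebyshev polynomials in one variable *)

Section ChebPoly.
Variable F : fieldType.

Lemma size_cheb_nat k : size (cheb_nat ('X : {poly F}) k) = k.+1
  /\ lead_coef (cheb_nat ('X : {poly F}) k) = 1.
Proof.
suff: (size (cheb_nat ('X : {poly F}) k) = k.+1
  /\ lead_coef (cheb_nat ('X : {poly F}) k) = 1) /\
  (size (cheb_nat ('X : {poly F}) k.+1) = k.+2
  /\ lead_coef (cheb_nat ('X : {poly F}) k.+1) = 1) by case.
elim: k => [|k [[s1 l1] [s2 l2]]].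
  by rewrite /= size_poly1 lead_coef1 size_polyX lead_coefX.
split=> //; rewrite -[cheb_nat _ k.+2]/('X * cheb_nat 'X k.+1 - cheb_nat 'X k).
have n0 : cheb_nat ('X : {poly F}) k.+1 != 0 by rewrite -size_poly_eq0 s2.
have sX : size ('X * cheb_nat ('X : {poly F}) k.+1) = k.+3 by rewrite mulrC size_mulX // s2.
by rewrite size_polyDl ?lead_coefDl ?size_polyN ?s1 ?sX // lead_coefM lead_coefX l2 mulr1.
Qed.

Lemma cheb_pred_cases (n : int) : n != 0 ->
  (exists2 k : nat, n = k.+1 & forall (A : comNzRingType) (v : A), cheb v (n - 1) = cheb v k)
  \/ (exists2 k : nat, n = - (k.+1%:Z) & forall (A : comNzRingType) (v : A), cheb v (n - 1) = - cheb v k).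
Proof.
case: n => [[//|k]|k] _; [left | right]; exists k => // A v.
  by congr cheb; rewrite -addn1 PoszD; ring.
by rewrite -cheb_neg; congr cheb; rewrite NegzE -addn1 PoszD; ring.
Qed.

Lemma size_cheb_pred (n : int) : n != 0 ->
  size (cheb ('X : {poly F}) (n - 1)) = absz n.
Proof.
by move=> /cheb_pred_cases [] [k -> ->]; rewrite ?abszN ?size_polyN;
  have [-> _] := size_cheb_nat k.
Qed.

Lemma horner_cheb (c : F) k : (cheb 'X k).[c] = cheb c k.
Proof. by have := rmorph_cheb (horner_eval c) 'X k; rewrite /= /horner_eval hornerX. Qed.

Lemma horner_chebP (c : F) k : (chebP 'X k).[c] = chebP c k.
Proof. by have := rmorph_chebP (horner_eval c) 'X k; rewrite /= /horner_eval hornerX. Qed.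

End ChebPoly.

(** * Lines on the surfaces v = c *)

Section Lines.
Variable F : numClosedFieldType.
Implicit Types (Y C : 3.-tuple F -> Prop) (p : 3.-tuple F).

(** If a product is small and the sum is not, the larger factor has at least
    half the size of the sum, and the smaller one is small. It is used to
    choose the root of a quadratic equation near a given number. *)
Lemma near_root (A B m rho : F) : A * B = m -> 0 < rho -> rho <= `|A + B| ->
  `|A| <= 2%:R * `|m| / rho \/ `|B| <= 2%:R * `|m| / rho.
Proof.
move=> AB rho0 hAB.
have key (U W : F) : U * W = m -> rho <= `|U + W| -> `|U| <= `|W| ->
    `|U| <= 2%:R * `|m| / rho.
  move=> UW hs le; rewrite ler_pdivlMr //.
  have h2 : rho <= 2%:R * `|W|.
    apply: le_trans hs _; apply: le_trans (ler_normD _ _) _.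
    by rewrite mulr_natl mulr2n lerD2r.
  have := ler_wpM2l (normr_ge0 U) h2.
  by rewrite mulrCA -normrM UW.
have /orP[le|le] : (`|A| <= `|B|) || (`|B| <= `|A|).
  by apply: real_leVge; apply: normr_real.
  by left; apply: (key A B).
by right; apply: (key B A); rewrite // 1?mulrC // addrC.
Qed.

(** Functions on a parametrized curve are polynomials in the parameter, which
    form a domain. *)
Lemma curve_prime (phi : F -> 3.-tuple F) :
  (forall j, exists g : {poly F}, forall t, tnth (phi t) j = g.[t]) ->
  prime_locus (fun p => exists t, p = phi t).
Proof.
move=> coords.
have all_P (P : {mpoly F[3]}) : exists g : {poly F}, forall t, P.@[tnth (phi t)] = g.[t].
  elim/mpoly_ring_ind: P => [c|j|P Q [g hg] [h hh]|P Q [g hg] [h hh]].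
  - by exists c%:P => t; rewrite mevalC hornerC.
  - by have [g hg] := coords j; exists g => t; rewrite mevalXU.
  - by exists (g + h) => t; rewrite mevalD hg hh hornerD.
  by exists (g * h) => t; rewrite mevalM hg hh hornerM.
split; first by exists (phi 0), 0.
move=> P Q hPQ; have [[g hg] [h hh]] := (all_P P, all_P Q).
have /eqP : g * h = 0.
  apply: poly_fun_eq0 => t; rewrite hornerM -hg -hh -mevalM.
  by apply: hPQ; exists t.
rewrite mulf_eq0 => /orP[] /eqP z; [left | right] => p [t ->].
  by rewrite hg z horner0.
by rewrite hh z horner0.
Qed.

(** The torsion and v are symmetric in x and y; the boolean lets the lines in
    x = 2 and in y = 2 be treated together. *)
Definition swapped_point (sw : bool) (x y z : F) : 3.-tuple F :=
  if sw then point y x z else point x y z.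

Lemma swapped_point_trv sw x y z : vW (swapped_point sw x y z) = trv x y z.
Proof. by case: sw; rewrite /vW /trv /coord /=; ring. Qed.

Lemma swapped_point_tau n sw x y z :
  tauW n (coord (swapped_point sw x y z) 0) (coord (swapped_point sw x y z) 1) (coord (swapped_point sw x y z) 2)
  = tauW n x y z.
Proof.
case: sw => //; have e : trv y x z = trv x y z by rewrite /trv; ring.
by rewrite /tauW /coord /= e; ring.
Qed.

Definition line_at2 (sw : bool) (s : F) p : Prop := exists t, p = swapped_point sw 2%:R t (t + s).

Lemma tnth_coord p (j : 'I_3) : tnth p j = coord p j.
Proof. by rewrite (tnth_nth 0). Qed.

Lemma line_at2_prime sw s : prime_locus (line_at2 sw s).
Proof.
apply: curve_prime => j; have h := ord3_cases j.
have [g [h0 h1 h2]] : exists g : nat -> {poly F}, [/\ g 0%N = (if sw then 'X else 2%:R%:P),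
   g 1%N = (if sw then 2%:R%:P else 'X) & g 2 = 'X + s%:P].
  by exists (fun i => if i == 0%N then (if sw then 'X else 2%:R%:P)
     else if i == 1%N then (if sw then 2%:R%:P else 'X) else 'X + s%:P).
exists (g j) => t; rewrite tnth_coord; case: h => ->; rewrite inordK // ?h0 ?h1 ?h2;
  by case: sw {h0 h1}; rewrite /= ?hornerD ?hornerX ?hornerC.
Qed.

End Lines.

(** * The divisor on the surfaces v = c *)

Section OtherComponents.
Variable F : numClosedFieldType.
Implicit Types (Y C : 3.-tuple F -> Prop) (p : 3.-tuple F).

Definition vP : {mpoly F[3]} := trv (X0 F) (X1 F) (X2 F).

Lemma meval_vP p : vP.@[tnth p] = vW p.
Proof. by rewrite /vP (rmorph_trv (meval (tnth p))) /= !meval_coords. Qed.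

Definition fP n : {mpoly F[3]} := fW n (X0 F) (X1 F) (X2 F).

Lemma meval_fP n p : (fP n).@[tnth p] = fW n (coord p 0) (coord p 1) (coord p 2).
Proof. by rewrite /fP (rmorph_fW (meval (tnth p))) /= !meval_coords. Qed.

Lemma meval_cheb k p : (cheb vP k).@[tnth p] = cheb (vW p) k.
Proof. by rewrite (rmorph_cheb (meval (tnth p))) /= meval_vP. Qed.

(** On an irreducible subset of S f_n = 0 one of the factors vanishes. If it
    is f_n, the set lies in the geometric part; otherwise v takes values in
    the finite set of roots of S, hence is a constant c, and the irreducible
    surface v = c is the whole component. *)
Lemma other_componentP n Y : n != 0 -> other_component n Y ->
  exists c, [/\ cheb c (n - 1) = 0, c != 2%:R & forall p, Y p <-> vW p = c].
Proof.
move=> n0 [compY notgeo]; have [YX irrY maxY] := compY.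
have [hS|hf] : vanishing_ideal Y (cheb vP (n - 1)) \/ vanishing_ideal Y (fP n).
- apply: zirreducible_mul => // p /YX /XirrP [h _].
  by rewrite mevalM meval_cheb meval_fP.
- have g0 : cheb ('X : {poly F}) (n - 1) != 0.
    by rewrite -size_poly_eq0 size_cheb_pred // absz_eq0.
  have [|c hc Yc] := irr_const_value irrY g0 (V := vP).
    by move=> p Yp; rewrite horner_cheb meval_vP -meval_cheb hS.
  have c2 : c != 2%:R.
    by have [[p Yp] _] := irrY; have /XirrP [_] := YX p Yp; rewrite -meval_vP Yc.
  rewrite horner_cheb in hc; exists c; split=> // p; split=> [/Yc|]; first by rewrite meval_vP.
  have [|||YC _] := @dense_component _ (Xirr n) (fun p => vW p = c) Y compY.
  + exact: surface_prime.
  + by move=> q /= hq; apply/XirrP; rewrite hq hc mul0r.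
  + move=> q /Yc; rewrite meval_vP => hq P; exact.
  by move=> /YC.
by case: notgeo => p Yp; split; [exact: YX | rewrite -meval_fP hf].
Qed.

Lemma swapped_point_close sw (e x y z x' y' z' : F) :
  `|x - x'| <= e -> `|y - y'| <= e -> `|z - z'| <= e ->
  close e (swapped_point sw x y z) (swapped_point sw x' y' z').
Proof.
move=> hx hy hz j; rewrite !tnth_coord.
by case: sw; case: (ord3_cases j) => ->; rewrite inordK.
Qed.

(** Near a point of the line x = 2, z = y + s, the equation v = c is quadratic
    in z; its two roots at x = 2 are y + s and y - s, and remain apart, so
    that one of the roots at x = 2 + e is at distance O(e) from y + s. *)
Lemma surface_lift sw c s y0 : s ^+ 2 = c - 2%:R -> s != 0 ->
  exists L K : F, [/\ 0 < L, 0 < K & forall e, 0 < e -> K * e <= 1 ->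
   exists z, vW (swapped_point sw (2%:R + e) y0 z) = c /\
     close (L * e) (swapped_point sw (2%:R + e) y0 z) (swapped_point sw 2%:R y0 (y0 + s))].
Proof.
move=> hs s0; pose z0 := y0 + s; have ns0 : 0 < `|s| by rewrite normr_gt0.
pose k := 4%:R + 1 + `|y0 * z0|; have k0 : 0 < k by rewrite ltr_wpDr ?addr_gt0 ?ltr01 ?ltr0n.
pose K := 1 + `|y0| / `|s|; have K0 : 0 < K by rewrite ltr_wpDr ?divr_ge0.
pose L := 1 + 2%:R * k / `|s|; have L0 : 0 < L by rewrite ltr_wpDr ?divr_ge0 ?mulr_ge0 ?ltW.
exists L, K; split=> // e e0 Ke.
have e1 : e <= 1.
  apply: le_trans Ke; rewrite mulrDl mul1r lerDl mulr_ge0 ?divr_ge0 //; exact: ltW.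
have ye : `|y0| * e <= `|s|.
  rewrite -[leRHS]mul1r -ler_pdivrMr // mulrAC; apply: le_trans Ke.
  by rewrite mulrDl lerDr mul1r ltW.
have [z1 hz1] := quadratic_root ((2%:R + e) * y0) ((2%:R + e) ^+ 2 + y0 ^+ 2 - 2%:R - c).
pose z2 := (2%:R + e) * y0 - z1.
have hz2 : z2 ^+ 2 - (2%:R + e) * y0 * z2 + ((2%:R + e) ^+ 2 + y0 ^+ 2 - 2%:R - c) = 0.
  by rewrite -hz1 /z2; ring.
(* The product is the value at z0 of the quadratic polynomial with roots z1
   and z2, which vanishes at z0 for e = 0. *)
have prod : (z0 - z1) * (z0 - z2) = e * (4%:R + e - y0 * z0).
  have E : c = s ^+ 2 + 2%:R by rewrite hs; ring.
  transitivity (z0 ^+ 2 - (2%:R + e) * y0 * z0 + ((2%:R + e) ^+ 2 + y0 ^+ 2 - 2%:R - c)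
     - (z1 ^+ 2 - (2%:R + e) * y0 * z1 + ((2%:R + e) ^+ 2 + y0 ^+ 2 - 2%:R - c))).
    by rewrite /z2; ring.
  by rewrite hz1 E /z0; ring.
have nprod : `|e * (4%:R + e - y0 * z0)| <= e * k.
  rewrite normrM (gtr0_norm e0); apply: ler_wpM2l; first exact: ltW.
  apply: le_trans (ler_normB _ _) _; rewrite lerD2r.
  by apply: le_trans (ler_normD _ _) _; rewrite normr_nat lerD2l gtr0_norm.
have sum : `|s| <= `|(z0 - z1) + (z0 - z2)|.
  have -> : (z0 - z1) + (z0 - z2) = 2%:R * s - e * y0 by rewrite /z2 /z0; ring.
  apply: le_trans (lerB_dist _ _); rewrite !normrM normr_nat.
  by rewrite lerBrDr mulr_natl mulr2n lerD2l gtr0_norm // mulrC.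
have [e0' k0'] := (ltW e0, ltW k0).
have fin z : `|z0 - z| <= 2%:R * `|e * (4%:R + e - y0 * z0)| / `|s| ->
    close (L * e) (swapped_point sw (2%:R + e) y0 z) (swapped_point sw 2%:R y0 (y0 + s)).
  have Le : e <= L * e by rewrite ler_peMl // lerDl divr_ge0 ?mulr_ge0.
  move=> h; apply: swapped_point_close; rewrite -/z0.
  - by rewrite addrAC subrr add0r gtr0_norm.
  - by rewrite subrr normr0; apply: le_trans Le.
  rewrite distrC; apply: le_trans h _.
  apply: (@le_trans _ _ (2%:R * k / `|s| * e)); last first.
    by rewrite ler_wpM2r // lerDr.
  rewrite [leRHS]mulrAC ler_wpM2r ?invr_ge0 // -mulrA ler_wpM2l //.
  by rewrite [k * e]mulrC.
have [h|h] := near_root prod ns0 sum.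
  exists z1; split; last exact: fin.
  by rewrite swapped_point_trv /trv; apply/eqP; rewrite -subr_eq0 -hz1; apply/eqP; ring.
exists z2; split; last exact: fin.
by rewrite swapped_point_trv /trv; apply/eqP; rewrite -subr_eq0 -hz2; apply/eqP; ring.
Qed.

(** On v = c the torsion is 2 (2 - x) (2 - y) P(c). It vanishes on the line,
    and at the points of [surface_lift] it is a nonzero multiple of e as long
    as the coordinate along the line is not 2, so its order is exactly 1. *)
Lemma order_line n c s sw Y C (T : {mpoly F[3]}) :
  cheb c (n - 1) = 0 -> chebP c n != 0 -> s ^+ 2 = c - 2%:R -> s != 0 ->
  (forall p, Y p <-> vW p = c) ->
  (forall p, Y p -> T.@[tnth p] = 2%:R * tauW n (coord p 0) (coord p 1) (coord p 2)) ->
  (exists p, C p) -> (forall p, C p -> T.@[tnth p] = 0) ->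
  subset_of (line_at2 sw s) C ->
  (forall P, vanishing_ideal C P <-> vanishing_ideal (line_at2 sw s) P) ->
  order_along Y C T 1.
Proof.
move=> hS hP hs s0 YE TE [q0 Cq0] CT lC idC; split.
  exists 1, T, 0; split.
  - by move=> /(_ q0 Cq0) /eqP; rewrite meval1 oner_eq0.
  - exists [:: (T, 1)]; split; last by rewrite big_seq1 /= mulr1.
    by move=> u; rewrite inE => /eqP ->.
  - by move=> p _; rewrite meval0.
  by rewrite mul1r addr0.
apply: order_upper => r rC.
(* W cuts out the point x = y = 2 of the line, where 2 - x and 2 - y vanish
   together. *)
pose W : {mpoly F[3]} := (if sw then X0 F else X1 F) - 2%:R%:MP.
have Wval x y z : W.@[tnth (swapped_point sw x y z)] = y - 2%:R.
  by rewrite /W; case: sw {W lC idC}; rewrite mevalB mevalC meval_coords.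
have [q [t qE] rq] : exists2 q, line_at2 sw s q & (r * W).@[tnth q] != 0.
  apply: contrapT => h; have [_ prm] := line_at2_prime sw s.
  have [|hr|hW] := prm r W.
  - move=> p lp; apply/eqP; apply: contraT => np; case: h; exists p => //.
  - by apply: rC; apply/idC.
  have := hW (swapped_point sw 2%:R 3%:R (3%:R + s)) (ex_intro _ 3%:R erefl).
  rewrite Wval => /eqP; rewrite (_ : 3%:R - 2%:R = 1) ?oner_eq0 //; ring.
move: rq; rewrite qE mevalM mulf_eq0 negb_or Wval => /andP[rq tq].
exists (swapped_point sw 2%:R t (t + s)); split; [by apply: lC; exists t | exact: rq |].
have [L [K [L0 K0 lift]]] := surface_lift sw t hs s0.
pose m := `|2%:R * (t - 2%:R) * chebP c n|.
exists L, m, K; split=> //.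
  by rewrite normr_gt0 !mulf_neq0 // pnatr_eq0.
move=> e e0 Ke; have [z [vz cl]] := lift e e0 Ke.
exists (swapped_point sw (2%:R + e) t z); split=> //; first by apply/YE.
have Yp : Y (swapped_point sw (2%:R + e) t z) by apply/YE.
rewrite TE // swapped_point_tau /tauW -[trv _ _ _](swapped_point_trv sw) vz hS mulr0 add0r expr1.
have -> : 2%:R * ((2%:R - (2%:R + e)) * (2%:R - t) * chebP c n)
  = 2%:R * (t - 2%:R) * chebP c n * e by ring.
by rewrite normrM (gtr0_norm e0).
Qed.

(** Where x = 2 on v = c, the equation is (z - y)^2 = c - 2, a pair of lines;
    likewise where y = 2. *)
Theorem other_component_divisor n Y (T : {mpoly F[3]}) : n != 0 ->
  is_torsion_function n T -> other_component n Y ->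
  divisor_has_multiplicity Y T 1 \/ vanishes_on Y T.
Proof.
move=> n0 /torsion_functionP torT oY.
have [c [hS c2 YE]] := other_componentP n0 oY.
have TE p : Y p -> T.@[tnth p] = 2%:R * tauW n (coord p 0) (coord p 1) (coord p 2).
  by move=> Yp; apply: torT; have [[YX _ _] _] := oY; exact: YX.
have TE' p : Y p -> T.@[tnth p] = 2%:R * ((2%:R - coord p 0) * (2%:R - coord p 1)) * chebP c n.
  by move=> Yp; rewrite TE // /tauW -[trv _ _ _]/(vW p) (proj1 (YE p) Yp) hS; ring.
have [P0|P0] := eqVneq (chebP c n) 0; [right | left].
  by move=> p Yp; rewrite TE' // P0 mulr0.
have [s hs] := sqr_exists (c - 2%:R).
have s0 : s != 0 by rewrite -sqrf_eq0 hs subr_eq0.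
split.
  have [z hz] := sqr_exists (c + 2%:R).
  have Yp : Y (point 0 0 z) by apply/YE; rewrite /vW /trv /coord /= hz; ring.
  move=> /(_ _ Yp) /eqP; rewrite TE' //= !subr0 !mulf_eq0 (negPf P0).
  by rewrite !pnatr_eq0.
move=> C compC; have [CX irrC _] := compC.
have hC : vanishing_ideal C ((X0 F - 2%:R%:MP) * (X1 F - 2%:R%:MP)).
  move=> p /CX [Yp]; rewrite TE' // => /eqP.
  rewrite !mulf_eq0 (negPf P0) orbF pnatr_eq0 /= mevalM !mevalB !mevalC !meval_coords.
  by case/orP; rewrite subr_eq0 eq_sym -subr_eq0 => /eqP ->; rewrite ?mul0r ?mulr0.
have [sw hsw] : exists sw, forall p, C p ->
    exists y z, p = swapped_point sw 2%:R y z.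
  have [h|h] := zirreducible_mul irrC hC; [exists false | exists true] => p Cp;
    have /eqP := h p Cp; rewrite mevalB mevalC meval_coords subr_eq0 => /eqP e.
    by exists (coord p 1), (coord p 2); rewrite [LHS]pointE e.
  by exists (coord p 0), (coord p 2); rewrite [LHS]pointE e.
pose D (r : F) : {mpoly F[3]} := X2 F - (if sw then X0 F else X1 F) - r%:MP.
have Dval r x y z : (D r).@[tnth (swapped_point sw x y z)] = z - y - r.
  by rewrite /D; case: (sw); rewrite !mevalB mevalC !meval_coords.
have hC2 : vanishing_ideal C (D s * D (- s)).
  move=> p Cp; have [y [z pE]] := hsw p Cp.
  have := proj1 (YE p) (proj1 (CX p Cp)); rewrite pE swapped_point_trv mevalM !Dval => hv.
  transitivity (c - 2%:R - s ^+ 2); last by rewrite hs subrr.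
  by rewrite -hv /trv; ring.
have [r [r0 hr Cr]] : exists r, [/\ r != 0, r ^+ 2 = c - 2%:R & vanishing_ideal C (D r)].
  by case: (zirreducible_mul irrC hC2) => h; [exists s | exists (- s)];
    rewrite ?sqrrN ?oppr_eq0.
have lineY p : line_at2 sw r p -> Y p.
  move=> [t ->]; apply/YE; rewrite swapped_point_trv.
  by rewrite -[RHS](subrK 2%:R) -hr /trv; ring.
have Cl : subset_of C (line_at2 sw r).
  move=> p Cp; have [y [z pE]] := hsw p Cp.
  have := Cr p Cp; rewrite pE Dval => /eqP; rewrite subr_eq0 => /eqP h.
  by exists y; rewrite -h addrC subrK.
have [||lC idC] := dense_component compC (line_at2_prime sw r).
- move=> p lp; split; first exact: lineY.
  rewrite TE'; last exact: lineY.
  by case: lp => t ->; case: (sw); rewrite /= subrr ?mulr0 ?mul0r ?mulr0 ?mul0r.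
- by move=> p /Cl lp P; exact.
apply: (order_line hS P0 hr r0 YE TE _ _ lC idC); first by case: irrC.
by move=> p /CX [].
Qed.

End OtherComponents.

(** * Identities on the geometric surface *)

Section GeometricFunctions.
Variables (A : comNzRingType) (n : int).

Definition dW (v : A) : A := 1 + (v - 2%:R) * chebP v n.
Definition TW (v : A) : A := (v - 2%:R) * cheb v (n - 1) + 2%:R * dW v.
(** The factor of (T + 2) d tau on the geometric surface that is left after
    the double factor S^2, see [tau_factor]. *)
Definition EW (v x y z : A) : A :=
  2%:R * (TW v + 2%:R) * z + (v + 2%:R) * (2%:R * dW v - z - dW v * (x + y)).
(** The square of this function is, up to a factor in v, the norm of [EW]
    under (x, y) |-> (-x, -y), an involution that preserves v and the
    geometric surface; see [E_norm]. *)
Definition HW (v z : A) : A := (TW v + 2%:R) * z + (v + 2%:R) * dW v.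
(** The value of S^2 (x + y) on the curve where tau = 0 and S is not zero, see
    [zero_locus]. *)
Definition SigW (v : A) : A := cheb v (n - 1) ^+ 2
  - (v - 2%:R) * chebP v n ^+ 2 - (v - 2%:R) * chebP v n * cheb v (n - 1).

Lemma fW_geom x y z : fW n x y z = x * y * dW (trv x y z) - z * TW (trv x y z).
Proof. exact: fWE. Qed.

(** The degree of T in v is visible in this form. *)
Lemma TW_cheb v : TW v = cheb v n - cheb v (n - 2).
Proof.
have -> : cheb v n = v * cheb v (n - 1) - cheb v (n - 2) by exact: cheb_rec.
by rewrite /TW /dW cheb_prevE; ring.
Qed.

End GeometricFunctions.

Section GeometricMorphisms.
Variables (A B : comNzRingType) (phi : {rmorphism A -> B}) (n : int).

Lemma rmorph_dW v : phi (dW n v) = dW n (phi v).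
Proof. by rewrite /dW !(rmorph1, rmorph_nat, rmorphB, rmorphM, rmorphD, rmorph_chebP). Qed.

Lemma rmorph_TW v : phi (TW n v) = TW n (phi v).
Proof. by rewrite /TW !(rmorph_cheb, rmorph_dW, rmorph_nat, rmorphB, rmorphM, rmorphD). Qed.

Lemma rmorph_EW v x y z : phi (EW n v x y z) = EW n (phi v) (phi x) (phi y) (phi z).
Proof. by rewrite /EW !(rmorph_TW, rmorph_dW, rmorph_nat, rmorphB, rmorphM, rmorphD). Qed.

Lemma rmorph_HW v z : phi (HW n v z) = HW n (phi v) (phi z).
Proof. by rewrite /HW !(rmorph_TW, rmorph_dW, rmorph_nat, rmorphM, rmorphD). Qed.

Lemma rmorph_SigW v : phi (SigW n v) = SigW n (phi v).
Proof.
by rewrite /SigW !(rmorph_nat, rmorphXn, rmorphB, rmorphM, rmorphD, rmorph_cheb, rmorph_chebP).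
Qed.

End GeometricMorphisms.

Section GeometricIdentities.
Variables (A : idomainType) (n : int).
Implicit Types x y z v : A.

Section AtV.
Variable v : A.
Hypothesis v2 : v != 2%:R.
Local Notation S := (cheb v (n - 1)).
Local Notation P := (chebP v n).
Local Notation w := (v - 2%:R).
Local Notation d := (dW n v).
Local Notation T := (TW n v).

Let rel := cheb_quadratic n v2.
Let rel0 : S ^+ 2 - (S + 2%:R * P + w * P ^+ 2 + w * S * P) = 0.
Proof. by rewrite rel subrr. Qed.

(** It shows that [SigW] is not zero as a polynomial in v, and reduces the
    discriminant of Gamma to T and v in [disc_rel]. *)
Lemma SigW_rel : (T + 2%:R) * SigW n v = (v + 2%:R) * S ^+ 2.
Proof.
apply/eqP; rewrite -subr_eq0 -[X in _ == X](mulr0 (w * S + 2%:R * w * P)) -rel0.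
by rewrite /TW /SigW /dW; apply/eqP; move: S P => s p; ring.
Qed.

(** This says that [HW] vanishes on Gamma, where S^2 z = - (S^2 + w P^2). *)
Lemma HW_rel : (T + 2%:R) * (S ^+ 2 + w * P ^+ 2) = (v + 2%:R) * d * S ^+ 2.
Proof.
apply/eqP; rewrite -subr_eq0 -[X in _ == X](mulr0 (w * S - 2%:R * w * P)) -rel0.
by rewrite /TW /dW; apply/eqP; move: S P => s p; ring.
Qed.

(** On Gamma one has S^2 (x + y) = SigW and xy = 2 (x + y) - (v + 2), so (S^2
    (x - y))^2 is the second factor on the left. The right-hand side has odd
    degree in v, as its last factor has degree twice that of T. *)
Lemma disc_rel (Sg := SigW n v) :
  (T + 2%:R) ^+ 2 * (Sg ^+ 2 - 8%:R * Sg * S ^+ 2 + 4%:R * (v + 2%:R) * S ^+ 4)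
  = (v + 2%:R) * S ^+ 4
    * ((v + 2%:R) - 8%:R * (T + 2%:R) + 4%:R * (T + 2%:R) ^+ 2).
Proof.
have e : (T + 2%:R) * Sg = (v + 2%:R) * S ^+ 2 := SigW_rel.
transitivity (((T + 2%:R) * Sg) ^+ 2
   - 8%:R * ((T + 2%:R) * Sg) * ((T + 2%:R) * S ^+ 2)
   + 4%:R * (v + 2%:R) * S ^+ 4 * (T + 2%:R) ^+ 2); first by ring.
by rewrite e; ring.
Qed.

End AtV.

Variables x y z : A.
Local Notation v := (trv x y z).
Hypothesis v2 : v != 2%:R.
Local Notation S := (cheb v (n - 1)).
Local Notation P := (chebP v n).
Local Notation w := (v - 2%:R).
Local Notation d := (dW n v).
Local Notation T := (TW n v).
Hypothesis f0 : fW n x y z = 0.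

Let rel0 : S ^+ 2 - (S + 2%:R * P + w * P ^+ 2 + w * S * P) = 0.
Proof. by rewrite (cheb_quadratic n v2) subrr. Qed.
Let geo0 : x * y * d - z * T = 0.
Proof. by rewrite -fW_geom. Qed.

(** The source of the double zeros along the curves where S vanishes. *)
Lemma tau_factor :
  (T + 2%:R) * d * tauW n x y z = S ^+ 2 * EW n v x y z.
Proof.
apply/eqP; rewrite -subr_eq0.
(* The difference of the two sides is a combination of the Cassini relation
   and of the equation of the surface, with the cofactors inserted here. *)
rewrite -[X in _ == X]addr0 -[X in _ == X + _](mulr0 (4%:R * x * w * P + 4%:R * x
  + 4%:R * y * w * P + 4%:R * y - 2%:R * z * w * S - 4%:R * z * w * P - 4%:R * z
  - 8%:R * w * P - 8%:R)) -[X in _ == _ * X + _]rel0.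
rewrite -[X in _ == _ + X](mulr0 ((T + 2%:R) * P)) -[X in _ == _ + _ * X]geo0.
rewrite /tauW /EW /TW /dW; apply/eqP; move: S P v => s p u; ring.
Qed.

(** The source of the double zeros along Gamma: where the conjugate of E is
    not zero, E has the order of H^2. *)
Lemma E_norm : EW n v x y z * EW n v (- x) (- y) z = - w * HW n v z ^+ 2.
Proof.
apply/eqP; rewrite -subr_eq0.
(* Cofactors of the Cassini relation and of the equation of the surface. *)
rewrite -[X in _ == X]addr0 -[X in _ == X + _](mulr0 (z ^+ 2 * w ^+ 3 + 4%:R * z ^+ 2 * w ^+ 2))
  -[X in _ == _ * X + _]rel0.
rewrite -[X in _ == _ + X](mulr0 (- (v + 2%:R) ^+ 2 * d * (z + 2%:R))) -[X in _ == _ + _ * X]geo0.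
rewrite /HW /EW /TW /dW; apply/eqP; move: S P => s p; rewrite /trv; ring.
Qed.

End GeometricIdentities.

(** * The zeros of tau on the geometric surface *)

(** With q = P / S and a = (2 - x) (2 - y), the equation tau = 0 gives x + y =
    z + 2 + q a, and then v - 2 = a k with k = q^2 a - z - 2. The equation of
    the surface becomes a S (k + 1)^2 = 0, so k = -1, and everything is
    expressed by v. *)
Lemma zero_locus_alg (F : fieldType) (x y z s p w : F) (d := 1 + w * p) :
  w = trv x y z - 2%:R -> w != 0 -> s != 0 ->
  s ^+ 2 = s + 2%:R * p + w * p ^+ 2 + w * s * p ->
  x * y * d - z * (w * s + 2%:R * d) = 0 ->
  (2%:R - x - y + z) * s + (2%:R - x) * (2%:R - y) * p = 0 ->
  [/\ (2%:R - x) * (2%:R - y) = - w,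
      s ^+ 2 * (x + y) = s ^+ 2 - w * p ^+ 2 - w * p * s
    & s ^+ 2 * z = - (s ^+ 2 + w * p ^+ 2)].
Proof.
move=> wE w0 s0 rel f0 t0; set a := (2%:R - x) * (2%:R - y); pose q := p / s.
have pE : p = q * s by rewrite divfK.
have {}t0 : x + y = z + 2%:R + q * a.
  apply: (mulIf s0); apply/eqP; rewrite -subr_eq0 -oppr_eq0 -t0 pE -/a; apply/eqP; ring.
have xy : x * y = 2%:R * z + a * (1 + 2%:R * q).
  have -> : x * y = a - 4%:R + 2%:R * (x + y) by rewrite /a; ring.
  by rewrite t0; ring.
pose k := q ^+ 2 * a - z - 2%:R.
have wak : w = a * k.
  rewrite wE; transitivity ((x + y) ^+ 2 - 2%:R * (x * y) + z ^+ 2 - x * y * z - 4%:R).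
    by rewrite /trv; ring.
  by rewrite t0 xy /k; ring.
have a0 : a != 0 by apply: contraNneq w0 => a0; rewrite wak a0 mul0r.
have relq : s * (1 - w * q ^+ 2 - w * q) = 1 + 2%:R * q.
  apply: (mulIf s0); apply/eqP; rewrite -subr_eq0; apply/eqP.
  transitivity (s ^+ 2 - (s + 2%:R * p + w * p ^+ 2 + w * s * p)); first by rewrite pE; ring.
  by rewrite rel subrr.
(* The equation of the surface is a s (k + 1)^2 = 0. *)
have k1 : k = -1.
  apply/eqP; rewrite -addr_eq0 -sqrf_eq0; apply/eqP.
  apply: (mulfI s0); apply: (mulfI a0); rewrite !mulr0 -[RHS]f0.
  transitivity (a * s * (1 + w * q ^+ 2 - (z * k))).
    by rewrite wak /k; ring.
  have -> : 1 + w * q ^+ 2 = (1 - w * q ^+ 2 - w * q) + (1 + 2%:R * q) * (w * q) by ring.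
  transitivity (a * (s * (1 - w * q ^+ 2 - w * q) + s * (1 + 2%:R * q) * (w * q)) - z * s * (a * k)).
    by ring.
  by rewrite relq -wak xy /d pE; ring.
have aw : a = - w by rewrite wak k1 mulrN1 opprK.
have zE : z = - (1 + q ^+ 2 * w).
  have -> : z = q ^+ 2 * a - 2%:R - k by rewrite /k; ring.
  by rewrite k1 aw; ring.
split=> //; last by rewrite zE pE; ring.
by rewrite t0 zE aw pE; ring.
Qed.

Section ZeroLocus.
Variables (F : numFieldType) (n : int) (x y z : F).
Local Notation v := (trv x y z).
Hypothesis v2 : v != 2%:R.
Local Notation S := (cheb v (n - 1)).
Local Notation P := (chebP v n).
Local Notation w := (v - 2%:R).

Let two0 : (2%:R : F) != 0. Proof. by rewrite pnatr_eq0. Qed.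
Let w0 : w != 0. Proof. by rewrite subr_eq0. Qed.

(** If S = 0, then d^2 = 1 by the Cassini identity, so the equation of the
    surface is xy = 2 z. If x = 2 or y = 2 this forces v = 2, and otherwise
    tau = (2 - x) (2 - y) P gives P = 0. *)
Lemma zero_locus_S0 : S = 0 -> fW n x y z = 0 -> tauW n x y z = 0 ->
  x * y = 2%:R * z /\ P = 0.
Proof.
move=> S0; rewrite fW_geom /tauW S0 mulr0 add0r.
have q : (2%:R + w * P) * P = 0.
  have := cheb_quadratic n v2; rewrite S0 expr0n /= => E.
  by rewrite [RHS]E; ring.
rewrite /TW S0 mulr0 add0r => f0 /eqP.
have dd : (1 + w * P) ^+ 2 = 1.
  by transitivity (1 + w * ((2%:R + w * P) * P)); [ring | rewrite q mulr0 addr0].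
have d0 : dW n v != 0.
  by rewrite -sqrf_eq0 [_ ^+ 2](_ : _ = 1) ?oner_eq0.
have xy : x * y = 2%:R * z.
  by apply: (mulIf d0); apply/eqP; rewrite -subr_eq0 -f0; apply/eqP; ring.
rewrite mulf_eq0 => /orP[|/eqP //] ab; exfalso.
move/negP: v2; apply.
have [xe|ye] : x = 2%:R \/ y = 2%:R.
  by move: ab; rewrite mulf_eq0 !subr_eq0 => /orP[] /eqP <-; [left | right].
  have zy : z = y by apply: (mulfI two0); rewrite -xy xe.
  by apply/eqP; rewrite /trv zy xe; ring.
have zx : z = x by apply: (mulfI two0); rewrite -xy ye mulrC.
by apply/eqP; rewrite /trv zx ye; ring.
Qed.

Lemma zero_locus : S != 0 -> fW n x y z = 0 -> tauW n x y z = 0 ->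
  [/\ (2%:R - x) * (2%:R - y) = - w, S ^+ 2 * (x + y) = SigW n v
    & S ^+ 2 * z = - (S ^+ 2 + w * P ^+ 2)].
Proof.
move=> S0; rewrite fW_geom /tauW => f0 t0.
have rel := cheb_quadratic n v2.
exact: (zero_locus_alg erefl w0 S0 rel f0 t0).
Qed.

End ZeroLocus.

(** The converse of [zero_locus_alg], so that Gamma is parametrized by v and a
    square root. *)
Lemma gamma_zeros (F : fieldType) (x y z s p w : F) (d := 1 + w * p) :
  s != 0 -> s ^+ 2 = s + 2%:R * p + w * p ^+ 2 + w * s * p ->
  s ^+ 2 * (x + y) = s ^+ 2 - w * p ^+ 2 - w * p * s ->
  x * y = 2%:R * (x + y) - (w + 4%:R) ->
  s ^+ 2 * z = - (s ^+ 2 + w * p ^+ 2) ->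
  [/\ trv x y z - 2%:R = w, x * y * d - z * (w * s + 2%:R * d) = 0
    & (2%:R - x - y + z) * s + (2%:R - x) * (2%:R - y) * p = 0].
Proof.
move=> s0 rel hs hxy hz; pose q := p / s.
have pE : p = q * s by rewrite divfK.
have s20 : s ^+ 2 != 0 by rewrite sqrf_eq0.
have {}hs : x + y = 1 - q ^+ 2 * w - q * w.
  by apply: (mulfI s20); rewrite hs pE; ring.
have {}hz : z = - 1 - q ^+ 2 * w.
  by apply: (mulfI s20); rewrite hz pE; ring.
have relq : s * (1 - w * q ^+ 2 - w * q) = 1 + 2%:R * q.
  apply: (mulIf s0); apply/eqP; rewrite -subr_eq0; apply/eqP.
  transitivity (s ^+ 2 - (s + 2%:R * p + w * p ^+ 2 + w * s * p)); first by rewrite pE; ring.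
  by rewrite rel subrr.
split.
- transitivity ((x + y) ^+ 2 - 2%:R * (x * y) + z ^+ 2 - x * y * z - 4%:R).
    by rewrite /trv; ring.
  by rewrite hxy hs hz; ring.
- rewrite hxy hs hz /d pE.
  transitivity (- w * (1 + 2%:R * q - s * (1 - w * q ^+ 2 - w * q))).
    by ring.
  by rewrite relq subrr mulr0.
transitivity ((2%:R - (x + y) + z) * s + (4%:R - 2%:R * (x + y) + x * y) * p); first by ring.
by rewrite hxy hs hz pE; ring.
Qed.

(** * Degrees, discriminants and simple roots *)

Section GeometricPolynomials.
Variables (F : numFieldType) (n : int).
Hypothesis n0 : n != 0.
Local Notation Xp := ('X : {poly F}).
Local Notation Sp := (cheb Xp (n - 1)).
Local Notation Pp := (chebP Xp n).

Lemma horner_dW (c : F) : (dW n Xp).[c] = dW n c.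
Proof. by have := rmorph_dW (horner_eval c) n 'X; rewrite /= /horner_eval hornerX. Qed.
Lemma horner_TW (c : F) : (TW n Xp).[c] = TW n c.
Proof. by have := rmorph_TW (horner_eval c) n 'X; rewrite /= /horner_eval hornerX. Qed.
Lemma horner_SigW (c : F) : (SigW n Xp).[c] = SigW n c.
Proof. by have := rmorph_SigW (horner_eval c) n 'X; rewrite /= /horner_eval hornerX. Qed.

Lemma Sp_neq0 : Sp != 0.
Proof. by rewrite -size_poly_eq0 size_cheb_pred // absz_eq0. Qed.

Lemma horner_neq0 (g : {poly F}) c : g.[c] != 0 -> g != 0.
Proof. by apply: contraNneq => ->; rewrite horner0. Qed.

Lemma dW_two (A : comNzRingType) : dW n (2%:R : A) = 1.
Proof. by rewrite /dW subrr mul0r addr0. Qed.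

Lemma TW_two (A : comNzRingType) : TW n (2%:R : A) = 2%:R.
Proof. by rewrite /TW subrr mul0r add0r dW_two mulr1. Qed.

Lemma dWp_neq0 : dW n Xp != 0.
Proof. by apply: (@horner_neq0 _ 2%:R); rewrite horner_dW dW_two oner_neq0. Qed.

Lemma TWp_neq0 : TW n Xp + 2%:R != 0.
Proof.
apply: (@horner_neq0 _ 2%:R); rewrite hornerD horner_TW TW_two -polyC_natr hornerC.
by rewrite -natrD pnatr_eq0.
Qed.

Lemma X2p_neq0 : Xp + 2%:R != 0.
Proof.
apply: (@horner_neq0 _ 2%:R); rewrite hornerD hornerX -polyC_natr hornerC.
by rewrite -natrD pnatr_eq0.
Qed.

Lemma Xm2p_neq0 : Xp - 2%:R != 0.
Proof. by rewrite -polyC_natr polyXsubC_eq0. Qed.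

Lemma X_neq2 : Xp != 2%:R.
Proof. by rewrite -subr_eq0 Xm2p_neq0. Qed.

Lemma size_TW : size (TW n Xp + 2%:R) = (absz n).+1.
Proof.
have T_nat (k : nat) : size (cheb_nat Xp k.+1 - cheb Xp (k%:Z - 1)) = k.+2.
  have [s1 _] := size_cheb_nat F k.+1; rewrite size_polyDl s1 ?size_polyN //.
  case: k {s1} => [|k]; first by rewrite size_poly0.
  have -> : k.+1%:Z - 1 = k by rewrite -addn1 PoszD; ring.
  by have [-> _] := size_cheb_nat F k.
have T_abs : size (TW n Xp) = (absz n).+1.
  rewrite TW_cheb; case: n n0 => [[//|k]|k] _.
    have -> : k.+1%:Z - 2 = k%:Z - 1 by rewrite -addn1 PoszD; ring.
    exact: T_nat.
  rewrite -[absz _]/k.+1.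
  have -> : Negz k - 2 = - k.+1%:Z - 2 by rewrite NegzE.
  have -> : Negz k = - (k%:Z - 1) - 2 by rewrite NegzE -addn1 PoszD; ring.
  by rewrite !cheb_neg opprK addrC; exact: T_nat.
rewrite size_polyDl T_abs // -polyC_natr.
by apply: leq_ltn_trans (size_polyC_leq1 _) _; rewrite ltnS lt0n absz_eq0.
Qed.

Definition discW : {poly F} := SigW n Xp ^+ 2 - 8%:R * SigW n Xp * Sp ^+ 2
   + 4%:R * (Xp + 2%:R) * Sp ^+ 4.

Let bracket : {poly F} :=
  (Xp + 2%:R) - 8%:R * (TW n Xp + 2%:R) + 4%:R * (TW n Xp + 2%:R) ^+ 2.

Let disc_rel_p : (TW n Xp + 2%:R) ^+ 2 * discW
  = (Xp + 2%:R) * Sp ^+ 4 * bracket.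
Proof. exact: disc_rel X_neq2. Qed.

Let size_bracket : size bracket = (absz n).*2.+1.
Proof.
have m1 : (0 < absz n)%N by rewrite lt0n absz_eq0.
have s4 : size (4%:R * (TW n Xp + 2%:R) ^+ 2) = (absz n).*2.+1.
  rewrite -polyC_natr mul_polyC size_scale ?pnatr_eq0 // expr2.
  by rewrite size_mul ?TWp_neq0 // size_TW; lia.
have s2 : (size (Xp + 2%:R - 8%:R * (TW n Xp + 2%:R))%R <= (absz n).+1)%N.
  rewrite (leq_trans (size_polyD _ _)) // geq_max size_polyN.
  rewrite -[8%:R]polyC_natr mul_polyC size_scale ?pnatr_eq0 // size_TW leqnn andbT.
  by rewrite -polyC_natr size_XaddC.
by rewrite /bracket addrC size_polyDl s4 //; lia.
Qed.

Let bracket_neq0 : bracket != 0.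
Proof. by rewrite -size_poly_eq0 size_bracket. Qed.

Lemma discW_neq0 : discW != 0.
Proof.
have : (TW n Xp + 2%:R) ^+ 2 * discW != 0.
  by rewrite disc_rel_p !mulf_neq0 ?expf_neq0 ?X2p_neq0 ?Sp_neq0.
by rewrite mulf_eq0 negb_or => /andP[].
Qed.

(** Up to squares the discriminant is (v + 2) (v + 2 - 8 (T + 2) + 4 (T +
    2)^2), of odd degree 1 + 2 |n|. *)
Lemma discW_nonsquare a b : a ^+ 2 = b ^+ 2 * discW -> b = 0.
Proof.
move=> E.
have M0 : (Xp + 2%:R) * Sp ^+ 4 * bracket != 0.
  by rewrite !mulf_neq0 ?expf_neq0 ?X2p_neq0 ?Sp_neq0.
apply: (@odd_degree_nonsquare _ ((Xp + 2%:R) * Sp ^+ 4 * bracket)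
  ((TW n Xp + 2%:R) * a) b) => //.
  have m1 : (0 < absz n)%N by rewrite lt0n absz_eq0.
  rewrite size_mul ?mulf_neq0 ?expf_neq0 ?X2p_neq0 ?Sp_neq0 //.
  rewrite size_mul ?expf_neq0 ?X2p_neq0 ?Sp_neq0 // size_bracket.
  rewrite -polyC_natr size_XaddC.
  have := size_exp Sp 4; rewrite size_cheb_pred //.
  have : (0 < size (Sp ^+ 4))%N by rewrite size_poly_gt0 expf_neq0 ?Sp_neq0.
  by move: (size (Sp ^+ 4)) => sz; lia.
by rewrite exprMn E -disc_rel_p; ring.
Qed.

Lemma SigWp_neq0 : SigW n Xp != 0.
Proof.
have : (TW n Xp + 2%:R) * SigW n Xp != 0.
  by rewrite (SigW_rel _ X_neq2) mulf_neq0 ?expf_neq0 ?X2p_neq0 ?Sp_neq0.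
by rewrite mulf_eq0 negb_or => /andP[].
Qed.

(** The Chebyshev differential identity, with the Chebyshev polynomial of the
    first kind expressed through S_k and S_(k-1). *)
Lemma cheb_deriv (k : nat) :
  (Xp ^+ 2 - 4%:R) * (cheb Xp k)^`() =
  (Xp * cheb Xp k - 2%:R * cheb Xp (k%:Z - 1)) *+ k.+1 - Xp * cheb Xp k.
Proof.
pose Q (j : nat) := (Xp ^+ 2 - 4%:R) * (cheb Xp j)^`() =
  (Xp * cheb Xp j - 2%:R * cheb Xp (j%:Z - 1)) *+ j.+1 - Xp * cheb Xp j.
suff: Q k /\ Q k.+1 by case.
have e (j : nat) : j.+1%:Z - 1 = j by rewrite -addn1 PoszD; ring.
have e2 (j : nat) : j.+1%:Z - 2 = j%:Z - 1 by rewrite -addn1 PoszD; ring.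
elim: k => [|k [IH1 IH2]].
  by split; rewrite /Q /= ?derivX ?derivC /=; ring.
split=> //; move: IH1 IH2; rewrite /Q !e (cheb_rec _ k.+2) !e e2.
rewrite derivB derivM derivX mul1r.
rewrite (cheb_rec _ k.+1) e e2.
set u := cheb Xp k; set t := cheb Xp (k%:Z - 1).
set du := u^`(); set dv := (_ - _)^`() => h1 h2.
transitivity ((Xp ^+ 2 - 4%:R) * (Xp * u - t) + Xp * ((Xp ^+ 2 - 4%:R) * dv)
  - (Xp ^+ 2 - 4%:R) * du); first by ring.
by rewrite h1 h2; ring.
Qed.

(** At a root of S_k, S_(k-1) is 1 or -1 by the Cassini identity, so
    [cheb_deriv] shows that (c^2 - 4) times the derivative is not zero. *)
Lemma cheb_simple_root (c : F) : cheb c (n - 1) = 0 ->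
  c + 2%:R != 0 /\ exists2 g : {poly F}, g.[c] != 0 & Sp = g * ('X - c%:P).
Proof.
move=> hS; have [k hk] : exists k : nat, cheb c k = 0 /\ (Sp = cheb Xp k \/ Sp = - cheb Xp k).
  have [[k _ h]|[k _ h]] := cheb_pred_cases n0; exists k.
    by rewrite -(h _ c) hS; split=> //; left; exact: h.
  by rewrite -[cheb c k]opprK -(h _ c) hS oppr0; split=> //; right; exact: h.
case: hk => ck Sk.
have sq : cheb c (k%:Z - 1) ^+ 2 = 1.
  by have := cheb_cassini c k; rewrite ck expr0n mulr0 mul0r subr0 add0r.
have p0 : cheb c (k%:Z - 1) != 0 by rewrite -sqrf_eq0 sq oner_neq0.
have nz : (c ^+ 2 - 4%:R) * (cheb Xp k)^`().[c] != 0.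
  have := congr1 (horner^~ c) (cheb_deriv k).
  rewrite hornerM hornerD hornerN hornerXn -polyC_natr hornerC => ->.
  rewrite hornerD hornerN hornerMn hornerD hornerN !hornerM hornerX !horner_cheb.
  rewrite ck mulr0 subr0 add0r -polyC_natr hornerC -mulNr -mulr_natr.
  by rewrite !mulf_neq0 ?oppr_eq0 ?pnatr_eq0.
have [c4 dk] : c ^+ 2 - 4%:R != 0 /\ (cheb Xp k)^`().[c] != 0.
  by apply/andP; rewrite -negb_or -mulf_eq0.
split.
  by apply: contraNneq c4 => /eqP; rewrite addr_eq0 => /eqP ->; apply/eqP; ring.
have /factor_theorem [g gE] : root Sp c by rewrite rootE horner_cheb hS.
exists g => //; apply: contraNneq dk => g0.
have : Sp^`().[c] = 0.
  rewrite gE derivM derivXsubC hornerD !hornerM g0 hornerXsubC subrr hornerC.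
  by rewrite mulr0 mul0r addr0.
by case: Sk => ->; rewrite ?derivN ?hornerN => /eqP; rewrite ?oppr_eq0 => /eqP ->.
Qed.

End GeometricPolynomials.

(** * The zero curves on the geometric surface *)

Section GeometricCurves.
Variables (F : numClosedFieldType) (n : int).
Hypothesis n0 : n != 0.
Implicit Types (p : 3.-tuple F).
Local Notation Xp := ('X : {poly F}).
Local Notation Sp := (cheb Xp (n - 1)).
Local Notation Pp := (chebP Xp n).

Definition gammaU (v : F) : Prop := v != 2%:R /\ cheb v (n - 1) != 0.
(** The solution of the equations of [zero_locus] with t = S^2 (x - y). *)
Definition gamma_pt (v t : F) : 3.-tuple F :=
  point ((SigW n v + t) / (2%:R * cheb v (n - 1) ^+ 2))
        ((SigW n v - t) / (2%:R * cheb v (n - 1) ^+ 2))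
        (- (cheb v (n - 1) ^+ 2 + (v - 2%:R) * chebP v n ^+ 2) / cheb v (n - 1) ^+ 2).
Definition Gamma := double_cover gammaU (@eval1 F) (discW F n) gamma_pt.

Lemma eval1_disc v : eval1 v (discW F n) = SigW n v ^+ 2
   - 8%:R * SigW n v * cheb v (n - 1) ^+ 2
   + 4%:R * (v + 2%:R) * cheb v (n - 1) ^+ 4.
Proof.
rewrite /discW !(rmorph_SigW, rmorph_cheb, rmorph_nat, rmorphXn, rmorphB, rmorphM, rmorphD).
by rewrite /= eval1E hornerX.
Qed.

Let two0 : (2%:R : F) != 0 := two_neq0 F.

Lemma Gamma_prime : prime_locus Gamma.
Proof.
have g0 : Sp * (Xp - 2%:R) != 0 by rewrite mulf_neq0 ?Sp_neq0 ?Xm2p_neq0.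
have gU (v : F) : (Sp * (Xp - 2%:R)).[v] != 0 -> gammaU v.
  rewrite hornerM mulf_eq0 negb_or horner_cheb => /andP[S0].
  by rewrite -polyC_natr hornerXsubC subr_eq0.
have cov (j : 'I_3) (D a b : {poly F}) : (forall v, gammaU v -> D.[v] != 0) ->
   (forall v t, gammaU v -> D.[v] * coord (gamma_pt v t) j = a.[v] + b.[v] * t) ->
   cover_fun gammaU (@eval1 F) (discW F n) gamma_pt 'X_j.
  by move=> h1 h2; exists D, a, b; split=> // v t Uv _; rewrite meval_point; exact: h2.
apply: prime_double_cover.
- by move=> c; exists c%:P => v; rewrite eval1E hornerC.
- by move=> b hb; apply: (poly_dense g0) => v /gU /hb.
- by move=> a b; exact: discW_nonsquare.
- have D2 (v : F) : gammaU v -> (2%:R * Sp ^+ 2).[v] != 0.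
    move=> [_ S0]; rewrite hornerM horner_exp horner_cheb -polyC_natr hornerC.
    by rewrite mulf_neq0 ?expf_neq0.
  move=> j; case: (ord3_cases j) => ->.
  + apply: (cov _ (2%:R * Sp ^+ 2) (SigW n Xp) 1) => // v t Uv; have [_ S0] := Uv.
    rewrite inordK // hornerM horner_exp horner_cheb -polyC_natr !hornerC horner_SigW /gamma_pt !pointX.
    by field; rewrite S0.
  + apply: (cov _ (2%:R * Sp ^+ 2) (SigW n Xp) (-1)) => // v t Uv; have [_ S0] := Uv.
    rewrite inordK // horner_SigW hornerM horner_exp horner_cheb -polyC_natr hornerN !hornerC /gamma_pt !pointX.
    by field; rewrite S0.
  apply: (cov _ (Sp ^+ 2) (- (Sp ^+ 2 + (Xp - 2%:R) * Pp ^+ 2)) 0) => [v [_ S0]|v t [_ S0]].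
    by rewrite horner_exp horner_cheb expf_neq0.
  rewrite inordK // !horner_exp hornerN hornerD !horner_exp hornerM !horner_exp horner_cheb horner_chebP.
  rewrite hornerD hornerN hornerX -polyC_natr !hornerC /gamma_pt !pointX.
  by field; rewrite S0.
by have [v hv] := poly_nonroot g0; exists v; apply: gU.
Qed.

Local Notation cx p := (coord p 0).
Local Notation cy p := (coord p 1).
Local Notation cz p := (coord p 2).

Lemma gamma_pt_on_Gamma v t : gammaU v -> t ^+ 2 = eval1 v (discW F n) ->
  let p := gamma_pt v t in
  [/\ vW p = v, fW n (cx p) (cy p) (cz p) = 0 & tauW n (cx p) (cy p) (cz p) = 0].
Proof.
move=> [v2 S0]; rewrite eval1_disc => ht p.
have rel := cheb_quadratic n v2.
have hs : cheb v (n - 1) ^+ 2 * (cx p + cy p) = cheb v (n - 1) ^+ 2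
   - (v - 2%:R) * chebP v n ^+ 2 - (v - 2%:R) * chebP v n * cheb v (n - 1).
  by rewrite /p /gamma_pt !pointX -/(SigW n v); field; rewrite S0.
have hxy : cx p * cy p = 2%:R * (cx p + cy p) - ((v - 2%:R) + 4%:R).
  transitivity ((SigW n v ^+ 2 - t ^+ 2) / (4%:R * cheb v (n - 1) ^+ 4)).
    by rewrite /p /gamma_pt !pointX; field; rewrite S0.
  by rewrite ht /p /gamma_pt !pointX; field; rewrite S0.
have hz : cheb v (n - 1) ^+ 2 * cz p
    = - (cheb v (n - 1) ^+ 2 + (v - 2%:R) * chebP v n ^+ 2).
  by rewrite /p /gamma_pt !pointX; field; rewrite S0.
have [tv f0 t0] := gamma_zeros S0 rel hs hxy hz.
have vp : vW p = v by apply: (addIr (- 2%:R)); rewrite tv.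
by split=> //; rewrite ?fW_geom /tauW -[trv _ _ _]/(vW p) vp.
Qed.

Lemma GammaP p : Gamma p <->
  [/\ vW p != 2%:R, cheb (vW p) (n - 1) != 0, fW n (cx p) (cy p) (cz p) = 0
    & tauW n (cx p) (cy p) (cz p) = 0].
Proof.
split=> [[v [t [Uv ht ->]]]|[v2 S0 f0 t0]].
  have [vp f0 t0] := gamma_pt_on_Gamma Uv ht; have [v2 S0] := Uv.
  by split=> //; rewrite vp.
have [hxy hs hz] := zero_locus v2 S0 f0 t0; rewrite -/(vW p) in hs hz hxy.
have {}hxy : cx p * cy p = 2%:R * (cx p + cy p) - (vW p + 2%:R).
  transitivity ((2%:R - cx p) * (2%:R - cy p) - 4%:R + 2%:R * (cx p + cy p)); first by ring.
  by rewrite hxy; ring.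
exists (vW p), (cheb (vW p) (n - 1) ^+ 2 * (cx p - cy p)); split=> //.
  rewrite eval1_disc -hs.
  transitivity (cheb (vW p) (n - 1) ^+ 4 * ((cx p + cy p) ^+ 2 - 4%:R * (cx p * cy p))).
    by ring.
  by rewrite hxy; ring.
rewrite [LHS]pointE /gamma_pt -hs -hz; congr point; field; exact: S0.
Qed.

(** Eliminating z from v = c and xy = 2 z gives (x^2 - 4) (y^2 - 4) = 4 (2 -
    c), a double cover of the x-line with t = (x^2 - 4) y. Its discriminant
    has the simple root x = 2. *)
Lemma biquadratic_prime (c : F) : c != 2%:R ->
  prime_locus (fun p => vW p = c /\ cx p * cy p = 2%:R * cz p).
Proof.
move=> c2; pose K := 4%:R * (2%:R - c).
have K0 : K != 0 by rewrite mulf_neq0 ?pnatr_eq0 // subr_eq0 eq_sym.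
pose q : {poly F} := Xp + 2%:R%:P.
pose r : {poly F} := 4%:R%:P * Xp ^+ 2 - 16%:R%:P + K%:P.
pose Delta := ('X - 2%:R%:P) * (q * r).
pose U (x : F) : Prop := x ^+ 2 - 4%:R != 0.
pose phi (x t : F) := point x (t / (x ^+ 2 - 4%:R)) (x * t / (2%:R * (x ^+ 2 - 4%:R))).
have evq x : q.[x] = x + 2%:R by rewrite hornerD hornerX hornerC.
have evr x : r.[x] = 4%:R * x ^+ 2 - 16%:R + K.
  by rewrite !hornerD hornerN hornerM horner_exp hornerX !hornerC.
have evD x : eval1 x Delta = (x ^+ 2 - 4%:R) * (4%:R * x ^+ 2 - 16%:R + K).
  by rewrite eval1E !hornerM hornerXsubC evq evr; ring.
have D0 : Xp ^+ 2 - 4%:R%:P != 0 by rewrite -size_poly_eq0 size_XnsubC.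
have evD0 x : (Xp ^+ 2 - 4%:R%:P).[x] = x ^+ 2 - 4%:R.
  by rewrite hornerD hornerN horner_exp hornerX hornerC.
apply: (@prime_locus_ext _ (double_cover U (@eval1 F) Delta phi)) => [p|].
  split=> [[x [t [Ux ht ->]]]|[hv hz]].
    rewrite evD in ht; split; last by rewrite /phi !pointX; field; rewrite Ux.
    rewrite /vW /trv /phi !pointX.
    transitivity (x ^+ 2 - 2%:R - t ^+ 2 / (4%:R * (x ^+ 2 - 4%:R))).
      by field; rewrite Ux.
    by rewrite ht /K; field; rewrite Ux.
  have key : (cx p ^+ 2 - 4%:R) * (cy p ^+ 2 - 4%:R) = K.
    transitivity (4%:R * (cx p ^+ 2 * cy p ^+ 2 / 4%:R - cx p ^+ 2 - cy p ^+ 2 + 4%:R)).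
      by field.
    have zE : cz p = cx p * cy p / 2%:R by rewrite hz; field.
    by rewrite /K -hv /vW /trv zE; field.
  have Ux : U (cx p) by apply: contraNneq K0 => ux; rewrite -key ux mul0r.
  exists (cx p), ((cx p ^+ 2 - 4%:R) * cy p); split=> //.
    by rewrite evD -key; ring.
  rewrite [LHS]pointE /phi; congr point; first by rewrite mulrC mulKf.
  transitivity (cx p * cy p / 2%:R); first by rewrite hz; field.
  by field; exact: Ux.
have cov (j : 'I_3) (D a b : {poly F}) : (forall x, U x -> D.[x] != 0) ->
   (forall x t, U x -> D.[x] * coord (phi x t) j = a.[x] + b.[x] * t) ->
   cover_fun U (@eval1 F) Delta phi 'X_j.
  by move=> h1 h2; exists D, a, b; split=> // v t Uv _; rewrite meval_point; exact: h2.
apply: prime_double_cover.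
- by move=> a; exists a%:P => v; rewrite eval1E hornerC.
- by move=> b hb; apply: (poly_dense D0) => v; rewrite evD0 => /hb.
- move=> a b; apply: odd_root_nonsquare.
  rewrite hornerM evq evr mulf_neq0 -?natrD ?pnatr_eq0 //.
  by rewrite (_ : _ + K = K) //; ring.
- move=> j; case: (ord3_cases j) => ->.
  + apply: (cov _ 1 Xp 0) => [x _|x t _]; first by rewrite hornerC oner_neq0.
    by rewrite inordK // !hornerC hornerX /phi !pointX mul1r mul0r addr0.
  + apply: (cov _ (Xp ^+ 2 - 4%:R%:P) 0 1) => [x|x t Ux]; first by rewrite evD0.
    by rewrite inordK // evD0 !hornerC /phi !pointX mul1r add0r mulrC divfK.
  apply: (cov _ (2%:R%:P * (Xp ^+ 2 - 4%:R%:P)) 0 Xp) => [x Ux|x t Ux].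
    by rewrite hornerM hornerC evD0 mulf_neq0.
  by rewrite inordK // hornerM evD0 !hornerC hornerX /phi !pointX; field; exact: Ux.
have [x hx] := poly_nonroot D0; exists x; by rewrite /U -evD0.
Qed.

End GeometricCurves.

(** * Local coordinates on the geometric surface *)

Section Lift.
Variables (F : numClosedFieldType).
Implicit Types (p : 3.-tuple F).

Lemma poly_lipschitz (g : {poly F}) : exists2 M, 0 < M & forall e : F, 0 < e ->
  e <= 1 -> `|g.[e] - g.[0]| <= M * e.
Proof.
elim/poly_ind: g => [|g c [M M0 hM]].
  by exists 1 => // e e0 _; rewrite !horner0 subrr normr0 mul1r ltW.
exists (`|g.[0]| + M); first by rewrite ltr_wpDl.
move=> e e0 e1; rewrite !hornerD !hornerMX !hornerC mulr0 add0r addrK normrM.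
rewrite [`|e|]gtr0_norm // ler_wpM2r ?(ltW e0) //.
rewrite -[g.[e]](subrK g.[0]) addrC; apply: le_trans (ler_normD _ _) _.
rewrite lerD2l; apply: le_trans (hM e e0 e1) _.
by rewrite ler_piMr // ltW.
Qed.

(** A rational function is Lipschitz near a point where its denominator does
    not vanish. *)
Lemma ratio_near (N D : {poly F}) : D.[0] != 0 -> exists M K : F, [/\ 0 < M, 0 < K &
  forall e, 0 < e -> K * e <= 1 ->
    D.[e] != 0 /\ `|N.[e] / D.[e] - N.[0] / D.[0]| <= M * e].
Proof.
move=> D0; pose g := N * D.[0]%:P - N.[0]%:P * D.
have [Mg Mg0 hg] := poly_lipschitz g.
have [Md Md0 hd] := poly_lipschitz D.
have nD : 0 < `|D.[0]| by rewrite normr_gt0.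
exists (2%:R * Mg / `|D.[0]| ^+ 2), (1 + 2%:R * Md / `|D.[0]|); split.
- by rewrite divr_gt0 ?mulr_gt0 ?exprn_gt0 ?ltr0n.
- by rewrite ltr_wpDr // divr_ge0 ?mulr_ge0 ?(ltW Md0).
move=> e e0; rewrite mulrDl mul1r => Ke.
have e0' := ltW e0.
have t0 : 0 <= 2%:R * Md / `|D.[0]| * e by rewrite mulr_ge0 ?divr_ge0 ?mulr_ge0 // ltW.
have e1 : e <= 1 by apply: le_trans Ke; rewrite lerDl.
have hMd : 2%:R * Md / `|D.[0]| * e <= 1 by apply: le_trans Ke; rewrite lerDr.
have De : `|D.[0]| / 2%:R <= `|D.[e]|.
  have h1 : Md * e <= `|D.[0]| / 2%:R.
    rewrite ler_pdivlMr ?ltr0n // -[leRHS]mul1r -ler_pdivrMr //.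
    by rewrite [X in X <= _](_ : _ = 2%:R * Md / `|D.[0]| * e) //; ring.
  have h2 : `|D.[0]| <= `|D.[e]| + `|D.[0]| / 2%:R.
    rewrite -{1}[D.[0]](subrK D.[e]) addrC; apply: le_trans (ler_normD _ _) _.
    by rewrite lerD2l distrC; apply: le_trans (hd e e0 e1) h1.
  rewrite -(lerD2r (`|D.[0]| / 2%:R)); apply: le_trans h2.
  by rewrite -mulrDl -mulr2n -[_ *+ 2]mulr_natr mulfK ?pnatr_eq0.
have De0 : D.[e] != 0.
  by rewrite -normr_gt0; apply: lt_le_trans De; rewrite divr_gt0 ?ltr0n.
split=> //.
have -> : N.[e] / D.[e] - N.[0] / D.[0] = (g.[e] - g.[0]) / (D.[e] * D.[0]).
  by rewrite /g !(hornerD, hornerN, hornerM, hornerC); field; rewrite De0 D0.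
rewrite normrM normfV normrM ler_pdivrMr; last by rewrite mulr_gt0 ?normr_gt0.
apply: le_trans (hg e e0 e1) _.
rewrite [leRHS](_ : _ = Mg * e * (`|D.[e]| * 2%:R / `|D.[0]|)).
  rewrite ler_peMr ?mulr_ge0 ?(ltW Mg0) //.
  by rewrite ler_pdivlMr // mul1r -ler_pdivrMr ?ltr0n.
by field; exact: lt0r_neq0.
Qed.

(** Away from 0, a number close to s0^2 has a square root close to s0: the
    product of s0 - s and s0 + s is small, and their sum is 2 s0. *)
Lemma sqrt_near (s0 q m : F) : s0 != 0 -> `|q - s0 ^+ 2| <= m ->
  exists2 s, s ^+ 2 = q & `|s - s0| <= m / `|s0|.
Proof.
move=> s00 hq; have [s hs] := sqr_exists q.
have ns : 0 < `|s0| by rewrite normr_gt0.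
have prod : (s0 - s) * (s0 + s) = - (q - s0 ^+ 2) by rewrite -hs; ring.
have sum : `|2%:R * s0| <= `|(s0 - s) + (s0 + s)|.
  by rewrite (_ : s0 - s + (s0 + s) = 2%:R * s0) //; ring.
have rho : 0 < `|2%:R * s0| by rewrite normr_gt0 mulf_neq0 ?two_neq0.
have fin t : `|t| <= 2%:R * `|- (q - s0 ^+ 2)| / `|2%:R * s0| -> `|t| <= m / `|s0|.
  move=> h; apply: le_trans h _; rewrite normrN normrM normr_nat.
  rewrite -mulf_div divff ?two_neq0 // mul1r ler_wpM2r ?invr_ge0 //.
have [/fin h|/fin h] := near_root prod rho sum.
  by exists s => //; rewrite distrC.
by exists (- s); rewrite ?sqrrN // -normrN opprD !opprK addrC.
Qed.

Variable n : int.
Local Notation cx p := (coord p 0).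
Local Notation cy p := (coord p 1).
Local Notation cz p := (coord p 2).

(** The equations of the surface f_n = 0 and of v determine xy and x^2 + y^2,
    hence (x + y)^2 and (x - y)^2, as rational functions of v and z with
    denominator d. *)
Lemma geom_of_squares (v z sg dl : F) : dW n v != 0 ->
  sg ^+ 2 = ((v + 2%:R - z ^+ 2) * dW n v + z * TW n v * (z + 2%:R)) / dW n v ->
  dl ^+ 2 = ((v + 2%:R - z ^+ 2) * dW n v + z * TW n v * (z - 2%:R)) / dW n v ->
  let p := point ((sg + dl) / 2%:R) ((sg - dl) / 2%:R) z in
  vW p = v /\ fW n (cx p) (cy p) (cz p) = 0.
Proof.
move=> d0 hs hd p.
have hxy : (sg + dl) / 2%:R * ((sg - dl) / 2%:R) = z * TW n v / dW n v.
  transitivity ((sg ^+ 2 - dl ^+ 2) / 4%:R); first by field.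
  by rewrite hs hd; field; exact: d0.
have vp : vW p = v.
  rewrite /vW /trv /p !pointX hxy.
  transitivity ((sg ^+ 2 + dl ^+ 2) / 2%:R + z ^+ 2 - z * TW n v / dW n v * z - 2%:R).
    by field; exact: d0.
  by rewrite hs hd; field; exact: d0.
split=> //; rewrite fW_geom -/(vW p) vp /p !pointX hxy; field; exact: d0.
Qed.

Lemma geom_squares p (v := vW p) (z := cz p) : dW n v != 0 ->
  fW n (cx p) (cy p) (cz p) = 0 ->
  (cx p + cy p) ^+ 2 = ((v + 2%:R - z ^+ 2) * dW n v + z * TW n v * (z + 2%:R)) / dW n v
  /\ (cx p - cy p) ^+ 2 = ((v + 2%:R - z ^+ 2) * dW n v + z * TW n v * (z - 2%:R)) / dW n v.
Proof.
move=> d0; rewrite fW_geom -/(vW p) -/v -/z => /eqP; rewrite subr_eq0 => /eqP h.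
have vE : v = cx p ^+ 2 + cy p ^+ 2 + z ^+ 2 - cx p * cy p * z - 2%:R by [].
split; apply: (mulIf d0); rewrite divfK //.
  transitivity ((v + 2%:R - z ^+ 2) * dW n v + (cx p * cy p * dW n v) * (z + 2%:R)).
    by move: (dW n v) => dd; rewrite vE; ring.
  by rewrite h.
transitivity ((v + 2%:R - z ^+ 2) * dW n v + (cx p * cy p * dW n v) * (z - 2%:R)).
  by move: (dW n v) => dd; rewrite vE; ring.
by rewrite h.
Qed.

(** Where d, x + y and x - y do not vanish, v and z are local coordinates on
    the geometric surface: x + y and x - y are square roots of rational
    functions of them. *)
Lemma geom_lift p0 (bv bz : F) : fW n (cx p0) (cy p0) (cz p0) = 0 ->
  dW n (vW p0) != 0 -> cx p0 + cy p0 != 0 -> cx p0 - cy p0 != 0 ->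
  exists L K : F, [/\ 0 < L, 0 < K & forall e, 0 < e -> K * e <= 1 ->
    exists p, [/\ vW p = vW p0 + bv * e, cz p = cz p0 + bz * e,
      fW n (cx p) (cy p) (cz p) = 0 & close (L * e) p p0]].
Proof.
move=> f0 d0 sg0 dl0; have [hs hd] := geom_squares d0 f0.
pose vv : {poly F} := (vW p0)%:P + bv *: 'X; pose zz : {poly F} := (cz p0)%:P + bz *: 'X.
pose D : {poly F} := dW n vv.
pose N (r : F) : {poly F} := (vv + 2%:R - zz ^+ 2) * D + zz * TW n vv * (zz + r%:P).
have vve e : vv.[e] = vW p0 + bv * e by rewrite hornerD hornerZ hornerX hornerC.
have zze e : zz.[e] = cz p0 + bz * e by rewrite hornerD hornerZ hornerX hornerC.
have De e : D.[e] = dW n (vv.[e]) by exact: (rmorph_dW (horner_eval e)).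
have Te e : (TW n vv).[e] = TW n (vv.[e]) by exact: (rmorph_TW (horner_eval e)).
have Ne r e : (N r).[e] = (vv.[e] + 2%:R - zz.[e] ^+ 2) * dW n vv.[e]
    + zz.[e] * TW n vv.[e] * (zz.[e] + r).
  rewrite -De -Te /N -[2%:R]polyC_natr.
  by rewrite !(horner_exp, hornerD, hornerN, hornerM, hornerC).
have D0 : D.[0] != 0 by rewrite De vve mulr0 addr0.
have NS r : (N r).[0] / D.[0] = ((vW p0 + 2%:R - cz p0 ^+ 2) * dW n (vW p0)
    + cz p0 * TW n (vW p0) * (cz p0 + r)) / dW n (vW p0).
  by rewrite Ne De vve zze !mulr0 !addr0.
have [M1 [K1 [M10 K10 h1]]] := ratio_near (N 2%:R) D0.
have [M2 [K2 [M20 K20 h2]]] := ratio_near (N (- 2%:R)) D0.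
set s0 := cx p0 + cy p0 in hs sg0; set t0 := cx p0 - cy p0 in hd dl0.
have [ns nt] : 0 < `|s0| /\ 0 < `|t0| by rewrite !normr_gt0.
pose L := `|bz| + (M1 / `|s0| + M2 / `|t0|).
have L0 : 0 < L by rewrite ltr_wpDl // addr_gt0 // divr_gt0.
exists L, (K1 + K2); split=> //; first exact: addr_gt0.
move=> e e0; rewrite mulrDl => Ke; have e0' := ltW e0.
have [Dne r1] : D.[e] != 0 /\ `|(N 2%:R).[e] / D.[e] - s0 ^+ 2| <= M1 * e.
  rewrite hs -NS; apply: h1 => //; apply: le_trans Ke.
  by rewrite lerDl mulr_ge0 // ltW.
have [_ r2] : D.[e] != 0 /\ `|(N (- 2%:R)).[e] / D.[e] - t0 ^+ 2| <= M2 * e.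
  rewrite hd -NS; apply: h2 => //; apply: le_trans Ke.
  by rewrite lerDr mulr_ge0 // ltW.
have [sg sgE sgc] := sqrt_near sg0 r1; have [dl dlE dlc] := sqrt_near dl0 r2.
rewrite !Ne De in sgE dlE; rewrite De in Dne.
have [vp fp] := geom_of_squares Dne sgE dlE.
exists (point ((sg + dl) / 2%:R) ((sg - dl) / 2%:R) zz.[e]); split=> //.
- by rewrite vp vve.
- by rewrite pointX zze.
have hL a b : `|a| <= M1 * e / `|s0| -> `|b| <= M2 * e / `|t0| ->
    `|(a + b) / 2%:R| <= L * e.
  move=> ha hb; rewrite normrM normfV normr_nat ler_pdivrMr ?ltr0n //.
  apply: (@le_trans _ _ (L * e)); last by rewrite ler_peMr ?ler1n // mulr_ge0 // ltW.
  apply: le_trans (ler_normD _ _) _; rewrite /L mulrDl mulrDl.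
  rewrite -[X in X <= _]add0r; apply: lerD; first by rewrite mulr_ge0.
  by apply: lerD; rewrite mulrAC.
move=> j; rewrite !tnth_coord [p0]pointE; case: (ord3_cases j) => ->; rewrite inordK // !pointX.
- have -> : (sg + dl) / 2%:R - cx p0 = ((sg - s0) + (dl - t0)) / 2%:R by rewrite /s0 /t0; field.
  exact: hL.
- have -> : (sg - dl) / 2%:R - cy p0 = ((sg - s0) + - (dl - t0)) / 2%:R by rewrite /s0 /t0; field.
  by apply: hL; rewrite ?normrN.
rewrite zze [_ - cz p0]addrAC subrr add0r normrM [`|e|]gtr0_norm //.
rewrite ler_wpM2r // lerDl.
by rewrite addr_ge0 // divr_ge0 // ltW.
Qed.

End Lift.

Section Neighbourhoods.
Variable F : numClosedFieldType.
Implicit Types (G : {mpoly F[3]}) (q : 3.-tuple F).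

Lemma half_lower (a b m : F) : `|a - b| <= m -> 2%:R * m <= `|b| -> `|b| / 2%:R <= `|a|.
Proof.
move=> h hm; rewrite ler_pdivrMr ?ltr0n // mulr_natr mulr2n.
rewrite -(lerD2r `|b|).
have h2 : `|b| <= `|a| + m.
  by rewrite -{1}[b](subrK a) addrC; apply: le_trans (ler_normD _ _) _; rewrite lerD2l distrC.
apply: le_trans (lerD h2 h2) _; rewrite addrACA lerD2l -mulr2n -mulr_natl.
exact: hm.
Qed.

Lemma meval_near_upper G q (L : F) : 0 < L -> exists B K : F, [/\ 0 < B, 0 < K &
  forall e p, 0 < e -> K * e <= 1 -> close (L * e) p q -> `|G.@[tnth p]| <= B].
Proof.
move=> L0; have [M M0 hM] := mpoly_lipschitz q G.
exists (`|G.@[tnth q]| + M), L; split=> //; first by rewrite ltr_wpDl.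
move=> e p e0 Ke cl; rewrite -[G.@[tnth p]](subrK G.@[tnth q]) addrC.
apply: le_trans (ler_normD _ _) _; rewrite lerD2l.
have Le0 : 0 <= L * e by rewrite mulr_ge0 ?ltW.
by apply: le_trans (hM _ p Le0 Ke cl) _; rewrite ler_piMr // ltW.
Qed.

Lemma meval_near_lower G q (L : F) : 0 < L -> G.@[tnth q] != 0 ->
  exists b K : F, [/\ 0 < b, 0 < K &
  forall e p, 0 < e -> K * e <= 1 -> close (L * e) p q -> b <= `|G.@[tnth p]|].
Proof.
move=> L0 Gq; have [M M0 hM] := mpoly_lipschitz q G.
have nG : 0 < `|G.@[tnth q]| by rewrite normr_gt0.
exists (`|G.@[tnth q]| / 2%:R), (L + 2%:R * M * L / `|G.@[tnth q]|); split.
- by rewrite divr_gt0 ?ltr0n.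
- by rewrite ltr_wpDr // divr_ge0 ?mulr_ge0 // ltW.
move=> e p e0; rewrite mulrDl => Ke cl; have Le0 : 0 <= L * e by rewrite mulr_ge0 ?ltW.
have t0 : 0 <= 2%:R * M * L / `|G.@[tnth q]| * e.
  by rewrite mulr_ge0 ?divr_ge0 ?mulr_ge0 // ltW.
have Le1 : L * e <= 1 by apply: le_trans Ke; rewrite lerDl.
apply: (half_lower (hM _ p Le0 Le1 cl)).
rewrite -[leRHS]mul1r -ler_pdivrMr //.
rewrite [X in X <= _](_ : _ = 2%:R * M * L / `|G.@[tnth q]| * e); last by ring.
by apply: le_trans Ke; rewrite lerDr.
Qed.

Lemma horner_near_lower (g : {poly F}) c : g.[c] != 0 ->
  exists b K : F, [/\ 0 < b, 0 < K &
  forall e, 0 < e -> K * e <= 1 -> b <= `|g.[c + e]|].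
Proof.
move=> gc; pose h := g \Po ('X + c%:P).
have hE e : h.[e] = g.[c + e] by rewrite horner_comp hornerD hornerX hornerC addrC.
have [M M0 hM] := poly_lipschitz h.
have nG : 0 < `|g.[c]| by rewrite normr_gt0.
exists (`|g.[c]| / 2%:R), (1 + 2%:R * M / `|g.[c]|); split.
- by rewrite divr_gt0 ?ltr0n.
- by rewrite ltr_wpDr // divr_ge0 ?mulr_ge0 // ltW.
move=> e e0; rewrite mulrDl mul1r => Ke; have e0' := ltW e0.
have t0 : 0 <= 2%:R * M / `|g.[c]| * e by rewrite mulr_ge0 ?divr_ge0 ?mulr_ge0 // ltW.
have e1 : e <= 1 by apply: le_trans Ke; rewrite lerDl.
have := hM e e0 e1; rewrite !hE addr0 => hm; apply: (half_lower hm).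
rewrite -[leRHS]mul1r -ler_pdivrMr //.
rewrite [X in X <= _](_ : _ = 2%:R * M / `|g.[c]| * e); last by ring.
by apply: le_trans Ke; rewrite lerDr.
Qed.

End Neighbourhoods.

(** * The order along Gamma *)

Section Geometric.
Variables (F : numClosedFieldType) (n : int).
Hypothesis n0 : n != 0.
Implicit Types (p q : 3.-tuple F) (C : 3.-tuple F -> Prop).
Local Notation cx p := (coord p 0).
Local Notation cy p := (coord p 1).
Local Notation cz p := (coord p 2).
Local Notation tau p := (tauW n (cx p) (cy p) (cz p)).
Local Notation f p := (fW n (cx p) (cy p) (cz p)).
Local Notation V := (vP F).

Lemma geometricP p : geometric n p <-> f p = 0 /\ vW p != 2%:R.
Proof.
split=> [[/XirrP [_ ?] ?] //|[f0 v2]]; split=> //.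
by apply/XirrP; rewrite f0 mulr0.
Qed.

(** From here on the functions S, d, T + 2, E, the conjugate of E, and H are
    used as elements of the polynomial ring in x, y, z. *)
Definition Sm : {mpoly F[3]} := cheb V (n - 1).
Definition dm : {mpoly F[3]} := dW n V.
Definition Tm : {mpoly F[3]} := TW n V + 2%:R.
Definition Em : {mpoly F[3]} := EW n V (X0 F) (X1 F) (X2 F).
Definition Ebm : {mpoly F[3]} := EW n V (- X0 F) (- X1 F) (X2 F).
Definition Hm : {mpoly F[3]} := HW n V (X2 F).

Lemma mevalE p :
  (Sm.@[tnth p] = cheb (vW p) (n - 1)) * (dm.@[tnth p] = dW n (vW p))
  * (Tm.@[tnth p] = TW n (vW p) + 2%:R)
  * (Em.@[tnth p] = EW n (vW p) (cx p) (cy p) (cz p))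
  * (Ebm.@[tnth p] = EW n (vW p) (- cx p) (- cy p) (cz p))
  * (Hm.@[tnth p] = HW n (vW p) (cz p)).
Proof.
have m2 : (2%:R : {mpoly F[3]}).@[tnth p] = 2%:R by exact: (rmorph_nat (meval (tnth p))).
have e1 := rmorph_dW (meval (tnth p)) n V; have e2 := rmorph_TW (meval (tnth p)) n V.
have e3 := rmorph_EW (meval (tnth p)) n V; have e4 := rmorph_HW (meval (tnth p)) n V.
rewrite /= meval_vP in e1 e2; split; [split; [split; [split; [split|]|]|]|].
- exact: meval_cheb.
- exact: e1.
- by rewrite mevalD e2 m2.
- by have := e3 (X0 F) (X1 F) (X2 F); rewrite /= meval_vP !meval_coords.
- by have := e3 (- X0 F) (- X1 F) (X2 F); rewrite /= meval_vP !mevalN !meval_coords.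
by have := e4 (X2 F); rewrite /= meval_vP !meval_coords.
Qed.

Lemma meval_tau_factor p : f p = 0 -> vW p != 2%:R ->
  (TW n (vW p) + 2%:R) * dW n (vW p) * tau p
  = cheb (vW p) (n - 1) ^+ 2 * EW n (vW p) (cx p) (cy p) (cz p).
Proof. by move=> f0 v2; exact: tau_factor. Qed.

(** The product of [tau_factor] and [E_norm]; it exhibits tau as H^2 times a
    function that is a unit at the generic point of Gamma. *)
Lemma tau_norm p : f p = 0 -> vW p != 2%:R ->
  (TW n (vW p) + 2%:R) * dW n (vW p) * EW n (vW p) (- cx p) (- cy p) (cz p) * tau p
  = - (vW p - 2%:R) * cheb (vW p) (n - 1) ^+ 2 * HW n (vW p) (cz p) ^+ 2.
Proof.
move=> f0 v2; have e1 := meval_tau_factor f0 v2; have e2 := E_norm v2 f0.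
rewrite -/(vW p) in e2.
transitivity (cheb (vW p) (n - 1) ^+ 2 * (EW n (vW p) (cx p) (cy p) (cz p)
    * EW n (vW p) (- cx p) (- cy p) (cz p))); first by rewrite mulrA -e1; ring.
by rewrite e2; ring.
Qed.

Variable T : {mpoly F[3]}.
Hypothesis torT : is_torsion_function n T.

Lemma torsion_geom p : geometric n p -> T.@[tnth p] = 2%:R * tau p.
Proof. by move/torsion_functionP: torT => h [Xp _]; apply: h. Qed.

(** At the points (x, 0, 0) of the surface, H is (v + 2) d, and [tau_norm] has
    a nonzero right-hand side for generic x. *)
Lemma torsion_not_zero_geom : ~ vanishes_on (geometric n) T.
Proof.
pose g : {poly F} := cheb 'X (n - 1) * dW n 'X * (('X + 2%:R) * ('X - 2%:R)).
have g0 : g != 0 by rewrite !mulf_neq0 ?Sp_neq0 ?dWp_neq0 ?X2p_neq0 ?Xm2p_neq0.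
have [v hv] := poly_nonroot g0; have [x hx] := sqr_exists (v + 2%:R).
move: hv; rewrite /g !hornerM horner_cheb horner_dW !mulf_eq0 !negb_or.
rewrite -polyC_natr hornerD hornerXsubC hornerX hornerC => /andP[/andP[S0 d0] /andP[v20 w0]].
pose p := point x 0 0.
have vp : vW p = v by rewrite /vW /trv /p !pointX hx; ring.
have f0 : f p = 0 by rewrite fW_geom !pointX; ring.
have gp : geometric n p by apply/geometricP; rewrite vp -subr_eq0.
move=> /(_ p gp) /eqP; rewrite torsion_geom // mulf_eq0 pnatr_eq0 /= => /eqP t0.
have v2 : vW p != 2%:R by rewrite vp -subr_eq0.
have := tau_norm f0 v2; rewrite t0 mulr0 vp => /esym /eqP.
rewrite /HW pointX mulr0 add0r; apply/negP.
by rewrite !(mulf_neq0, expf_neq0, oppr_eq0).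
Qed.

(** None of the functions T + 2, d, v + 2, x + y, x - y vanishes on Gamma, as
    their values are nonzero rational functions of the parameters; Gamma being
    irreducible, they and r are simultaneously nonzero at some point. *)
Lemma Gamma_generic (r : {mpoly F[3]}) : ~ vanishing_ideal (Gamma n) r ->
  exists q, Gamma n q /\ [/\ r.@[tnth q] != 0, TW n (vW q) + 2%:R != 0, dW n (vW q) != 0,
    vW q + 2%:R != 0 & (cx q + cy q != 0) && (cx q - cy q != 0)].
Proof.
move=> hr; have [_ prm] := Gamma_prime F n0.
(* The product of the functions that have to be nonzero at q. *)
pose G := Tm * dm * (V + 2%:R) * ((X0 F + X1 F) * (X0 F - X1 F)).
have evG q : G.@[tnth q] = (TW n (vW q) + 2%:R) * dW n (vW q) * (vW q + 2%:R)
    * ((cx q + cy q) * (cx q - cy q)).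
  rewrite /G !mevalM !mevalE [(V + _).@[_]]mevalD meval_vP (rmorph_nat (meval _)).
  by rewrite mevalD mevalB !meval_coords.
have G0 : ~ vanishing_ideal (Gamma n) G.
  pose g : {poly F} := (cheb 'X (n - 1) * ('X - 2%:R)) * ((TW n 'X + 2%:R) * dW n 'X)
     * (('X + 2%:R) * (SigW n 'X * discW F n)).
  have g0 : g != 0.
    by rewrite !mulf_neq0 ?Sp_neq0 ?Xm2p_neq0 ?TWp_neq0 ?dWp_neq0 ?X2p_neq0
      ?SigWp_neq0 ?discW_neq0.
  have [v hv] := poly_nonroot g0; have [t ht] := sqr_exists (eval1 v (discW F n)).
  move: hv; rewrite /g !hornerM -polyC_natr horner_cheb horner_dW horner_SigW
    [(TW n _ + _).[v]]hornerD horner_TW hornerXsubC [('X + _).[v]]hornerD hornerX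
    hornerC -(eval1E v) -ht.
  rewrite !mulf_eq0 !negb_or => /andP[/andP[/andP[S0 w0] /andP[T0 d0]] /and3P[v0 sg0 t0]].
  have {}t0 : t != 0 by case/andP: t0.
  have Uv : gammaU n v by split; rewrite // -subr_eq0.
  have [vp _ _] := gamma_pt_on_Gamma Uv ht.
  have Gp : Gamma n (gamma_pt n v t) by exists v, t.
  move=> /(_ _ Gp) /eqP; rewrite evG vp.
  rewrite !mulf_eq0 (negPf T0) (negPf d0) (negPf v0) /=.
  have -> : cx (gamma_pt n v t) + cy (gamma_pt n v t) = SigW n v / cheb v (n - 1) ^+ 2.
    by rewrite /gamma_pt !pointX; field; exact: S0.
  have -> : cx (gamma_pt n v t) - cy (gamma_pt n v t) = t / cheb v (n - 1) ^+ 2.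
    by rewrite /gamma_pt !pointX; field; exact: S0.
  by rewrite !mulf_eq0 invr_eq0 expf_eq0 /= (negPf S0) (negPf sg0) (negPf t0).
have rG : ~ vanishing_ideal (Gamma n) (r * G) by move=> /prm [].
have [q /not_implyP [Gq]] : exists q, ~ (Gamma n q -> (r * G).@[tnth q] = 0).
  by apply/existsNP.
rewrite mevalM evG.
move=> /eqP; rewrite !mulf_eq0 !negb_or.
by move=> /andP[rq /andP[/andP[/andP[T0 d0] v0] sd]]; exists q; split.
Qed.

(** On Gamma, E vanishes since tau does, and the difference between E and its
    conjugate is a multiple of x + y. *)
Lemma EW_bar_Gamma q : Gamma n q ->
  EW n (vW q) (- cx q) (- cy q) (cz q) = 2%:R * (vW q + 2%:R) * dW n (vW q) * (cx q + cy q)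
  /\ HW n (vW q) (cz q) = 0.
Proof.
move=> /GammaP [v2 S0 f0 t0]; split.
  have := meval_tau_factor f0 v2; rewrite t0 mulr0 => /esym /eqP.
  rewrite mulf_eq0 expf_eq0 /= (negPf S0) /= => /eqP E0.
  by rewrite -[LHS]subr0 -{1}E0 /EW; ring.
have [_ _ hz] := zero_locus v2 S0 f0 t0; rewrite -/(vW q) in hz.
apply: (mulfI (expf_neq0 2 S0)); rewrite mulr0.
transitivity ((TW n (vW q) + 2%:R) * (cheb (vW q) (n - 1) ^+ 2 * cz q)
   + (vW q + 2%:R) * dW n (vW q) * cheb (vW q) (n - 1) ^+ 2).
  by rewrite /HW; ring.
by rewrite hz -(HW_rel n v2); ring.
Qed.

(** At least 2: by [tau_norm] the torsion is H^2 times a unit. At most 2: at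
    fixed v, increasing z by e increases H from 0 to (T + 2) e, and [tau_norm]
    bounds the torsion from below by a multiple of e^2. *)
Lemma order_Gamma C : subset_of (Gamma n) C ->
  (forall P, vanishing_ideal C P <-> vanishing_ideal (Gamma n) P) ->
  order_along (geometric n) C T 2.
Proof.
move=> GC idC; split.
  have [a ea] : exists a : {mpoly F[3]}, forall p, a.@[tnth p]
      = - 2%:R * (vW p - 2%:R) * cheb (vW p) (n - 1) ^+ 2.
    exists ((- 2%:R)%:MP * (V - 2%:R%:MP) * (Sm * Sm)) => p.
    by rewrite !mevalM !mevalE mevalB !mevalC meval_vP expr2.
  exists (Tm * dm * Ebm), (Hm * (Hm * a)), (Tm * dm * Ebm * T - Hm * (Hm * a)).
  have HC : vanishing_ideal C Hm.
    by apply/idC => q Gq; rewrite mevalE (proj2 (EW_bar_Gamma Gq)).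
  split; last by rewrite addrC subrK.
  - move=> /idC h; have one : ~ vanishing_ideal (Gamma n) (1 : {mpoly F[3]}).
      move=> h1; have [[q Gq] _] := Gamma_prime F n0.
      by have /eqP := h1 q Gq; rewrite meval1 oner_eq0.
    have [q [Gq [_ T0 d0 v0 /andP[s0 _]]]] := Gamma_generic one.
    have := h q Gq; rewrite !mevalM !mevalE (proj1 (EW_bar_Gamma Gq)) => /eqP.
    by rewrite !mulf_eq0 pnatr_eq0 (negPf T0) (negPf d0) (negPf v0) (negPf s0).
  - exists [:: (Hm, Hm * a)]; rewrite big_seq1; split=> // u; rewrite inE => /eqP ->.
    split=> //; exists [:: (Hm, a)]; rewrite big_seq1; split=> // u'.
    by rewrite inE => /eqP ->.
  move=> p gp; have [f0 v2] := proj1 (geometricP p) gp.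
  rewrite mevalB !mevalM !mevalE torsion_geom // ea.
  transitivity (2%:R * ((TW n (vW p) + 2%:R) * dW n (vW p)
      * EW n (vW p) (- cx p) (- cy p) (cz p) * tau p
     + (vW p - 2%:R) * cheb (vW p) (n - 1) ^+ 2 * HW n (vW p) (cz p) ^+ 2)); first by ring.
  by rewrite tau_norm //; ring.
apply: order_upper => r rC.
have [q [Gq [rq T0 d0 v0 /andP[s0 t0]]]] : exists q, Gamma n q /\ _ :=
  Gamma_generic (fun h => rC (proj2 (idC r) h)).
have [v2 S0 f0 tq] := proj1 (GammaP n q) Gq.
exists q; split=> //; first exact: GC.
(* Test points with v fixed and z moved by e. *)
have [L [K [L0 K0 lift]]] := geom_lift 0 1 f0 d0 s0 t0.
have [B [K' [B0 K'0 up]]] := meval_near_upper (Tm * dm * Ebm) q L0.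
pose c0 := `|(vW q - 2%:R) * cheb (vW q) (n - 1) ^+ 2 * (TW n (vW q) + 2%:R) ^+ 2|.
have c00 : 0 < c0 by rewrite normr_gt0 !mulf_neq0 ?expf_neq0 // subr_eq0.
exists L, (c0 / B), (K + K'); split=> //; [exact: divr_gt0 | exact: addr_gt0 |].
move=> e e0; rewrite mulrDl => Ke; have e0' := ltW e0.
have [|p [vp zp fp cl]] := lift e e0.
  by apply: le_trans Ke; rewrite lerDl mulr_ge0 // ltW.
rewrite mul0r addr0 in vp; rewrite mul1r in zp.
have gp : geometric n p by apply/geometricP; rewrite vp.
exists p; split=> //; rewrite torsion_geom //.
have Hp : HW n (vW p) (cz p) = (TW n (vW q) + 2%:R) * e.
  rewrite -[RHS]addr0 -(proj2 (EW_bar_Gamma Gq)) vp zp /HW; ring.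
have v2p : vW p != 2%:R by rewrite vp.
have upp : `|(Tm * dm * Ebm).@[tnth p]| <= B.
  by apply: (up e p e0 _ cl); apply: le_trans Ke; rewrite lerDr mulr_ge0 // ltW.
have key : c0 * e ^+ 2 = `|(Tm * dm * Ebm).@[tnth p]| * `|tau p|.
  rewrite -normrM !mevalM !mevalE tau_norm // Hp vp /c0.
  rewrite -[e ^+ 2]ger0_norm ?exprn_ge0 // -normrM -normrN; congr (`|_|); ring.
rewrite mulrAC ler_pdivrMr // key [leRHS]mulrC normrM normr_nat.
apply: ler_pM => //; rewrite mulr_natl mulr2n lerDl //.
Qed.

End Geometric.

(** * The order along the curves v = c, xy = 2 z *)

Section Biquadratic.
Variables (F : numClosedFieldType) (n : int).
Hypothesis n0 : n != 0.
Implicit Types (p q : 3.-tuple F) (C : 3.-tuple F -> Prop).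
Local Notation cx p := (coord p 0).
Local Notation cy p := (coord p 1).
Local Notation cz p := (coord p 2).
Local Notation tau p := (tauW n (cx p) (cy p) (cz p)).
Local Notation f p := (fW n (cx p) (cy p) (cz p)).

Variable T : {mpoly F[3]}.
Hypothesis torT : is_torsion_function n T.

Variable c : F.
Hypotheses (c2 : c != 2%:R) (Sc : cheb c (n - 1) = 0) (Pc : chebP c n = 0).

Definition biquadratic p : Prop := vW p = c /\ cx p * cy p = 2%:R * cz p.

Lemma dW_c : dW n c = 1.
Proof. by rewrite /dW Pc mulr0 addr0. Qed.

Lemma TW_c : TW n c = 2%:R.
Proof. by rewrite /TW Sc mulr0 add0r dW_c mulr1. Qed.

Lemma biquadratic_fW p : biquadratic p -> f p = 0.
Proof.
by move=> [vp hz]; rewrite fW_geom -/(vW p) vp dW_c TW_c hz; ring.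
Qed.

Lemma biquadratic_tau p : biquadratic p -> tau p = 0.
Proof. by move=> [vp hz]; rewrite /tauW -/(vW p) vp Sc Pc !mulr0 addr0. Qed.

(** At the points (0, y, 0) of the curve, H = v + 2 is not zero, so E is not
    zero by [E_norm], and neither are x + y and x - y. Since the curve is
    irreducible, r is nonzero at some point with the same properties. *)
Lemma biquadratic_generic (r : {mpoly F[3]}) : ~ vanishing_ideal biquadratic r ->
  exists q, biquadratic q /\ [/\ r.@[tnth q] != 0, (Em F n).@[tnth q] != 0,
    cx q + cy q != 0 & cx q - cy q != 0].
Proof.
move=> hr; have [_ prm] := biquadratic_prime c2.
pose G := Em F n * ((X0 F + X1 F) * (X0 F - X1 F)).
have evG q : G.@[tnth q] = (Em F n).@[tnth q] * ((cx q + cy q) * (cx q - cy q)).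
  by rewrite /G !mevalM [(X0 F + X1 F).@[_]]mevalD mevalB !meval_coords.
have [c20 _] := cheb_simple_root n0 Sc.
have G0 : ~ vanishing_ideal biquadratic G.
  have [y hy] := sqr_exists (c + 2%:R).
  have y0 : y != 0 by rewrite -sqrf_eq0 hy.
  have vp : vW (point 0 y 0) = c by rewrite /vW /trv !pointX hy; ring.
  have cp : biquadratic (point 0 y 0) by split=> //; rewrite !pointX; ring.
  have v2 : vW (point 0 y 0) != 2%:R by rewrite vp.
  have := E_norm v2 (biquadratic_fW cp); rewrite -/(vW (point 0 y 0)) vp /HW dW_c TW_c !pointX => hE.
  move=> /(_ _ cp) /eqP; rewrite evG mevalE vp !pointX add0r sub0r.
  rewrite !mulf_eq0 oppr_eq0 (negPf y0) !orbF => /eqP E0.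
  move: hE; rewrite E0 mul0r => /esym /eqP; apply/negP.
  by rewrite !(mulf_neq0, expf_neq0, oppr_eq0) ?subr_eq0 // mulr0 add0r mulr1.
have rG : ~ vanishing_ideal biquadratic (r * G) by move=> /prm [].
have [q /not_implyP [Gq]] : exists q, ~ (biquadratic q -> (r * G).@[tnth q] = 0).
  by apply/existsNP.
rewrite mevalM evG => /eqP; rewrite !mulf_eq0 !negb_or.
by move=> /and4P[rq E0 s0 t0]; exists q; split.
Qed.

(** At least 2: by [tau_factor] the torsion is S^2 times a unit. At most 2:
    increasing v by e at fixed z makes S a nonzero multiple of e to first
    order, because c is a simple root of S. *)
Lemma order_biquadratic C : subset_of biquadratic C ->
  (forall P, vanishing_ideal C P <-> vanishing_ideal biquadratic P) ->
  order_along (geometric n) C T 2.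
Proof.
move=> GC idC.
have one : ~ vanishing_ideal biquadratic (1 : {mpoly F[3]}).
  move=> h1; have [[q Gq] _] := biquadratic_prime c2.
  by have /eqP := h1 q Gq; rewrite meval1 oner_eq0.
split.
  have [a ea] : exists a : {mpoly F[3]}, forall p, a.@[tnth p] = 2%:R * (Em F n).@[tnth p].
    by exists (2%:R%:MP * Em F n) => p; rewrite mevalM mevalC.
  exists (Tm F n * dm F n), (Sm F n * (Sm F n * a)), (Tm F n * dm F n * T - Sm F n * (Sm F n * a)).
  have SC : vanishing_ideal C (Sm F n).
    by apply/idC => q [vq _]; rewrite mevalE vq.
  split; last by rewrite addrC subrK.
  - move=> /idC h; have [q [Gq _]] := biquadratic_generic one.
    have := h q Gq; rewrite !mevalM !mevalE (proj1 Gq) dW_c TW_c => /eqP.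
    by rewrite mulr1 -natrD pnatr_eq0.
  - exists [:: (Sm F n, Sm F n * a)]; rewrite big_seq1; split=> // u; rewrite inE => /eqP ->.
    split=> //; exists [:: (Sm F n, a)]; rewrite big_seq1; split=> // u'.
    by rewrite inE => /eqP ->.
  move=> p gp; have [f0 v2] := proj1 (geometricP n p) gp.
  rewrite mevalB !mevalM !mevalE (torsion_geom torT) // ea mevalE.
  transitivity (2%:R * ((TW n (vW p) + 2%:R) * dW n (vW p) * tau p
     - cheb (vW p) (n - 1) ^+ 2 * EW n (vW p) (cx p) (cy p) (cz p))); first by ring.
  by rewrite meval_tau_factor // subrr mulr0.
apply: order_upper => r rC.
have [q [Gq [rq E0 s0 t0]]] : exists q, biquadratic q /\ _ :=
  biquadratic_generic (fun h => rC (proj2 (idC r) h)).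
have f0 := biquadratic_fW Gq; have [vq _] := Gq.
have d0 : dW n (vW q) != 0 by rewrite vq dW_c oner_neq0.
exists q; split=> //; first exact: GC.
(* Test points with z fixed and v moved by e. *)
have [L [K1 [L0 K10 lift]]] := geom_lift 1 0 f0 d0 s0 t0.
have [B [K2 [B0 K20 up]]] := meval_near_upper (Tm F n * dm F n) q L0.
have [b [K3 [b0 K30 low]]] := meval_near_lower L0 E0.
have [_ [g gc gE]] := cheb_simple_root n0 Sc.
have [b' [K4 [b'0 K40 low']]] := horner_near_lower gc.
have c20 : 0 < `|2%:R - c| by rewrite normr_gt0 subr_eq0 eq_sym.
(* The bound K5 e <= 1 keeps v = c + e away from 2. *)
pose K5 := 2%:R / `|2%:R - c|; have K50 : 0 < K5 by rewrite divr_gt0 ?ltr0n.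
exists L, (b' ^+ 2 * b / B), (K1 + (K2 + (K3 + (K4 + K5)))); split=> //.
- by rewrite divr_gt0 ?mulr_gt0 ?exprn_gt0.
- by rewrite !addr_gt0.
move=> e e0; rewrite !mulrDl => Ke; have e0' := ltW e0.
have pos (k : F) : 0 < k -> 0 <= k * e by move=> k0; rewrite mulr_ge0 // ltW.
have [k1 k2 k3] : [/\ K1 * e <= 1, K2 * e <= 1 & K3 * e <= 1].
  split; apply: le_trans Ke; first by rewrite lerDl !addr_ge0 ?pos.
    by rewrite addrCA lerDl !addr_ge0 ?pos.
  by rewrite [K2 * e + _]addrCA [K1 * e + _]addrCA lerDl !addr_ge0 ?pos.
have [k4 k5] : K4 * e <= 1 /\ K5 * e <= 1.
  split; apply: le_trans Ke; last by rewrite !addrA lerDr !addr_ge0 ?pos.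
  by rewrite !addrA [_ + K4 * e + _]addrAC lerDr !addr_ge0 ?pos.
have [p [vp zp fp cl]] := lift e e0 k1; rewrite mul1r vq in vp.
have v2p : vW p != 2%:R.
  rewrite vp; apply: contraTneq k5 => cE.
  have eE : 2%:R - c = e by rewrite -cE addrAC subrr add0r.
  by rewrite /K5 eE gtr0_norm // divfK ?gt_eqF // lt_geF ?ltr1n.
have gp : geometric n p by apply/geometricP.
exists p; split=> //; rewrite (torsion_geom torT) //.
have upp : `|(Tm F n * dm F n).@[tnth p]| <= B by apply: (up e p).
have lowp : b <= `|(Em F n).@[tnth p]| by apply: (low e p).
have Sp' : cheb (vW p) (n - 1) = g.[c + e] * e.
  by rewrite -horner_cheb gE hornerM hornerXsubC vp [c + e - c]addrAC subrr add0r.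
have := meval_tau_factor fp v2p.
have := @mevalE F n p; move=> [[[[[_ dE] TE] EE] _] _].
rewrite -EE -TE -dE -mevalM => /(congr1 (fun u => `|u|)).
rewrite [LHS]normrM [RHS]normrM normrX Sp' [`|_ * e|]normrM (gtr0_norm e0) exprMn => key.
rewrite mulrAC ler_pdivrMr //.
apply: (@le_trans _ _ (`|(Tm F n * dm F n).@[tnth p]| * `|tau p|)).
  rewrite key mulrAC; apply: ler_pM => //.
  - by rewrite mulr_ge0 ?exprn_ge0 // ltW.
  - exact: ltW.
  rewrite ler_wpM2r ?exprn_ge0 // lerXn2r ?nnegrE ?(ltW b'0) //.
  exact: low'.
rewrite [leRHS]mulrC normrM normr_nat.
by apply: ler_pM => //; rewrite mulr_natl mulr2n lerDl.
Qed.

End Biquadratic.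

(** * The divisor on the geometric surface *)

Section Final.
Variables (F : numClosedFieldType) (n : int).
Hypothesis n0 : n != 0.
Implicit Types (p q : 3.-tuple F) (C : 3.-tuple F -> Prop).
Local Notation cx p := (coord p 0).
Local Notation cy p := (coord p 1).
Local Notation cz p := (coord p 2).

Variable T : {mpoly F[3]}.
Hypothesis torT : is_torsion_function n T.

(** A component of the zero set of the torsion lies in S = 0 or in the closure
    of Gamma. In the first case v is a constant c on it, and it is contained
    in the curve xy = 2 z of the surface v = c; in both cases
    [dense_component] gives its ideal. *)
Theorem geometric_divisor : divisor_has_multiplicity (geometric n) T 2.
Proof.
split=> [|C compC]; first exact: torsion_not_zero_geom.
have [CZ irrC _] := compC.
have tau0 p : C p -> [/\ fW n (cx p) (cy p) (cz p) = 0, vW p != 2%:R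
    & tauW n (cx p) (cy p) (cz p) = 0].
  move=> /CZ [gp Tp]; have [f0 v2] := proj1 (geometricP n p) gp; split=> //.
  by move/eqP: Tp; rewrite (torsion_geom torT gp) mulf_eq0 pnatr_eq0 => /eqP.
have inZ p : fW n (cx p) (cy p) (cz p) = 0 -> vW p != 2%:R ->
    tauW n (cx p) (cy p) (cz p) = 0 -> geometric n p /\ T.@[tnth p] = 0.
  move=> f0 v2 t0; have gp : geometric n p by apply/geometricP.
  by rewrite (torsion_geom torT gp) t0 mulr0.
have [S0|CG] : subset_of C (zeros (Sm F n)) \/ subset_of C (zclosure (Gamma n)).
  have [_ irr] := irrC; apply: irr; [exact: zclosed_zeros | exact: zclosed_closure |].
  move=> p /tau0 [f0 v2 t0].
  have [S0|S0] := eqVneq (cheb (vW p) (n - 1)) 0.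
    by left; rewrite /zeros mevalE.
  by right=> P; apply; apply/GammaP.
- have [|c hc Cc] := irr_const_value irrC (Sp_neq0 F n0) (V := vP F).
    by move=> p Cp; have := S0 p Cp; rewrite /zeros mevalE horner_cheb meval_vP.
  rewrite horner_cheb in hc.
  have Cc' p : C p -> vW p = c by move=> Cp; rewrite -meval_vP Cc.
  have [[p0 Cp0] _] := irrC; have [f0 v2 t0] := tau0 p0 Cp0.
  have c2 : c != 2%:R by rewrite -(Cc' p0 Cp0).
  have Pc : chebP c n = 0.
    have S0' : cheb (vW p0) (n - 1) = 0 by rewrite Cc'.
    by have [_] := zero_locus_S0 v2 S0' f0 t0; rewrite -/(vW p0) Cc'.
  have sub : subset_of (biquadratic c) (fun p => geometric n p /\ T.@[tnth p] = 0).
    move=> p cp; apply: inZ; [exact: (biquadratic_fW hc Pc cp) | by rewrite (proj1 cp) |].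
    exact: (biquadratic_tau hc Pc cp).
  have sub' : subset_of C (zclosure (biquadratic c)).
    move=> p Cp P; apply; split; first exact: Cc'.
    have [f1 v1 t1] := tau0 p Cp; have S1 : cheb (vW p) (n - 1) = 0 by rewrite Cc'.
    by have [] := zero_locus_S0 v1 S1 f1 t1.
  have [sC idC] := dense_component compC (biquadratic_prime c2) sub sub'.
  exact: (order_biquadratic n0 torT c2 hc Pc sC idC).
have sub : subset_of (Gamma n) (fun p => geometric n p /\ T.@[tnth p] = 0).
  by move=> p /GammaP [v2 _ f0 t0]; apply: inZ.
have [sC idC] := dense_component compC (Gamma_prime F n0) sub CG.
exact: order_Gamma.
Qed.

Theorem torsion_function_exists : exists T : {mpoly F[3]}, is_torsion_function n T.
Proof.
exists (2%:R%:MP * tauP F n); apply/torsion_functionP => p _.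
by rewrite mevalM mevalC meval_tauP.
Qed.

End Final.

Theorem theorem1p7 (R : realType) (n : int) (hn : n != 0) :
  (exists T : {mpoly R[i][3]}, is_torsion_function n T) /\
  forall T : {mpoly R[i][3]}, is_torsion_function n T ->
    divisor_has_multiplicity (geometric n) T 2 /\
    (forall Y : 3.-tuple R[i] -> Prop, other_component n Y ->
       divisor_has_multiplicity Y T 1 \/ vanishes_on Y T).
Proof.
split; first exact: torsion_function_exists.
move=> T torT; split; first exact: geometric_divisor.
by move=> Y; exact: other_component_divisor.
Qed.
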